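(* In the case $S=\mathbb R^d$, the point spectrum of $\mathcal A^{\rm hom}$ consists of those eigenvalues of $-\Delta_{\mathcal O}$ whose eigenfunctions have zero mean: $$\operatorname{Sp}_p(\mathcal A^{\rm hom})=\{\lambda\in\operatorname{Sp}_p(-\Delta_{\mathcal O}):\ \exists\,\psi\in W_0^{1,2}(\mathcal O),\ \psi\ne0,\ \text{such that } -\Delta_{\mathcal O}\psi=\lambda\psi,\ \langle\psi\rangle=0\}.$$
   Context: **Probability setting.** $(\Omega,\mathcal F,P)$ is a complete probability space with countably generated $\sigma$-algebra, equipped with an ergodic dynamical system $\{T_x\}_{x\in\mathbb R^d}$: measurable bijections $T_x:\Omega\to\Omega$ with $T_x\circ T_y=T_{x+y}$, $P(T_xF)=P(F)$ for $F\in\mathcal F$, $(x,\omega)\mapsto T_x\omega$ measurable, and such that every measurable $f$ with $f(T_x\omega)=f(\omega)$ for all $x$ and a.e. $\omega$ is a.e. constant. The realisation of a function $f$ on $\Omega$ is $x\mapsto f(T_x\omega)$. **Inclusions (standing assumption).** An open set $U\subset\mathbb R^d$ is $(\rho,\mathcal N,\gamma)$ minimally smooth if there is a countable family of open sets $U_i$ covering $\partial U$ such that each $x\in\mathbb R^d$ lies in at most $\mathcal N$ of them, for each $x\in\partial U$ the ball $B_\rho(x)$ is contained in some $U_i$, and each portion $\partial U\cap U_i$ is, in some Cartesian frame, the graph of a Lipschitz function with Lipschitz seminorm at most $\gamma$. $\mathcal O\subset\Omega$ is a measurable set with $0<P(\mathcal O)<1$, and $\mathcal O_\omega:=\{x\in\mathbb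 R^d: T_x\omega\in\mathcal O\}$. There are constants $\rho,\mathcal N,\gamma$ and $r_0>0$, independent of $\omega$, such that for a.e. $\omega$ the set $\mathbb R^d\setminus\overline{\mathcal O_\omega}$ is connected and $\mathcal O_\omega=\bigcup_{k=1}^\infty\mathcal O_\omega^k$, where each $\mathcal O^k_\omega$ is open, connected, $(\rho,\mathcal N,\gamma)$ minimally smooth, has diameter $<1/2$, and $\operatorname{dist}(\mathcal O_\omega^k,\mathcal O_\omega^l)>r_0$ for $k\ne l$. **Spaces and operators.** $\mathcal D_j$ is the infinitesimal generator in $L^2(\Omega)$ of $f\mapsto f(T_{te_j}\,\cdot)$; $\nabla_\omega=(\mathcal D_1,\dots,\mathcal D_d)$; $W^{1,2}(\Omega)=\bigcap_j{\rm dom}(\mathcal D_j)$; $W_0^{1,2}(\mathcal O)=\{v\in W^{1,2}(\Omega): \mathbf 1_{\mathcal O}v=v\}$. Functions on $\mathcal O$ are extended by zero to $\Omega$; $\langle f\rangle=\int_\Omega f\,dP$. $-\Delta_{\mathcal O}$ is the self-adjoint operator in $L^2(\mathcal O)$ generated by the form $\int_{\mathcal O}\nabla_\omega u\cdot\nabla_\omega v$, $u,v\in W_0^{1,2}(\mathcal O)$. A field $f\in L^2(\Omega;\mathbb R^d)$ is potential if a.e. realisation is the gradient of a function in $W^{1,2}_{\rm loc}(\mathbb R^d)$; $\mathcal V^2_{\rm pot}$ is the space of potential fields with zero mean. $A_1$ is a symmetric positive-definite $d\times d$ matrix, and $A_1^{\rm hom}\xi\cdot\xi=\inf_{p\in\mathcal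 V^2_{\rm pot}}\int_{\Omega\setminus\mathcal O}A_1(\xi+p)\cdot(\xi+p)$, $\xi\in\mathbb R^d$. Set $H=L^2(\mathbb R^d)+L^2(\mathbb R^d\times\mathcal O)\subset L^2(\mathbb R^d\times\Omega)$ and $V=W^{1,2}(\mathbb R^d)+L^2(\mathbb R^d,W_0^{1,2}(\mathcal O))$. $\mathcal A^{\rm hom}$ is the self-adjoint operator in $H$ generated by the form $\int_{\mathbb R^d}A_1^{\rm hom}\nabla u_0\cdot\nabla\varphi_0+\int_{\mathbb R^d\times\Omega}\nabla_\omega u_1\cdot\nabla_\omega\varphi_1$, $u_0+u_1,\ \varphi_0+\varphi_1\in V$. $\operatorname{Sp}_p$ denotes the point spectrum (set of eigenvalues). *)

(* Defs.v *)
From HB Require Import structures.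
From mathcomp Require Import all_boot all_order all_algebra.
From mathcomp Require Import all_classical all_reals all_analysis.

Set Implicit Arguments.
Unset Strict Implicit.
Unset Printing Implicit Defensive.

Import Order.TTheory GRing.Theory Num.Theory.
Import numFieldNormedType.Exports.

Local Open Scope classical_set_scope.
Local Open Scope ring_scope.

Definition measure_rv_display : measure_display.
Proof. exact: default_measure_display. Qed.

Section rv_measurable.
Context {R : realType} {n : nat}.

(* The sigma-algebra generated by the coordinates, as for [n.-tuple R] in the
   library; on R^n it coincides with the Borel sigma-algebra. *)
Let coords (i : 'I_n) (x : 'rV[R]_n) : R := x 0 i.

Let rv_set0 : g_sigma_preimage coords set0.
Proof. exact: sigma_algebra0. Qed.

Let rv_setC A : g_sigma_preimage coords A -> g_sigma_preimage coords (~` A).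
Proof. exact: sigma_algebraC. Qed.

Let rv_bigcup (F : (set 'rV[R]_n)^nat) :
  (forall i, g_sigma_preimage coords (F i)) ->
  g_sigma_preimage coords (\bigcup_i (F i)).
Proof. exact: sigma_algebra_bigcup. Qed.

HB.instance Definition _ := @isMeasurable.Build measure_rv_display
  'rV[R]_n (g_sigma_preimage coords) rv_set0 rv_setC rv_bigcup.

Lemma measurable_coord (i : 'I_n) :
  measurable_fun [set: 'rV[R]_n] (fun x : 'rV[R]_n => x 0 i).
Proof.
move=> _ Y mY; rewrite setTI; apply: sub_sigma_algebra.
rewrite (bigD1 i)//=; left; exists Y => //.
by rewrite setTI.
Qed.

Lemma measurable_fun_rv d (T : measurableType d) (f : T -> 'rV[R]_n) :
  (forall i, measurable_fun setT (fun t => f t 0 i)) -> measurable_fun setT f.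
Proof.
move=> mf _ Y; rewrite setTI.
apply: (@smallest_sub _ _ _ (fun Y => measurable (f @^-1` Y))).
  split => [|A|F mF]; first by rewrite preimage_set0.
  - by rewrite setTD preimage_setC => mA; exact: measurableC.
  - by rewrite preimage_bigcup; exact: bigcup_measurable.
elim/big_ind : _ => [//|A B hA hB Z [/hA|/hB]//|i _ Z [B mB <-]].
by rewrite setTI -comp_preimage -[X in measurable X]setTI; exact: mf.
Qed.

End rv_measurable.

Section rv_cons.
Context {R : realType} {n : nat}.

Definition rv_cons (z : measurableTypeR R * 'rV[R]_n) : 'rV[R]_n.+1 :=
  row_mx (z.1 : R)%:M z.2 : 'rV[R]_(1 + n).

Lemma measurable_rv_cons : measurable_fun setT rv_cons.
Proof.
apply: measurable_fun_rv => i; rewrite /rv_cons.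
case: (split_ordP (i : 'I_(1 + n))) => j ->.
  rewrite [X in measurable_fun _ X](_ : _ = fst); first exact: measurable_fst.
  apply/funext => z.
  by rewrite (row_mxEl (z.1 : R)%:M) !ord1 mxE eqxx mulr1n.
rewrite [X in measurable_fun _ X](_ : _ = (fun x : 'rV[R]_n => x 0 j) \o snd).
  exact: measurableT_comp (measurable_coord j) measurable_snd.
by apply/funext => z; rewrite (row_mxEr (z.1 : R)%:M).
Qed.

HB.instance Definition _ := isMeasurableFun.Build _ _ _ _ rv_cons
  measurable_rv_cons.

Variable mu : {sigma_finite_measure set 'rV[R]_n -> \bar R}.

Definition lebesgue_succ := pushforward (lebesgue_measure \x mu)%E rv_cons.

Let lebesgue_succ0 : lebesgue_succ set0 = 0%E.
Proof. exact: measure0. Qed.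

Let lebesgue_succ_ge0 A : (0 <= lebesgue_succ A)%E.
Proof. exact: measure_ge0. Qed.

Let lebesgue_succ_sigma_additive : semi_sigma_additive lebesgue_succ.
Proof. exact: measure_semi_sigma_additive. Qed.

HB.instance Definition _ := isMeasure.Build _ _ _ lebesgue_succ
  lebesgue_succ0 lebesgue_succ_ge0 lebesgue_succ_sigma_additive.

Let lebesgue_succ_sigma_finite : sigma_finite setT lebesgue_succ.
Proof.
have mrs : measurable_fun [set: 'rV[R]_n.+1]
    (fun y : 'rV[R]_(1 + n) => rsubmx y).
  apply: measurable_fun_rv => i; apply: (@eq_measurable_fun _ _ _ _ _
    (fun y : 'rV[R]_n.+1 => y 0 (rshift 1 i))) => [y _|]; first by rewrite mxE.
  exact: measurable_coord.
have muncons : measurable_fun [set: 'rV[R]_n.+1] (fun y : 'rV[R]_(1 + n) =>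
    (y 0 (lshift n 0) : measurableTypeR R, rsubmx y)).
  by apply/measurable_fun_pairP; split => //; exact: measurable_coord.
have /sigma_finiteP[F [FT ndF Foo]] := sigma_finiteT (@lebesgue_measure R).
have /sigma_finiteP[G [GT ndG Goo]] := sigma_finiteT mu.
pose uncons (y : 'rV[R]_(1 + n)) := (y 0 (lshift n 0), rsubmx y).
exists (fun k => uncons @^-1` (F k `*` G k)).
  rewrite -preimage_bigcup -[LHS](preimage_setT uncons); congr (_ @^-1` _).
  rewrite -setXTT FT GT; apply/seteqP; split => [[x y]|[x y] [k _ []/= ? ?]].
    move=> [/= [i _ Fix] [j _ Gjy]]; exists (maxn i j) => //; split => /=.
      by move: Fix; exact/subsetPset/ndF/leq_maxl.
    by move: Gjy; exact/subsetPset/ndG/leq_maxr.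
  by split; exists k.
move=> k; have [mF Fk] := Foo k; have [mG Gk] := Goo k; split.
  by rewrite -[X in measurable X]setTI; apply: muncons => //; exact: measurableX.
rewrite /lebesgue_succ /pushforward -comp_preimage /=.
rewrite (_ : uncons \o _ = id); last first.
  apply/funext => -[x y] /=; rewrite /uncons /rv_cons (row_mxEl (x : R)%:M).
  by rewrite row_mxKr mxE eqxx mulr1n.
rewrite preimage_id product_measure1E//= lte_mul_pinfty// ge0_fin_numE//.
Qed.

HB.instance Definition _ := Measure_isSigmaFinite.Build _ _ _ lebesgue_succ
  lebesgue_succ_sigma_finite.

End rv_cons.

(* Lebesgue measure on R^n: a point mass on R^0, then an iterated product. *)
Fixpoint leb (R : realType) (n : nat) :
    {sigma_finite_measure set 'rV[R]_n -> \bar R} :=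
  match n with
  | 0 => dirac (0 : 'rV[R]_0)
  | m.+1 => lebesgue_succ (leb R m)
  end.

(* The library norm on ['rV[R]_d] is the sup norm, hence the following. *)

Section euclidean.
Context {R : realType} {d : nat}.
Implicit Types (x y : 'rV[R]_d) (A B U : set 'rV[R]_d).

Definition dotv x y : R := (x *m y^T) 0 0.

Definition enorm x : R := Num.sqrt (dotv x x).

Definition eball x (r : R) : set 'rV[R]_d := [set y | enorm (y - x) < r].

Definition euclid_diam A : \bar R :=
  ereal_sup [set (enorm (x - y))%:E | x in A & y in A].

(* The distance to an empty set is +oo. *)
Definition euclid_dist A B : \bar R :=
  ereal_inf [set (enorm (x - y))%:E | x in A & y in B].

Definition bndry A : set 'rV[R]_d := closure A `\` interior A.

Definition basisv (i : 'I_d) : 'rV[R]_d := delta_mx 0 i.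

(* [mxform A x y] is (A x) . y, for column vectors x and y stored as rows. *)
Definition mxform (A : 'M[R]_d) x y : R := dotv (x *m A^T) y.

End euclidean.

Section minimally_smooth.
Context {R : realType} {d : nat}.
Implicit Types (U S : set 'rV[R]_d).

(* [Q] is the change to the coordinates of the Cartesian frame, [i] is the
   vertical axis and [phi], with domain [D], is a function of the other d - 1
   coordinates; [phi] absorbs the choice of the origin of the frame. *)
Definition lipschitz_graph (gamma : R) S :=
  exists (Q : 'M[R]_d) (i : 'I_d) (D : set 'rV[R]_d.-1) (phi : 'rV[R]_d.-1 -> R),
    [/\ Q *m Q^T = 1%:M,
        forall y z, D y -> D z -> `|phi y - phi z| <= gamma * enorm (y - z) &
        S = [set x | D (col' i (x *m Q)) /\
                     (x *m Q) 0 i = phi (col' i (x *m Q))]].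

Definition minimally_smooth (rho : R) (N : nat) (gamma : R) U :=
  exists W : (set 'rV[R]_d)^nat,
    [/\ forall i, open (W i),
        bndry U `<=` \bigcup_i W i,
        forall x, ([set i | W i x] #<= `I_N)%card,
        forall x, bndry U x -> exists i, eball x rho `<=` W i &
        forall i, lipschitz_graph gamma (bndry U `&` W i)].

End minimally_smooth.

Section dynamical_system.
Context {R : realType} {d : nat} {disp : measure_display}
  {Omega : measurableType disp}.
Variables (P : probability Omega R) (T : 'rV[R]_d -> Omega -> Omega).

(* Measurability with respect to the completion of [mu]. *)
Definition completed_measurable disp' (X : measurableType disp')
    (mu : set X -> \bar R) (A : set X) :=
  exists2 B, measurable B & mu.-negligible (A `+` B).

(* A complete sigma-algebra is countably generated in the sense that, up to
   P-null sets, it is the sigma-algebra generated by a sequence of events. *)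
Definition countably_generated :=
  exists2 G : (set Omega)^nat, (forall n, measurable (G n)) &
    forall F, measurable F ->
      exists2 F', <<s range G >> F' & P.-negligible (F `+` F').

(* As P is complete, joint measurability refers to the completion of dx * P. *)
Record ergodic_dynamical_system : Prop := {
  shift_bij : forall x, bijective (T x);
  shift_measurable : forall x, measurable_fun setT (T x);
  shiftD : forall x y w, T x (T y w) = T (x + y) w;
  shift_measure : forall x F, measurable F -> P (T x @` F) = P F;
  shift_jointly_measurable : forall F, measurable F ->
    completed_measurable (leb R d \x P)%E [set z | F (T z.1 z.2)];
  shift_ergodic : forall f : Omega -> R, measurable_fun setT f ->
    (forall x, {ae P, forall w, f (T x w) = f w}) ->
    exists c, {ae P, forall w, f w = c} }.

Definition realised_set (O : set Omega) (w : Omega) : set 'rV[R]_d :=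
  [set x | O (T x w)].

Record random_inclusions (O : set Omega) (rho : R) (N : nat) (gamma r0 : R) :
    Prop := {
  inclusions_measurable : measurable O;
  inclusions_proba : (0 < P O < 1)%E;
  inclusions_rho : 0 < rho;
  inclusions_gamma : 0 <= gamma;
  inclusions_r0 : 0 < r0;
  inclusions_ae : {ae P, forall w,
    connected (~` closure (realised_set O w)) /\
    exists Ok : (set 'rV[R]_d)^nat,
      [/\ realised_set O w = \bigcup_k Ok k,
          forall k, [/\ open (Ok k), connected (Ok k),
                       minimally_smooth rho N gamma (Ok k) &
                       (euclid_diam (Ok k) < (2^-1)%:E)%E] &
          forall k l, k <> l -> (r0%:E < euclid_dist (Ok k) (Ok l))%E]} }.

(* [f \in dom D_j] and [D_j f = g]: g is the limit in L^2(Omega) of the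
   difference quotients of f along e_j. *)
Definition stoch_deriv (j : 'I_d) (f g : Omega -> R) :=
  [/\ f \in Lfun P 2%:E, g \in Lfun P 2%:E &
      ('N[P]_2%:E [(fun w => ((f (T (t *: basisv j) w) - f w) / t - g w)%R%:E)])%E
        @[t --> (0 : R)^'] --> 0%E].

Definition stoch_grad (f : Omega -> R) (g : Omega -> 'rV[R]_d) :=
  forall j, stoch_deriv j f (fun w => g w 0 j).

Definition W12_Omega (f : Omega -> R) :=
  forall j, exists g, stoch_deriv j f g.

Definition supported_in (O : set Omega) (f : Omega -> R) :=
  {ae P, forall w, \1_O w * f w = f w}.

Definition W120 (O : set Omega) (f : Omega -> R) :=
  W12_Omega f /\ supported_in O f.

Definition L2_in (O : set Omega) (f : Omega -> R) :=
  f \in Lfun P 2%:E /\ supported_in O f.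

(* [u] is in the domain of the operator generated by the form, with image [f]. *)
Definition neg_Delta (O : set Omega) (u f : Omega -> R) :=
  [/\ W120 O u, L2_in O f &
      forall v gu gv, W120 O v -> stoch_grad u gu -> stoch_grad v gv ->
        \int[P]_(w in O) dotv (gu w) (gv w) = \int[P]_(w in O) (f w * v w)].

End dynamical_system.

Section sobolev.
Context {R : realType} {d : nat}.
Implicit Types (u : 'rV[R]_d -> R) (g : 'rV[R]_d -> 'rV[R]_d).

Definition iter_partial (s : seq 'I_d) (f : 'rV[R]_d -> R) : 'rV[R]_d -> R :=
  foldr (fun i h => fun x => 'D_(basisv i) h x) f s.

Definition smooth (f : 'rV[R]_d -> R) :=
  forall s x, differentiable (iter_partial s f) x.

Definition test_function (f : 'rV[R]_d -> R) :=
  smooth f /\ compact (closure [set x | f x != 0]).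

Definition weak_grad u g := forall f, test_function f -> forall j,
  \int[leb R d]_x (u x * 'D_(basisv j) f x) =
  - \int[leb R d]_x (g x 0 j * f x).

Definition W12 u g :=
  [/\ u \in Lfun (leb R d) 2%:E,
      forall j, (fun x => g x 0 j) \in Lfun (leb R d) 2%:E & weak_grad u g].

Definition L2loc u := measurable_fun setT u /\
  forall r, (\int[leb R d]_(x in eball 0 r) ((u x) ^+ 2)%:E < +oo)%E.

Definition W12loc u g :=
  [/\ L2loc u, forall j, L2loc (fun x => g x 0 j) & weak_grad u g].

End sobolev.

Section homogenised.
Context {R : realType} {d : nat} {disp : measure_display}
  {Omega : measurableType disp}.
Variables (P : probability Omega R) (T : 'rV[R]_d -> Omega -> Omega).
Variable O : set Omega.

Definition potential (p : Omega -> 'rV[R]_d) :=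
  (forall j, (fun w => p w 0 j) \in Lfun P 2%:E) /\
  {ae P, forall w, exists u g, W12loc u g /\
    {ae leb R d, forall x, p (T x w) = g x}}.

Definition Vpot (p : Omega -> 'rV[R]_d) :=
  potential p /\ forall j, \int[P]_w (p w 0 j) = 0.

Definition hom_matrix (A1 Ahom : 'M[R]_d) := Ahom^T = Ahom /\
  forall xi, mxform Ahom xi xi =
    inf [set \int[P]_(w in ~` O) mxform A1 (xi + p w) (xi + p w) | p in Vpot].

Let mu := (leb R d \x P)%E.

(* L^2(R^d, W^{1,2}_0(O)): the elements are represented by jointly measurable
   functions [u], and [g] is a jointly measurable version of their gradient. *)
Definition L2_W120 (u : 'rV[R]_d * Omega -> R)
    (g : 'rV[R]_d * Omega -> 'rV[R]_d) :=
  [/\ u \in Lfun mu 2%:E,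
      forall j, (fun z => g z 0 j) \in Lfun mu 2%:E &
      {ae leb R d, forall x, W120 P T O (fun w => u (x, w)) /\
        stoch_grad P T (fun w => u (x, w)) (fun w => g (x, w))}].

Definition Hspace (f : 'rV[R]_d * Omega -> R) :=
  f \in Lfun mu 2%:E /\
  exists f0 f1, [/\ f0 \in Lfun (leb R d) 2%:E, f1 \in Lfun mu 2%:E,
    {ae mu, forall z, \1_O z.2 * f1 z = f1 z} &
    {ae mu, forall z, f z = f0 z.1 + f1 z}].

(* u = u0 + u1 is in V, with g0 = grad u0 and g1 = grad_omega u1. *)
Definition Vdecomp (u : 'rV[R]_d * Omega -> R) u0 g0 u1 g1 :=
  [/\ u \in Lfun mu 2%:E, W12 u0 g0, L2_W120 u1 g1 &
      {ae mu, forall z, u z = u0 z.1 + u1 z}].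

(* The decomposition of [u] and the gradients are unique almost everywhere. *)
Definition A_hom (Ahom : 'M[R]_d) (u f : 'rV[R]_d * Omega -> R) :=
  [/\ exists u0 g0 u1 g1, Vdecomp u u0 g0 u1 g1,
      Hspace f &
      forall u0 g0 u1 g1 phi phi0 h0 phi1 h1,
        Vdecomp u u0 g0 u1 g1 -> Vdecomp phi phi0 h0 phi1 h1 ->
        \int[leb R d]_x mxform Ahom (g0 x) (h0 x) +
        \int[mu]_z dotv (g1 z) (h1 z) = \int[mu]_z (f z * phi z)].

End homogenised.

(* [A u f] means that u is in the domain of the operator and that A u = f;
   functions are identified when they are equal almost everywhere. Spaces and
   eigenvalues are real: the operators in use are self-adjoint and commute with
   complex conjugation, so complexification adds no eigenvalue. *)
Definition point_spectrum (R : realType) disp (X : measurableType disp)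
    (mu : set X -> \bar R) (A : (X -> R) -> (X -> R) -> Prop) : set R :=
  [set lambda | exists u, ~ {ae mu, forall x, u x = 0} /\
                          A u (fun x => lambda * u x)].

(* Main.v *)
(* If psi is an eigenfunction with zero mean, then 1_Q(x) psi(w), with Q a cube,
   is an eigenfunction of A^hom.

   Conversely, let u = u0 + u1 be an eigenfunction. Testing with f(x) v(w), where
   v is in W_0^{1,2}(O), shows that the averages psi_f = int f(x) u1(x, .) dx solve
   - Delta psi_f = lambda (c_f + psi_f) on O, with c_f = int f u0. If the problem
   - Delta b = lambda (1 + b) has no solution, then c_f = 0 for all f, so u0 = 0,
   some psi_f is a nonzero eigenfunction, and macroscopic testing shows that its
   mean vanishes. If b is a solution, then a nonzero psi_f - c_f b is an
   eigenfunction, orthogonal to constants by the symmetry of the form. The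
   remaining case psi_f = c_f b for all f makes u0 a weak solution of
   - div A1hom grad u0 = beta u0 with beta = lambda (1 + <b>). Such a u0 in L^2(R^d)
   vanishes, hence so does u: for beta <> 0 the dilates u0(s x) are pairwise
   orthogonal although they depend continuously on s, and for beta = 0 the
   positivity of A1hom makes the gradient of u0 vanish.

   A1hom is positive because the inclusions are small and separated: each
   realisation of O admits a function with bounded gradient, equal to e_j on the
   inclusions. Testing the identity d_i Y_j = d_j Y_i, where Y is a realisation of
   xi + p, with x_j minus this function, cut off to large cubes, bounds xi_i by the
   integral of |Y_i| + |Y_j| outside O. This needs d >= 2; in dimension one the
   complement of separated bounded inclusions is never connected. *)

Require Import Defs.
From mathcomp Require Import all_boot all_order all_algebra.
From mathcomp Require Import all_classical all_reals all_analysis.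
From mathcomp Require Import measurable_realfun ring lra.

Set Implicit Arguments.
Unset Strict Implicit.
Unset Printing Implicit Defensive.

Import Order.TTheory GRing.Theory Num.Theory.
Import numFieldNormedType.Exports.

Local Open Scope classical_set_scope.
Local Open Scope ring_scope.

(** The number lambda may lie in any part of the spectrum of -Delta_O, so a solution b of - Delta b
    = lambda (1 + b) cannot be produced by a resolvent; the bare alternative whether some b exists
    takes its place. The dilation argument rests on two facts about weak limits: a bounded sequence
    of pairwise orthogonal functions tends weakly to 0, and u0(s x) tends weakly to u0 as s tends to
    1.

    What could make A1hom degenerate is a field xi + p concentrated on O, where the integral that
    defines A1hom does not see it; the geometry of the inclusions excludes this. The estimate on
    large cubes is integrated over Omega before the cubes grow: by stationarity its terms are then
    exactly volumes times expectations. Ergodicity enters through the fact that functions with zero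
    gradient are constant, which rules out lambda = 0.

    Since (x, w) -> f(T_x w) is jointly measurable only up to a null set, realisations are replaced
    by measurable versions, and hypotheses on them hold almost everywhere. *)

Lemma sqr_sum_le (R : realType) n (a : nat -> R) :
  (\sum_(k < n) a k) ^+ 2 <= n%:R * \sum_(k < n) a k ^+ 2.
Proof.
elim: n => [|n]; first by rewrite !big_ord0 expr2 !mul0r.
rewrite !big_ord_recr /=.
case: n => [|n]; first by rewrite !big_ord0 !add0r mul1r.
move: (\sum_(k < n.+1) a k ^+ 2) (\sum_(k < n.+1) a k) (a n.+1) => Q s b h.
rewrite -natr1; have n0 : 0 < n.+1%:R :> R by rewrite ltr0n.
move: (n.+1%:R) n0 h => m m0 h.
rewrite -subr_ge0 -(pmulr_rge0 _ m0).
rewrite (_ : m * _ = (m + 1) * (m * Q - s ^+ 2) + (s - m * b) ^+ 2); last by ring.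
by rewrite addr_ge0 ?sqr_ge0// mulr_ge0 ?subr_ge0// addr_ge0// ltW.
Qed.

Lemma normr_indic_le1 (R : realDomainType) (X : Type) (A : set X) x :
  `|\1_A x : R| <= 1.
Proof. by rewrite indicE; case: (_ \in _); rewrite ?normr1 ?normr0. Qed.

Lemma cvge0_lt (R : realType) (u : nat -> \bar R) (e : R) :
  u n @[n --> \oo] --> 0%E -> 0 < e -> \forall n \near \oo, (u n < e%:E)%E.
Proof.
move=> u0 e0; have /u0 : nbhs (0%E : \bar R) [set x | x < e%:E]%E; last by [].
by apply: open_nbhs_nbhs; split; [exact: open_ereal_lt_ereal|rewrite /= lte_fin].
Qed.

(** * Square-integrable functions and stochastic derivatives *)

Section square_integrable.
Context {R : realType} {d : measure_display} {X : measurableType d}.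
Variable mu : {measure set X -> \bar R}.
Implicit Types f g h : X -> R.

(** The squared L^2 norm, kept in the extended reals so that estimates can precede finiteness.
    Squares avoid roots, at the price of a factor 2 in the triangle inequality [sqintD]. *)
Definition sqint f : \bar R := (\int[mu]_x ((f x) ^+ 2)%:E)%E.

Definition rintg f := mu.-integrable setT (EFin \o f).

Lemma measurable_sq f : measurable_fun setT f ->
  measurable_fun setT (fun x => ((f x) ^+ 2)%:E).
Proof. by move=> mf; apply/measurable_EFinP; exact: measurable_funX. Qed.

Lemma sqint_ge0 f : (0 <= sqint f)%E.
Proof. by apply: integral_ge0 => x _; rewrite lee_fin sqr_ge0. Qed.

Lemma Lnorm2_sqint f : ('N[mu]_2%:E [EFin \o f] = sqint f `^ 2^-1)%E.
Proof.
rewrite unlock /Lnorm; congr (_ `^ _)%E; apply: eq_integral => x _ /=.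
by rewrite powR_mulrn// -normrX ger0_norm ?sqr_ge0.
Qed.

Lemma L2P f : f \in Lfun mu 2%:E <-> measurable_fun setT f /\ (sqint f < +oo)%E.
Proof.
split.
  move=> fL; have /integrableP[_] := Lfun2_integrable_sqr fL.
  move: fL; rewrite inE => /andP[/[!inE]/= mf _] h; split=> //.
  apply: le_lt_trans h; rewrite /sqint.
  by under [leRHS]eq_integral do rewrite /= ger0_norm ?sqr_ge0//.
move=> [mf foo]; rewrite inE; apply/andP; split; rewrite inE//=.
by rewrite /finite_norm Lnorm2_sqint poweR_lty.
Qed.

Lemma L2_measurable f : f \in Lfun mu 2%:E -> measurable_fun setT f.
Proof. by move/L2P => []. Qed.

Lemma L2_sqint_lty f : f \in Lfun mu 2%:E -> (sqint f < +oo)%E.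
Proof. by move/L2P => []. Qed.

Lemma le_sqint f g : measurable_fun setT f -> measurable_fun setT g ->
  (forall x, `|f x| <= `|g x|) -> (sqint f <= sqint g)%E.
Proof.
move=> mf mg fg; apply: ge0_le_integral => //.
- by move=> x _; rewrite lee_fin sqr_ge0.
- exact: measurable_sq.
- exact: measurable_sq.
- by move=> x _; rewrite lee_fin -[X in X <= _]real_normK ?num_real// -[X in _ <= X]real_normK ?num_real// lerXn2r// nnegrE.
Qed.

Lemma le_L2 f g : measurable_fun setT f -> g \in Lfun mu 2%:E ->
  (forall x, `|f x| <= `|g x|) -> f \in Lfun mu 2%:E.
Proof.
move=> mf /L2P[mg goo] fg; apply/L2P; split => //.
exact: le_lt_trans (le_sqint mf mg fg) goo.
Qed.

Lemma sqintD f g : measurable_fun setT f -> measurable_fun setT g ->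
  (sqint (fun x => f x + g x)%R <= 2%:E * sqint f + 2%:E * sqint g)%E.
Proof.
move=> mf mg; rewrite /sqint -!ge0_integralZl//; last 4 first.
- exact: measurable_sq.
- by move=> x _; rewrite lee_fin sqr_ge0.
- exact: measurable_sq.
- by move=> x _; rewrite lee_fin sqr_ge0.
rewrite -ge0_integralD//; last 4 first.
- by move=> x _; rewrite -EFinM lee_fin mulr_ge0// sqr_ge0.
- exact/measurable_funeM/measurable_sq.
- by move=> x _; rewrite -EFinM lee_fin mulr_ge0// sqr_ge0.
- exact/measurable_funeM/measurable_sq.
apply: ge0_le_integral => //.
- by move=> x _; rewrite lee_fin sqr_ge0.
- exact/measurable_sq/measurable_funD.
- by apply: emeasurable_funD; exact/measurable_funeM/measurable_sq.
- move=> x _; rewrite -!EFinM -EFinD lee_fin.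
  by have := sqr_ge0 (f x - g x); nra.
Qed.

Lemma le_sqintD h f g : measurable_fun setT f -> measurable_fun setT g ->
  (forall x, h x = f x + g x) ->
  (sqint h <= 2%:E * sqint f + 2%:E * sqint g)%E.
Proof. by move=> mf mg /funext->; exact: sqintD. Qed.

Lemma sqintZ k f : measurable_fun setT f ->
  (sqint (fun x => k * f x)%R = (k ^+ 2)%:E * sqint f)%E.
Proof.
move=> mf; rewrite /sqint -ge0_integralZl//.
- by apply: eq_integral => x _; rewrite exprMn EFinM.
- exact: measurable_sq.
- by move=> x _; rewrite lee_fin sqr_ge0.
- by rewrite lee_fin sqr_ge0.
Qed.

Lemma sqintN f : sqint (fun x => - f x) = sqint f.
Proof. by apply: eq_integral => x _; rewrite sqrrN. Qed.

Lemma eq_sqint f g : f =1 g -> sqint f = sqint g.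
Proof. by move=> fg; apply: eq_integral => x _; rewrite fg. Qed.

Lemma ae_eq_sqint f g : measurable_fun setT f -> measurable_fun setT g ->
  {ae mu, forall x, f x = g x} -> sqint f = sqint g.
Proof.
move=> mf mg fg; apply: ge0_ae_eq_integral => //.
- exact: measurable_sq.
- exact: measurable_sq.
- by move=> x _; rewrite lee_fin sqr_ge0.
- by move=> x _; rewrite lee_fin sqr_ge0.
- by apply: filterS fg => x + _ => ->.
Qed.

Lemma sqint_eq0 f : measurable_fun setT f -> sqint f = 0%E ->
  {ae mu, forall x, f x = 0}.
Proof.
move=> mf f0; have : (\int[mu]_x `|((f x) ^+ 2)%:E| = 0)%E.
  rewrite -[RHS]f0; apply: eq_integral => x _.
  by rewrite gee0_abs// lee_fin sqr_ge0.
move/(ae_eq_integral_abs mu measurableT (measurable_sq mf)).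
apply: filterS => x /= /(_ I) /eqP.
by rewrite eqe sqrf_eq0 => /eqP.
Qed.

Lemma ae_eq0_sqint f : measurable_fun setT f ->
  {ae mu, forall x, f x = 0} -> sqint f = 0%E.
Proof.
move=> mf f0; rewrite (@ae_eq_sqint f (cst 0))//.
by rewrite /sqint; under eq_integral do rewrite expr0n; rewrite integral0.
Qed.

Lemma L2D f g : f \in Lfun mu 2%:E -> g \in Lfun mu 2%:E ->
  (fun x => f x + g x) \in Lfun mu 2%:E.
Proof.
move=> /L2P[mf foo] /L2P[mg goo]; apply/L2P; split.
  exact: measurable_funD.
apply: le_lt_trans (sqintD mf mg) _.
by rewrite lte_add_pinfty// lte_mul_pinfty.
Qed.

Lemma L2Z k f : f \in Lfun mu 2%:E -> (fun x => k * f x) \in Lfun mu 2%:E.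
Proof.
move=> /L2P[mf foo]; apply/L2P; split; first exact: measurable_funM.
by rewrite sqintZ// lte_mul_pinfty// lee_fin sqr_ge0.
Qed.

Lemma L2N f : f \in Lfun mu 2%:E -> (fun x => - f x) \in Lfun mu 2%:E.
Proof.
by move/(L2Z (-1)); under eq_fun do rewrite mulN1r.
Qed.

Lemma L2B f g : f \in Lfun mu 2%:E -> g \in Lfun mu 2%:E ->
  (fun x => f x - g x) \in Lfun mu 2%:E.
Proof. by move=> fL gL; apply: L2D => //; exact: L2N. Qed.

Lemma L20 : (fun=> 0) \in Lfun mu 2%:E.
Proof.
apply/L2P; split => //; rewrite /sqint.
by under eq_integral do rewrite expr0n; rewrite integral0.
Qed.

Lemma L2_sum (I : Type) (r : seq I) (F : I -> X -> R) :
  (forall i, F i \in Lfun mu 2%:E) ->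
  (fun x => \sum_(i <- r) F i x) \in Lfun mu 2%:E.
Proof.
move=> FL; elim: r => [|i r ih].
  by under eq_fun do rewrite big_nil; exact: L20.
by under eq_fun do rewrite big_cons; exact: L2D.
Qed.

Lemma L2_mul_integrable f g : f \in Lfun mu 2%:E -> g \in Lfun mu 2%:E ->
  rintg (fun x => f x * g x).
Proof. by move=> fL gL; apply/Lfun1_integrable; exact: Lfun2_mul_Lfun1. Qed.

Lemma L2_sqr_integrable f : f \in Lfun mu 2%:E ->
  rintg (fun x => f x ^+ 2).
Proof. exact: Lfun2_integrable_sqr. Qed.

Lemma integral_sqE f : f \in Lfun mu 2%:E ->
  (\int[mu]_x (f x ^+ 2))%:E = sqint f.
Proof.
move=> fL; rewrite /Rintegral fineK//.
exact: integrable_fin_num (L2_sqr_integrable fL).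
Qed.

Lemma ae_eq_Rintegral f g : measurable_fun setT f -> measurable_fun setT g ->
  {ae mu, forall x, f x = g x} -> \int[mu]_x f x = \int[mu]_x g x.
Proof.
move=> mf mg fg; congr fine; apply: ae_eq_integral => //; try exact/measurable_EFinP.
by apply: filterS fg => x + _ => ->.
Qed.

Lemma rintg_measurable f : rintg f -> measurable_fun setT f.
Proof. by move=> /measurable_int /measurable_EFinP. Qed.

Lemma rintgP f : rintg f <->
  measurable_fun setT f /\ (\int[mu]_x `|f x|%:E < +oo)%E.
Proof.
split=> [/integrableP[/measurable_EFinP ? ?]//|[mf foo]].
by apply/integrableP; split => //; exact/measurable_EFinP.
Qed.

Lemma rintgD f g : rintg f -> rintg g -> rintg (fun x => f x + g x).
Proof. by move=> rf rg; apply: eq_integrable (integrableD _ rf rg). Qed.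

Lemma rintgZ k f : rintg f -> rintg (fun x => k * f x).
Proof. by move=> rf; apply: eq_integrable (integrableZl _ k rf). Qed.

Lemma rintgN f : rintg f -> rintg (fun x => - f x).
Proof. by move=> rf; apply: eq_integrable (integrableN rf). Qed.

Lemma rintgB f g : rintg f -> rintg g -> rintg (fun x => f x - g x).
Proof. by move=> rf rg; apply: rintgD => //; exact: rintgN. Qed.

Lemma rintg0 : rintg (fun=> 0).
Proof. exact: integrable0. Qed.

Lemma rintg_sum (I : Type) (r : seq I) (F : I -> X -> R) :
  (forall i, rintg (F i)) -> rintg (fun x => \sum_(i <- r) F i x).
Proof.
move=> FL; elim: r => [|i r ih].
  by rewrite (_ : (fun _ => _) = fun=> 0); [exact: rintg0|apply/funext => x; rewrite big_nil].
rewrite (_ : (fun _ => _) = fun x => F i x + \sum_(j <- r) F j x).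
  exact: rintgD.
by apply/funext => x; rewrite big_cons.
Qed.

Lemma le_rintg f g : measurable_fun setT f -> (forall x, `|f x| <= `|g x|) ->
  rintg g -> rintg f.
Proof.
move=> mf fg; apply: le_integrable => //; first exact/measurable_EFinP.
by move=> x _; rewrite /= lee_fin.
Qed.

Lemma ae_eq_rintg f g : measurable_fun setT g -> {ae mu, forall x, f x = g x} ->
  rintg f -> rintg g.
Proof.
move=> mg fg /rintgP[mf foo]; apply/rintgP; split => //.
rewrite -(@ge0_ae_eq_integral _ _ _ _ _ (fun x => `|f x|%:E))//.
- by apply/measurable_EFinP; exact: measurableT_comp.
- by apply/measurable_EFinP; exact: measurableT_comp.
- by apply: filterS fg => x + _ => ->.
Qed.

Lemma rintg_norm f : rintg f -> rintg (fun x => `|f x|).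
Proof.
move=> rf; apply: (le_rintg _ _ (rf)) => [|x]; last by rewrite normr_id.
by apply: measurableT_comp => //; exact: rintg_measurable.
Qed.

Lemma rintg_bounded k f g : measurable_fun setT g -> (forall x, `|g x| <= k) ->
  rintg f -> rintg (fun x => f x * g x).
Proof.
move=> mg gk rf; apply: (@le_rintg _ (fun x => k * f x)).
- by apply: measurable_funM => //; exact: rintg_measurable.
- by move=> x; rewrite !normrM mulrC ler_wpM2r// (le_trans (gk _))// ler_norm.
- exact: rintgZ.
Qed.

Lemma RintD f g : rintg f -> rintg g ->
  \int[mu]_x (f x + g x) = \int[mu]_x f x + \int[mu]_x g x.
Proof. exact: RintegralD. Qed.

Lemma RintB f g : rintg f -> rintg g ->
  \int[mu]_x (f x - g x) = \int[mu]_x f x - \int[mu]_x g x.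
Proof. exact: RintegralB. Qed.

Lemma RintZ k f : rintg f -> \int[mu]_x (k * f x) = k * \int[mu]_x f x.
Proof. exact: RintegralZl. Qed.

Lemma Rint0 : \int[mu]_x (0 : R) = 0.
Proof. by rewrite /Rintegral integral0. Qed.

Lemma Rint_sum (I : Type) (r : seq I) (F : I -> X -> R) :
  (forall i, rintg (F i)) ->
  \int[mu]_x (\sum_(i <- r) F i x) = \sum_(i <- r) \int[mu]_x F i x.
Proof.
move=> FL; elim: r => [|i r ih].
  by rewrite big_nil -[RHS]Rint0; apply: eq_Rintegral => x _; rewrite big_nil.
rewrite big_cons -ih -RintD//; last exact: rintg_sum.
by apply: eq_Rintegral => x _; rewrite big_cons.
Qed.

Lemma le_Rint f g : rintg f -> rintg g -> (forall x, f x <= g x) ->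
  \int[mu]_x f x <= \int[mu]_x g x.
Proof. by move=> rf rg fg; exact: le_Rintegral. Qed.

Lemma le_norm_Rint f : rintg f -> `|\int[mu]_x f x| <= \int[mu]_x `|f x|.
Proof. exact: le_normr_Rintegral. Qed.

Lemma RintE f : rintg f -> (\int[mu]_x (f x))%:E = (\int[mu]_x (f x)%:E)%E.
Proof. by move=> rf; rewrite /Rintegral fineK//; exact: integrable_fin_num rf. Qed.

Lemma Rint_dominated (f_ : nat -> X -> R) f g :
  (forall n, measurable_fun setT (f_ n)) -> measurable_fun setT f ->
  {ae mu, forall x, f_ n x @[n --> \oo] --> f x} -> rintg g ->
  (forall n x, `|f_ n x| <= g x) ->
  rintg f /\ \int[mu]_x f_ n x @[n --> \oo] --> \int[mu]_x f x.
Proof.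
move=> mf_ mf ff rg fg.
have mF n : measurable_fun setT (EFin \o f_ n) by exact/measurable_EFinP.
have mF0 : measurable_fun setT (EFin \o f) by exact/measurable_EFinP.
have cF : {ae mu, forall x, setT x -> (EFin \o f_ n) x @[n --> \oo] --> (EFin \o f) x}.
  apply: filterS ff => x fx _; apply: cvg_EFin fx; exact: nearW.
have bF : {ae mu, forall x n, setT x -> (`|(EFin \o f_ n) x| <= (EFin \o g) x)%E}.
  by apply: aeW => x n _; rewrite /= lee_fin.
have [rf _ h] := @dominated_convergence _ _ _ mu _ measurableT _ _ _ mF mF0 cF rg bF.
split => //; apply: fine_cvg; rewrite fineK//.
exact: (integrable_fin_num _ rf).
Qed.

Lemma L2_cauchy_schwarz f g : f \in Lfun mu 2%:E -> g \in Lfun mu 2%:E ->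
  (\int[mu]_x (f x * g x)) ^+ 2 <=
  \int[mu]_x (f x ^+ 2) * \int[mu]_x (g x ^+ 2).
Proof.
move=> fL gL.
have ff := L2_sqr_integrable fL; have gg := L2_sqr_integrable gL.
have fg := L2_mul_integrable fL gL.
set a := \int[mu]_x (f x ^+ 2); set c := \int[mu]_x (g x ^+ 2).
set b := \int[mu]_x (f x * g x).
have h s t : 0 <= s ^+ 2 * a + 2 * s * t * b + t ^+ 2 * c.
  have -> : s ^+ 2 * a + 2 * s * t * b + t ^+ 2 * c =
      \int[mu]_x ((s * f x + t * g x) ^+ 2).
    transitivity (\int[mu]_x (s ^+ 2 * f x ^+ 2 + 2 * s * t * (f x * g x) +
        t ^+ 2 * g x ^+ 2)); last first.
      by apply: eq_Rintegral => x _; ring.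
    have i1 := rintgZ (s ^+ 2) ff.
    have i2 := rintgZ (2 * s * t) fg.
    have i3 := rintgZ (t ^+ 2) gg.
    by rewrite RintD//; [rewrite RintD// !RintZ|exact: rintgD].
  by apply: Rintegral_ge0 => x _; exact: sqr_ge0.
have a0 : 0 <= a by apply: Rintegral_ge0 => x _; exact: sqr_ge0.
have c0 : 0 <= c by apply: Rintegral_ge0 => x _; exact: sqr_ge0.
have [a0'|an0] := eqVneq a 0.
  rewrite a0' mul0r real_exprn_even_le0 ?num_real//=; apply/negbNE/negP => b0.
  (* For a = 0 the form is 2 s t b + t^2 c, and this choice makes it equal to -(c + 2), which is
     negative. *)
  have := h (- (c + 1) / b) 1.
  rewrite a0' => h'; suff : 0 <= - (c + 2) by lra.
  by apply: le_trans h' _; rewrite le_eqVlt; apply/orP; left; apply/eqP; field.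
have := h b (- a).
have agt0 : 0 < a by rewrite lt_neqAle eq_sym an0.
have -> : b ^+ 2 * a + 2 * b * - a * b + (- a) ^+ 2 * c = a * (a * c - b ^+ 2) by ring.
by rewrite pmulr_rge0// subr_ge0.
Qed.

End square_integrable.

Section stoch_deriv_facts.
Context {R : realType} {d : nat} {disp : measure_display}
  {Omega : measurableType disp}.
Variables (P : probability Omega R) (T : 'rV[R]_d -> Omega -> Omega).
Implicit Types (j : 'I_d) (f g : Omega -> R) (t : R).

Definition diffquot j t f : Omega -> R :=
  fun w => (f (T (t *: basisv j) w) - f w) / t.

(** Trades a limit of extended norms for an epsilon-delta statement on squared norms, the form in
    which all later estimates are made. *)
Lemma stoch_derivP j f g : stoch_deriv P T j f g <->
  [/\ f \in Lfun P 2%:E, g \in Lfun P 2%:E &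
      forall e : R, 0 < e -> exists2 dlt : R, 0 < dlt & forall t, t != 0 -> `|t| < dlt ->
        (sqint P (fun w => diffquot j t f w - g w)%R <= e%:E)%E].
Proof.
split=> -[fL gL h]; split => //.
  move=> e e0.
  have /h : nbhs (0%E : \bar R) [set x | x < (Num.sqrt e)%:E]%E.
    by apply: open_nbhs_nbhs; split; [exact: open_ereal_lt_ereal|rewrite /= lte_fin sqrtr_gt0].
  move=> [/= dlt dlt0 hd]; exists dlt => // t t0 td.
  have := hd t; rewrite /= sub0r normrN => /(_ td t0).
  rewrite (_ : (fun w => _) = EFin \o (fun w => diffquot j t f w - g w)); last exact/funext.
  rewrite Lnorm2_sqint; have := sqint_ge0 P (fun w => diffquot j t f w - g w)%R.
  case: (sqint _ _) => // [r|]; last by rewrite poweRyr.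
  rewrite lee_fin => r0; rewrite poweR_EFin lte_fin powR12_sqrt// ltr_sqrt// lee_fin.
  exact: ltW.
apply/fine_cvgP; split.
  have [dlt dlt0 hd] := h 1 ltr01.
  exists dlt => //= t; rewrite /= sub0r normrN => td t0.
  have := hd _ t0 td.
  rewrite (_ : (fun w => _) = EFin \o (fun w => diffquot j t f w - g w)); last exact/funext.
  rewrite Lnorm2_sqint; have := sqint_ge0 P (fun w => diffquot j t f w - g w)%R.
  by case: (sqint _ _).
apply/cvgrPdist_le => e e0.
have [dlt dlt0 hd] := h (e ^+ 2) (exprn_gt0 _ e0).
exists dlt => //= t; rewrite /= sub0r normrN => td t0.
have := hd _ t0 td.
rewrite (_ : (fun w => _) = EFin \o (fun w => diffquot j t f w - g w)); last exact/funext.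
rewrite Lnorm2_sqint; have := sqint_ge0 P (fun w => diffquot j t f w - g w)%R.
case: (sqint _ _) => // r; rewrite !lee_fin => r0 re.
rewrite sub0r normrN poweR_EFin /= powR12_sqrt// ger0_norm ?sqrtr_ge0//.
by rewrite -(ger0_norm (ltW e0)) -sqrtr_sqr ler_wsqrtr.
Qed.

Lemma stoch_deriv_L2l j f g : stoch_deriv P T j f g -> f \in Lfun P 2%:E.
Proof. by case. Qed.

Lemma stoch_deriv_L2r j f g : stoch_deriv P T j f g -> g \in Lfun P 2%:E.
Proof. by case. Qed.

Hypothesis TE : ergodic_dynamical_system P T.

Lemma shift0 w : T 0 w = w.
Proof.
have [h hK _] := shift_bij TE 0.
by have := congr1 h (shiftD TE 0 0 w); rewrite addr0 !hK.
Qed.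

Lemma shiftNK x : cancel (T x) (T (- x)).
Proof. by move=> w; rewrite (shiftD TE) addNr shift0. Qed.

Lemma shiftKN x : cancel (T (- x)) (T x).
Proof. by move=> w; rewrite (shiftD TE) subrr shift0. Qed.

Lemma shift_preimage x F : T x @^-1` F = T (- x) @` F.
Proof.
apply/seteqP; split => [w Fw|_ [w Fw <-]]; last by rewrite /= shiftKN.
by exists (T x w) => //; rewrite shiftNK.
Qed.

Lemma measurable_shift_preimage x F : measurable F -> measurable (T x @^-1` F).
Proof. by move=> mF; rewrite -[X in measurable X]setTI; exact: (shift_measurable TE). Qed.

Lemma shift_preimage_measure x F : measurable F -> P (T x @^-1` F) = P F.
Proof. by move=> mF; rewrite shift_preimage (shift_measure TE). Qed.

Lemma measurable_shift x f : measurable_fun setT f ->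
  measurable_fun setT (fun w => f (T x w)).
Proof. by move=> mf; apply: measurableT_comp => //; exact: (shift_measurable TE). Qed.

Lemma ge0_integral_shift x (f : Omega -> \bar R) : measurable_fun setT f ->
  (forall w, 0 <= f w)%E -> (\int[P]_w f (T x w) = \int[P]_w f w)%E.
Proof.
move=> mf f0.
have := ge0_integral_pushforward (shift_measurable TE x) P measurableT mf.
move=> /(_ (fun w _ => f0 w)) /esym; rewrite preimage_setT => ->.
apply: eq_measure_integral => [|mT A mA _]; first exact: (shift_measurable TE).
exact: shift_preimage_measure.
Qed.

Lemma sqint_shift x f : measurable_fun setT f ->
  sqint P (fun w => f (T x w)) = sqint P f.
Proof.
move=> mf; rewrite /sqint (ge0_integral_shift x (measurable_sq mf))// => w.
by rewrite lee_fin sqr_ge0.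
Qed.

Lemma L2_shift x f : f \in Lfun P 2%:E -> (fun w => f (T x w)) \in Lfun P 2%:E.
Proof.
move=> /L2P[mf foo]; apply/L2P; split; first exact: measurable_shift.
by rewrite sqint_shift.
Qed.

Lemma ae_shift x (Q : Omega -> Prop) :
  {ae P, forall w, Q w} -> {ae P, forall w, Q (T x w)}.
Proof.
move=> [N [mN N0 QN]]; exists (T x @^-1` N); split.
- exact: measurable_shift_preimage.
- by rewrite shift_preimage_measure.
- by move=> w /= nQ; exact: QN.
Qed.

Lemma L2_diffquot j t f : f \in Lfun P 2%:E -> diffquot j t f \in Lfun P 2%:E.
Proof.
move=> fL; have := L2Z t^-1 (L2B (L2_shift (t *: basisv j) fL) fL).
by rewrite /diffquot; under [in X in _ -> X]eq_fun do rewrite mulrC.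
Qed.

(** The increment over n x telescopes into n increments over x, all of the same norm because the
    shifts preserve P. *)
Lemma sqint_shift_sub_natmul n x f : measurable_fun setT f ->
  (sqint P (fun w => f (T (x *+ n) w) - f w)%R <=
   (n%:R ^+ 2)%:E * sqint P (fun w => f (T x w) - f w)%R)%E.
Proof.
move=> mf.
have mfx y : measurable_fun setT (fun w => f (T y w)) by exact: measurable_shift.
have mk k : measurable_fun setT (fun w => f (T x (T (x *+ k) w)) - f (T (x *+ k) w)).
  exact: (measurable_shift (x *+ k) (measurable_funB (mfx x) mf)).
have E w : f (T (x *+ n) w) - f w =
    \sum_(k < n) (f (T x (T (x *+ k) w)) - f (T (x *+ k) w)).
  rewrite (eq_bigr (fun k : 'I_n => f (T (x *+ k.+1) w) - f (T (x *+ k) w))).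
    by rewrite -(big_mkord xpredT (fun k => f (T (x *+ k.+1) w) - f (T (x *+ k) w)))
      telescope_sumr// mulr0n shift0.
  by move=> k _; rewrite (shiftD TE) mulrS.
rewrite (eq_sqint _ E).
have CS w : (\sum_(k < n) (f (T x (T (x *+ k) w)) - f (T (x *+ k) w))) ^+ 2 <=
    n%:R * \sum_(k < n) (f (T x (T (x *+ k) w)) - f (T (x *+ k) w)) ^+ 2.
  exact: (sqr_sum_le n (fun k => f (T x (T (x *+ k) w)) - f (T (x *+ k) w))).
apply: (@le_trans _ _ (\int[P]_w (n%:R * \sum_(k < n)
    (f (T x (T (x *+ k) w)) - f (T (x *+ k) w)) ^+ 2)%:E)%E).
  apply: ge0_le_integral => //.
  - by move=> w _; rewrite lee_fin sqr_ge0.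
  - by apply: measurable_sq; apply: measurable_sum.
  - by apply/measurable_EFinP; apply: measurable_funM => //;
      apply: measurable_sum => k; exact: measurable_funX.
  - by move=> w _; rewrite lee_fin.
under eq_integral do rewrite EFinM -sumEFin.
rewrite ge0_integralZl//; last 2 first.
  by apply: emeasurable_sum => k _; exact: measurable_sq.
  by move=> w _; apply: sume_ge0 => k _; rewrite lee_fin sqr_ge0.
rewrite ge0_integral_sum//; last 2 first.
  by move=> k; exact: measurable_sq.
  by move=> k w _; rewrite lee_fin sqr_ge0.
rewrite (eq_bigr (fun=> sqint P (fun w => f (T x w) - f w))) => [|k _]; last first.
  by rewrite -(sqint_shift (x *+ k) (measurable_funB (mfx x) mf)).
have := sqint_ge0 P (fun w => f (T x w) - f w).
case: (sqint _ _) => [r||] //=.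
  move=> _; have -> : (\sum_(i < n) r%:E)%R = (\sum_(i < n) r)%:E by rewrite -sumEFin.
  by rewrite sumr_const card_ord -!EFinM lee_fin expr2 -(mulr_natl r) mulrA.
(* If the increment over x has infinite norm the bound is trivial for n > 0; for n = 0 both sides
   are 0, by the convention 0 * oo = 0. *)
case: n {E CS mk} => [|n]; first by rewrite expr2 mul0r !mul0e.
by move=> _; rewrite [X in (_ <= X)%E]gt0_muley ?leey// lte_fin exprn_gt0// ltr0n.
Qed.

(** The increment over t is split into n short ones, for which the quotient is close to g, and these
    are summed by [sqint_shift_sub_natmul]. The bound thus holds for all t, not only small ones; the
    factor 2 stems from [sqintD]. *)
Lemma sqint_shift_sub j f g t : stoch_deriv P T j f g ->
  (sqint P (fun w => f (T (t *: basisv j) w) - f w)%R <=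
   (2 * t ^+ 2)%:E * sqint P g)%E.
Proof.
move=> /stoch_derivP[fL gL h]; have mf := L2_measurable fL.
have [->|t0] := eqVneq t 0.
  rewrite (_ : (fun w => _) = fun=> 0).
    rewrite /sqint; under eq_integral do rewrite expr0n.
    by rewrite integral0 mule_ge0// ?lee_fin ?mulr_ge0 ?sqr_ge0// sqint_ge0.
  by apply/funext => w; rewrite scale0r shift0 subrr.
apply/lee_addgt0Pr => e e0.
have e0' : 0 < e / (2 * t ^+ 2).
  by rewrite divr_gt0// mulr_gt0// exprn_even_gt0.
have [dlt dlt0 hd] := h _ e0'.
pose n := (Num.trunc (`|t| / dlt)).+1.
have n0 : n%:R != 0 :> R by rewrite pnatr_eq0.
have tn : `|t / n%:R| < dlt.
  rewrite normrM normfV normr_nat ltr_pdivrMr ?ltr0n// mulrC -ltr_pdivrMr//.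
  by rewrite truncnS_gt.
have tn0 : t / n%:R != 0 by rewrite mulf_neq0// invr_neq0.
have {hd} := hd _ tn0 tn.
set q := diffquot j (t / n%:R) f => hq.
have -> : t *: basisv j = ((t / n%:R) *: basisv j) *+ n.
  by rewrite scalerMnl -[_ *+ n]mulr_natr divfK.
apply: le_trans (sqint_shift_sub_natmul n _ mf) _.
have mq : measurable_fun setT q by exact: L2_measurable (L2_diffquot _ _ fL).
have mg := L2_measurable gL.
rewrite (@eq_sqint _ _ _ _ _ (fun w => (t / n%:R) * q w)); last first.
  by move=> w; rewrite /q /diffquot [RHS]mulrC divfK.
rewrite sqintZ// muleA -EFinM -exprMn [n%:R * _]mulrC divfK//.
have : (sqint P q <= 2%:E * (e / (2 * t ^+ 2))%:E + 2%:E * sqint P g)%E.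
  apply: le_trans (@le_sqintD _ _ _ P q (fun w => q w - g w) g _ mg _) _.
  - exact: measurable_funB.
  - by move=> w; rewrite subrK.
  by apply: leeD => //; apply: lee_wpmul2l.
move/(lee_wpmul2l (_ : (0 <= (t ^+ 2)%:E)%E)).
rewrite lee_fin sqr_ge0 => /(_ isT) /le_trans; apply.
rewrite ge0_muleDr; last 2 first.
- by apply: mule_ge0 => //; rewrite lee_fin ltW.
- by rewrite mule_ge0// sqint_ge0.
rewrite addeC muleA -!EFinM [t ^+ 2 * 2]mulrC.
by rewrite leeD2l// lee_fin le_eqVlt; apply/orP; left; apply/eqP; field; rewrite t0.
Qed.

Lemma stoch_deriv_unique j f g g' : stoch_deriv P T j f g ->
  stoch_deriv P T j f g' -> {ae P, forall w, g w = g' w}.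
Proof.
move=> /stoch_derivP[fL gL h] /stoch_derivP[_ gL' h'].
have mf := L2_measurable fL; have mg := L2_measurable gL.
have mg' := L2_measurable gL'.
suff : sqint P (fun w => g w - g' w) = 0%E.
  move/(sqint_eq0 (measurable_funB mg mg')).
  by apply: filterS => w /eqP; rewrite subr_eq0 => /eqP.
apply/eqP; rewrite eq_le sqint_ge0 andbT; apply/lee_addgt0Pr => e e0.
have e0' : 0 < e / 4 by rewrite divr_gt0.
have [d1 d10 h1] := h _ e0'; have [d2 d20 h2] := h' _ e0'.
pose t := Num.min d1 d2 / 2.
have t0 : 0 < t by rewrite divr_gt0// lt_min d10.
have td : t < Num.min d1 d2.
  by rewrite ltr_pdivrMr// mulr_natr mulr2n ltrDl lt_min d10.
have {h1} := h1 t; rewrite gt_eqF// gtr0_norm// (lt_le_trans td) ?ge_min ?lexx// => /(_ isT isT) h1.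
have {h2} := h2 t; rewrite gt_eqF// gtr0_norm// (lt_le_trans td) ?ge_min ?lexx ?orbT// => /(_ isT isT) h2.
have mq : measurable_fun setT (diffquot j t f) by exact: L2_measurable (L2_diffquot _ _ fL).
apply: le_trans (@le_sqintD _ _ _ P _ (fun w => - (diffquot j t f w - g w))
  (fun w => diffquot j t f w - g' w) _ _ _) _.
- exact/measurable_funN/measurable_funB.
- exact: measurable_funB.
- by move=> w; ring.
rewrite sqintN; apply: (@le_trans _ _ (2%:E * (e / 4)%:E + 2%:E * (e / 4)%:E)%E).
  by apply: leeD; apply: lee_wpmul2l.
by rewrite -!EFinM -!EFinD add0r lee_fin; lra.
Qed.

Lemma ae_eq_stoch_deriv j f f' g g' : f' \in Lfun P 2%:E -> g' \in Lfun P 2%:E ->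
  {ae P, forall w, f w = f' w} -> {ae P, forall w, g w = g' w} ->
  stoch_deriv P T j f g -> stoch_deriv P T j f' g'.
Proof.
move=> fL' gL' ff' gg' /stoch_derivP[fL gL h]; apply/stoch_derivP; split => //.
move=> e e0; have [dlt dlt0 hd] := h e e0; exists dlt => // t t0 td.
rewrite -(@ae_eq_sqint _ _ _ _ (fun w => diffquot j t f w - g w)); first exact: hd.
- exact: L2_measurable (L2B (L2_diffquot _ _ fL) gL).
- exact: L2_measurable (L2B (L2_diffquot _ _ fL') gL').
- apply: filterS3 ff' gg' (ae_shift (t *: basisv j) ff') => w E1 E2 E3.
  by rewrite /diffquot E1 E2 E3.
Qed.

Lemma stoch_derivD j f g f' g' k : stoch_deriv P T j f g -> stoch_deriv P T j f' g' ->
  stoch_deriv P T j (fun w => f w + k * f' w) (fun w => g w + k * g' w).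
Proof.
move=> /stoch_derivP[fL gL h] /stoch_derivP[fL' gL' h'].
apply/stoch_derivP; split; [exact/L2D/L2Z|exact/L2D/L2Z|] => e e0.
have e1 : 0 < e / 4 by rewrite divr_gt0.
have e2 : 0 < e / (4 * (1 + k ^+ 2)).
  by rewrite divr_gt0// mulr_gt0// ltr_pwDl// sqr_ge0.
have [d1 d10 h1] := h _ e1; have [d2 d20 h2] := h' _ e2.
exists (Num.min d1 d2); first by rewrite lt_min d10.
move=> t t0; rewrite lt_min => /andP[td1 td2].
have {}h1 := h1 _ t0 td1; have {}h2 := h2 _ t0 td2.
have m1 := L2_measurable (L2B (L2_diffquot j t fL) gL).
have m2 := L2_measurable (L2B (L2_diffquot j t fL') gL').
apply: le_trans (@le_sqintD _ _ _ P _ _ (fun w => k * (diffquot j t f' w - g' w)) m1 _ _) _.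
- exact: measurable_funM.
- by move=> w; rewrite /diffquot; ring.
rewrite sqintZ//.
apply: (@le_trans _ _ (2%:E * (e / 4)%:E + 2%:E * ((k ^+ 2)%:E * (e / (4 * (1 + k ^+ 2)))%:E))%E).
  by apply: leeD; apply: lee_wpmul2l => //; apply: lee_wpmul2l => //; rewrite lee_fin sqr_ge0.
have k1 : 0 < 1 + k ^+ 2 by rewrite ltr_pwDl// sqr_ge0.
have : k ^+ 2 * (e / (4 * (1 + k ^+ 2))) <= e / 4.
  rewrite mulrA ler_pdivrMr ?mulr_gt0//.
  rewrite (_ : e / 4 * _ = e * (1 + k ^+ 2)); last by field.
  by rewrite mulrC ler_pM2l// lerDr.
by rewrite -!EFinM -!EFinD lee_fin; lra.
Qed.

Lemma stoch_deriv0 j : stoch_deriv P T j (fun=> 0) (fun=> 0).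
Proof.
apply/stoch_derivP; split; [exact: L20|exact: L20|] => e e0; exists 1 => // t _ _.
rewrite (@eq_sqint _ _ _ _ _ (fun=> 0)); last by move=> w; rewrite /diffquot !subr0 mul0r.
rewrite /sqint; under eq_integral do rewrite expr0n.
by rewrite integral0 lee_fin ltW.
Qed.

(** By [sqint_shift_sub] with a zero derivative f is invariant under shifts along each axis, hence
    under all shifts, and ergodicity applies. *)
Lemma stoch_grad0_cst f : measurable_fun setT f -> (forall j, stoch_deriv P T j f (fun=> 0)) ->
  exists c, {ae P, forall w, f w = c}.
Proof.
move=> mf h; apply: (shift_ergodic TE) => // x.
have hj j t : {ae P, forall w, f (T (t *: basisv j) w) = f w}.
  have := sqint_shift_sub t (h j); rewrite (_ : sqint P (fun=> 0) = 0%E); last first.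
    by rewrite /sqint; under eq_integral do rewrite expr0n; rewrite integral0.
  rewrite mule0 => s0.
  have {}s0 : sqint P (fun w => f (T (t *: basisv j) w) - f w) = 0%E.
    by apply/eqP; rewrite eq_le s0 sqint_ge0.
  have := sqint_eq0 (measurable_funB (measurable_shift _ mf) mf) s0.
  by apply: filterS => w /eqP; rewrite subr_eq0 => /eqP.
rewrite [x]row_sum_delta; elim: (index_enum _) => [|j r ih].
  by apply: aeW => w; rewrite big_nil shift0.
apply: filterS2 (ih) (ae_shift (\sum_(i <- r) x 0 i *: delta_mx 0 i) (hj j (x 0 j))) => w E1 E2.
by rewrite big_cons -(shiftD TE) E2 E1.
Qed.

(** Outside O the quotient of f with increment t vanishes unless the shift by t e_j enters O.
    Shifting back, the exceptional points become points of O that leave O under - t e_j; since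
    realisations are open, the mass of g^2 on them tends to 0 by dominated convergence. *)
Lemma stoch_deriv_supported O j f g : measurable O ->
  {ae P, forall w, open (realised_set T O w)} ->
  supported_in P O f -> stoch_deriv P T j f g ->
  {ae P, forall w, \1_O w * g w = g w}.
Proof.
move=> mO oO sf /[dup] fg /stoch_derivP[fL gL h].
have mg := L2_measurable gL.
pose e := basisv j : 'rV[R]_d.
have mcO : measurable_fun setT (\1_(~` O) : Omega -> R).
  by apply: measurable_indic; exact: measurableC.
have m1O : measurable_fun setT (\1_O : Omega -> R) by exact: measurable_indic.
pose k t w : R := \1_(~` O) (T (- (t *: e)) w) * \1_O w * g w.
have mk t : measurable_fun setT (k t).
  by apply: measurable_funM => //; apply: measurable_funM => //; exact: measurable_shift.
have k0 : sqint P (k n.+1%:R^-1) @[n --> \oo] --> 0%E.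
  have [] := @dominated_convergence _ _ _ P _ measurableT
      (fun n w => ((k n.+1%:R^-1 w) ^+ 2)%:E) (cst 0%E) (fun w => ((g w) ^+ 2)%:E).
  - by move=> n; exact: measurable_sq.
  - exact: measurable_cst.
  - apply: filterS oO => w ow _.
    have [Ow|nOw] := pselect (O w); last first.
      rewrite (_ : (fun n => _) = cst 0%E); first exact: cvg_cst.
      apply/funext => n; rewrite /k (indicE _ O) memNset// mulr0 mul0r expr0n //.
    apply: cvg_near_cst; near=> n.
    rewrite /k indicE memNset ?mul0r ?expr0n//=; apply; near: n.
    have /(_ (realised_set T O w)) : (- (n.+1%:R^-1 *: e)) @[n --> \oo] --> (0 : 'rV[R]_d).
      rewrite -oppr0 -(scale0r e); apply: cvgN; apply: cvgZr_tmp.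
      exact: cvg_harmonic.
    by apply; apply: open_nbhs_nbhs; split => //; rewrite /realised_set /= shift0.
  - exact: L2_sqr_integrable.
  - apply: aeW => w n _; rewrite /= lee_fin ger0_norm ?sqr_ge0//.
    rewrite /k exprMn ler_piMl ?sqr_ge0// -[leLHS]real_normK ?num_real// exprn_ile1//.
  - by move=> _ _; rewrite /sqint integral_cst// mul0e.
have mcg : measurable_fun setT (fun w => \1_(~` O) w * g w) by exact: measurable_funM.
suff : sqint P (fun w => \1_(~` O) w * g w) = 0%E.
  move/(sqint_eq0 mcg); apply: filterS => w.
  rewrite !indicE in_setC; case: (w \in O) => /=; first by rewrite mul1r.
  by rewrite mul1r => ->; rewrite mulr0.
apply/eqP; rewrite eq_le sqint_ge0 andbT; apply/lee_addgt0Pr => eps eps0.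
(* The constants add up to 2 * 1 + 2 * 10 = 22 hundredths, where 10 = 2 * 1 + 2 * 4 comes from [h4]
   and 4 from [h3]. *)
have eps1 : 0 < eps / 100 by rewrite divr_gt0.
have [dlt dlt0 hd] := h _ eps1.
have [n] : exists n, (sqint P (k n.+1%:R^-1)%R <= (eps / 100)%:E)%E /\ n.+1%:R^-1 < dlt.
  have k1 : \forall n \near \oo, (sqint P (k n.+1%:R^-1)%R < (eps / 100)%:E)%E.
    exact: (cvge0_lt k0).
  have [n [kn nd]] := filter_ex (filterI k1 (near_infty_natSinv_lt (PosNum dlt0))).
  by exists n; split => //; exact: ltW.
move=> [kn nd]; set t : R := n.+1%:R^-1 in kn nd.
have t0 : 0 < t by rewrite invr_gt0.
have {}kn : (sqint P (k t) <= (eps / 100)%:E)%E by [].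
have h1 := hd t (lt0r_neq0 t0); rewrite gtr0_norm// in h1; have {}h1 := h1 nd.
have h2 := hd (- t); rewrite oppr_eq0 (lt0r_neq0 t0) normrN gtr0_norm// in h2.
have {}h2 := h2 isT nd.
have mq s : measurable_fun setT (fun w => diffquot j s f w - g w).
  exact: L2_measurable (L2B (L2_diffquot j s fL) gL).
have mgT : measurable_fun setT (fun w => g (T (- (t *: e)) w)) by exact: measurable_shift.
(* The quotient with increment t at the point shifted by - t e is the quotient with increment - t at
   w. It is close both to g at the shifted point and to g at w, so g changes little under the
   shift. *)
have h3 : (sqint P (fun w => g (T (- (t *: e)) w) - g w)%R <= (4 * (eps / 100))%:E)%E.
  apply: le_trans (@le_sqintD _ _ _ P _
    (fun w => - (diffquot j t f (T (- (t *: e)) w) - g (T (- (t *: e)) w)))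
    (fun w => diffquot j (- t) f w - g w) _ _ _) _ => //.
  - by apply: measurable_funN; exact: (measurable_shift _ (mq t)).
  - move=> w; rewrite /diffquot (shiftKN (t *: e)) scaleNr; field; exact: lt0r_neq0.
  - rewrite sqintN (sqint_shift _ (mq t)).
    apply: (@le_trans _ _ (2%:E * (eps / 100)%:E + 2%:E * (eps / 100)%:E)%E).
      by apply: leeD; apply: lee_wpmul2l.
    by rewrite -!EFinM -!EFinD lee_fin; lra.
pose b w : R := \1_(~` O) w * \1_O (T (t *: e) w) * g w.
have mb : measurable_fun setT b.
  by apply: measurable_funM => //; apply: measurable_funM => //; exact: measurable_shift.
have h4 : (sqint P b <= (10 * (eps / 100))%:E)%E.
  rewrite -(sqint_shift (- (t *: e)) mb).
  apply: le_trans (@le_sqintD _ _ _ P _ (k t)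
    (fun w => \1_(~` O) (T (- (t *: e)) w) * \1_O w * (g (T (- (t *: e)) w) - g w)) _ _ _) _ => //.
  - apply: measurable_funM; last exact: measurable_funB.
    by apply: measurable_funM => //; exact: measurable_shift.
  - by move=> w; rewrite /b /k (shiftKN (t *: e)); ring.
  - apply: (@le_trans _ _ (2%:E * (eps / 100)%:E + 2%:E * (4 * (eps / 100))%:E)%E).
      apply: leeD; apply: lee_wpmul2l => //; apply: le_trans h3; apply: le_sqint.
      + apply: measurable_funM; last exact: measurable_funB.
        by apply: measurable_funM => //; exact: measurable_shift.
      + exact: measurable_funB.
      + move=> w; rewrite normrM ler_piMl// normrM.
        by rewrite mulr_ile1// normr_indic_le1.
    by rewrite -!EFinM -!EFinD lee_fin; lra.
have h5 : (sqint P (fun w => \1_(~` O) w * g w)%R <=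
    2%:E * sqint P (fun w => diffquot j t f w - g w)%R + 2%:E * sqint P b)%E.
  pose b1 w : R := \1_(~` O) w * (1 - \1_O (T (t *: e) w)) * (g w - diffquot j t f w).
  have mb1 : measurable_fun setT b1.
    apply: measurable_funM; last exact: measurable_funB mg (L2_measurable (L2_diffquot j t fL)).
    apply: measurable_funM => //; apply: measurable_funB => //; exact: measurable_shift.
  rewrite (@ae_eq_sqint _ _ _ P _ (fun w => b1 w + b w))//; last 2 first.
  - exact: measurable_funD.
  - apply: filterS2 sf (ae_shift (t *: e) sf) => w E1 E2.
    rewrite /b1 /b /diffquot -E1 -E2 !indicE in_setC.
    by case: (w \in O); case: (_ \in O) => /=; ring.
  have h6 := @le_sqintD _ _ _ P (fun w => b1 w + b w) b1 b mb1 mb (fun w => erefl _).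
  apply: (le_trans h6); apply: leeD => //; apply: lee_wpmul2l => //.
  apply: le_sqint => // w; rewrite normrM [X in _ <= X]distrC ler_piMl//.
  rewrite normrM mulr_ile1// ?normr_indic_le1// indicE.
  by case: (_ \in _); rewrite ?subrr ?subr0 ?normr0 ?normr1.
rewrite add0e; apply: le_trans h5 _.
apply: (@le_trans _ _ (2%:E * (eps / 100)%:E + 2%:E * (10 * (eps / 100))%:E)%E).
  by apply: leeD; apply: lee_wpmul2l.
by rewrite -!EFinM -!EFinD lee_fin; lra.
Unshelve. all: by end_near. Qed.

End stoch_deriv_facts.

(** * Lebesgue measure on R^d *)

Section lebesgue_affine.
Context {R : realType}.

(** The scaled push-forward is a measure that agrees with Lebesgue measure on half-open intervals,
    and these determine it. *)
Lemma lebesgue_affine (c v : R) (A : set (measurableTypeR R)) : 0 < c -> measurable A ->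
  (lebesgue_measure A = c%:E * lebesgue_measure ((fun t : R => (c * t + v)%R) @^-1` A))%E.
Proof.
move=> c0 mA.
have mphi : measurable_fun [set: measurableTypeR R]
    (fun t : measurableTypeR R => c * t + v : measurableTypeR R).
  by apply: measurable_funD => //; exact: measurable_funM.
pose nu : {measure set (measurableTypeR R) -> \bar R} :=
  mscale (NngNum (ltW c0))
    (measure_function_pushforward__canonical__measure_function_Measure lebesgue_measure mphi).
have -> : (c%:E * lebesgue_measure ((fun t : R => (c * t + v)%R) @^-1` A) = nu A)%E by [].
apply: lebesgue_measure_unique => // _ [[a b] _ <-].
rewrite /nu /= /mscale /= /pushforward.
have -> : (fun t : measurableTypeR R => c * t + v : measurableTypeR R) @^-1` `]a, b]%classic =
    `](a - v) / c, (b - v) / c]%classic.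
  apply/seteqP; split=> t; rewrite /= !in_itv /= => /andP[h1 h2]; apply/andP; split.
  - by rewrite ltr_pdivrMr// ltrBlDr mulrC.
  - by rewrite ler_pdivlMr// lerBrDr mulrC.
  - by move: h1; rewrite ltr_pdivrMr// ltrBlDr mulrC.
  - by move: h2; rewrite ler_pdivlMr// lerBrDr mulrC.
rewrite !lebesgue_measure_itv /= !lte_fin ltr_pM2r ?invr_gt0// ltrD2r.
case: ifPn => _; last by rewrite mule0.
by rewrite -!EFinB -EFinM; congr (_%:E); field; rewrite gt_eqF.
Qed.

Lemma ge0_integral_affine (c v : R) (f : R -> \bar R) : 0 < c ->
  measurable_fun setT f -> (forall t, 0 <= f t)%E ->
  (\int[lebesgue_measure]_t f (c * t + v)%R =
   (c^-1)%:E * \int[lebesgue_measure]_t f t)%E.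
Proof.
move=> c0 mf f0.
have mphi : measurable_fun [set: measurableTypeR R]
    (fun t : measurableTypeR R => c * t + v : measurableTypeR R).
  by apply: measurable_funD => //; exact: measurable_funM.
have := ge0_integral_pushforward mphi lebesgue_measure measurableT mf (fun w _ => f0 w).
rewrite preimage_setT => <-.
have ic0 : 0 <= c^-1 by rewrite invr_ge0 ltW.
rewrite -(ge0_integral_mscale lebesgue_measure measurableT (NngNum ic0) mf)//.
apply: eq_measure_integral => A mA _ /=; rewrite /mscale /= /pushforward.
by rewrite (lebesgue_affine v c0 mA) muleA -EFinM mulVf ?mul1e// gt_eqF.
Qed.

End lebesgue_affine.

Section leb_facts.
Context {R : realType}.

Definition box {n : nat} (a b : 'I_n -> R) : set 'rV[R]_n :=
  [set x | forall i, a i < x 0 i < b i].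

Definition cube n (r : R) : set 'rV[R]_n := box (fun=> - r) (fun=> r).

Arguments cube : clear implicits.

Lemma normr_coord_le n (x : 'rV[R]_n) i : `|x 0 i| <= `|x|.
Proof.
rewrite [X in _ <= X]mx_normrE.
exact: (le_bigmax _ (fun ij : 'I_1 * 'I_n => `|x ij.1 ij.2|) (0, i)).
Qed.

Lemma normr_rv_lt n (x : 'rV[R]_n) r : 0 < r ->
  (forall i, `|x 0 i| < r) -> `|x| < r.
Proof.
move=> r0 h; rewrite [X in X < _]mx_normrE; apply/bigmax_ltP; split => // -[i j] _ /=.
by rewrite ord1.
Qed.

Lemma measurable_coord_itv n (i : 'I_n) (a b : R) :
  measurable [set x : 'rV[R]_n | a < x 0 i < b].
Proof.
rewrite -[X in measurable X]setTI.
rewrite (_ : [set x | _] = (fun x : 'rV[R]_n => x 0 i) @^-1` `]a, b[%classic).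
  exact: measurable_coord.
by apply/seteqP; split => x /=; rewrite in_itv.
Qed.

Lemma measurable_box n (a b : 'I_n -> R) : measurable (box a b).
Proof.
rewrite (_ : box a b = \bigcap_(i in [set: 'I_n]) [set x : 'rV[R]_n | a i < x 0 i < b i]).
  by apply: fin_bigcap_measurable => // i _; exact: measurable_coord_itv.
by apply/seteqP; split => [x h i _|x h i]; [exact: h|exact: h].
Qed.

Lemma ge0_integral_leb_succ n (f : 'rV[R]_n.+1 -> \bar R) :
  measurable_fun setT f -> (forall x, 0 <= f x)%E ->
  (\int[leb R n.+1]_x f x =
   \int[lebesgue_measure]_t \int[leb R n]_y f (rv_cons (t, y)))%E.
Proof.
move=> mf f0.
rewrite [LHS](_ : _ = \int[(lebesgue_measure \x leb R n)]_z f (rv_cons z))%E.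
  apply: (fubini_tonelli1 (fun z => f (rv_cons z))) => //.
  by apply: measurableT_comp => //; exact: measurable_rv_cons.
have := ge0_integral_pushforward (@measurable_rv_cons R n) (lebesgue_measure \x leb R n)%E measurableT mf (fun w _ => f0 w).
by rewrite preimage_setT.
Qed.

Lemma rv_cons0 n (t : R) (y : 'rV[R]_n) :
  rv_cons (t : measurableTypeR R, y) 0 ord0 = t.
Proof.
transitivity (rv_cons (t : measurableTypeR R, y) 0 (lshift n (ord0 : 'I_1))).
  by congr (rv_cons _ _ _); exact/val_inj.
by rewrite /rv_cons (row_mxEl (t : R)%:M) mxE eqxx mulr1n.
Qed.

Lemma rv_consS n (t : R) (y : 'rV[R]_n) i :
  rv_cons (t : measurableTypeR R, y) 0 (lift ord0 i) = y 0 i.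
Proof.
transitivity (rv_cons (t : measurableTypeR R, y) 0 (rshift 1 i)).
  by congr (rv_cons _ _ _); exact/val_inj.
by rewrite /rv_cons (row_mxEr (t : R)%:M).
Qed.

Lemma measurable_rv_affine n (c : R) (v : 'rV[R]_n) :
  measurable_fun setT (fun x : 'rV[R]_n => c *: x + v).
Proof.
apply: measurable_fun_rv => i; under eq_fun do rewrite !mxE.
apply: measurable_funD => //; apply: measurable_funM => //.
exact: measurable_coord.
Qed.

Lemma ge0_integral_leb_affine n (c : R) (v : 'rV[R]_n) (f : 'rV[R]_n -> \bar R) :
  0 < c -> measurable_fun setT f -> (forall x, 0 <= f x)%E ->
  (\int[leb R n]_x f (c *: x + v)%R = ((c ^- n)%:E * \int[leb R n]_x f x))%E.
Proof.
move=> c0; elim: n v f => [|n ih] v f mf f0.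
  rewrite expr0 invr1 mul1e; apply: eq_integral => x _; congr f.
  by apply/rowP => -[].
have mfa : measurable_fun setT (fun x : 'rV[R]_n.+1 => f (c *: x + v)).
  exact: (measurableT_comp mf (measurable_rv_affine c v)).
rewrite !ge0_integral_leb_succ//.
pose v' : 'rV[R]_n := \row_i v 0 (lift ord0 i).
have rvE (t : R) (y : 'rV[R]_n) : c *: rv_cons (t : measurableTypeR R, y) + v =
    rv_cons (c * t + v 0 ord0 : measurableTypeR R, c *: y + v').
  apply/rowP => i; rewrite [LHS]mxE [X in X + _]mxE.
  by case: (unliftP ord0 i) => [j ->|->]; rewrite ?rv_cons0 ?rv_consS ?mxE.
under eq_integral do under eq_integral do rewrite rvE.
have mft t : measurable_fun setT (fun y : 'rV[R]_n => f (rv_cons (t : measurableTypeR R, y))).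
  apply: (measurableT_comp mf); apply: (measurableT_comp (@measurable_rv_cons R n)).
  exact: measurable_fun_pair.
pose F (t : R) : \bar R := (\int[leb R n]_y f (rv_cons (t : measurableTypeR R, y)))%E.
have mF : measurable_fun setT F.
  apply: (measurable_fun_fubini_tonelli_F (fun z => f (rv_cons z))) => //.
  by apply: measurableT_comp => //; exact: measurable_rv_cons.
have F0 t : (0 <= F t)%E by exact: integral_ge0.
transitivity (\int[lebesgue_measure]_t ((c ^- n)%:E * F (c * t + v 0 ord0)%R))%E.
  by apply: eq_integral => t _; rewrite -(ih v' _ (mft _)).
rewrite -/F.
have mF' : measurable_fun setT (fun t : R => F (c * t + v 0 ord0)).
  by apply: (measurableT_comp mF); apply: measurable_funD => //; exact: measurable_funM.
rewrite (ge0_integralZl lebesgue_measure measurableT mF' (fun t _ => F0 _)); last first.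
  by rewrite lee_fin invr_ge0 exprn_ge0// ltW.
by rewrite (ge0_integral_affine (v 0 ord0) c0 mF F0) muleA -EFinM exprSr invfM.
Qed.

Lemma leb_box n (a b : 'I_n -> R) : (forall i, a i <= b i) ->
  leb R n (box a b) = (\prod_i (b i - a i))%:E.
Proof.
elim: n a b => [|n ih] a b ab.
  rewrite big_ord0 /= diracE mem_set// => -[]//.
have -> : leb R n.+1 (box a b) = (\int[leb R n.+1]_x (\1_(box a b) x)%:E)%E.
  by rewrite integral_indic ?setIT//; exact: measurable_box.
rewrite ge0_integral_leb_succ//; last first.
  by apply/measurable_EFinP; apply: measurable_indic; exact: measurable_box.
rewrite big_ord_recl /=.
pose b' := box (fun i : 'I_n => a (lift ord0 i)) (fun i => b (lift ord0 i)).
have E (t : R) (y : 'rV[R]_n) : \1_(box a b) (rv_cons (t : measurableTypeR R, y)) =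
    \1_(`]a ord0, b ord0[%classic : set R) t * \1_b' y :> R.
  rewrite !indicE -natrM mulnb; congr ((nat_of_bool _)%:R).
  apply/idP/andP => [/set_mem h|[/set_mem h1 /set_mem h2]].
    split; apply/mem_set; first by have := h ord0; rewrite rv_cons0 /= in_itv.
    by move=> i; have := h (lift ord0 i); rewrite rv_consS.
  apply/mem_set => i; case: (unliftP ord0 i) => [j ->|->]; rewrite ?rv_cons0 ?rv_consS.
    exact: h2.
  by move: h1; rewrite /= in_itv.
transitivity (\int[lebesgue_measure]_t
    ((\1_(`]a ord0, b ord0[%classic : set R) t)%:E * (\prod_i (b (lift ord0 i) - a (lift ord0 i)))%:E))%E.
  apply: eq_integral => t _; under eq_integral do rewrite E EFinM.
  rewrite ge0_integralZl//; last first.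
    by apply/measurable_EFinP; apply: measurable_indic; exact: measurable_box.
  have -> : (\int[leb R n]_y (\1_b' y)%:E = leb R n b')%E.
    by rewrite integral_indic ?setIT//; exact: measurable_box.
  by rewrite ih.
rewrite ge0_integralZr//=; last 2 first.
- by apply/measurable_EFinP; apply: measurable_indic.
- by rewrite lee_fin; apply: prodr_ge0 => i _; rewrite subr_ge0.
rewrite integral_indic ?setIT//= lebesgue_measure_itv/= lte_fin.
rewrite EFinM; congr (_ * _)%E.
have := ab ord0; rewrite le_eqVlt => /orP[/eqP->|->//].
by rewrite ltxx subrr.
Qed.

Lemma leb_cube n r : 0 <= r -> leb R n (cube n r) = ((r *+ 2) ^+ n)%:E.
Proof.
move=> r0; rewrite leb_box; last by move=> _; rewrite ge0_cp.
by rewrite prodr_const card_ord opprK mulr2n.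
Qed.

Lemma leb_cube_lty n r : (leb R n (cube n r) < +oo)%E.
Proof.
have [r0|r0] := leP 0 r; first by rewrite leb_cube// ltry.
apply: (@le_lt_trans _ _ (leb R n (cube n 0))); last by rewrite leb_cube// ltry.
apply: le_measure; rewrite ?inE; [exact: measurable_box|exact: measurable_box|].
by move=> x h i; have := h i; rewrite oppr0; lra.
Qed.

Lemma sub_cube n r s : r <= s -> cube n r `<=` cube n s.
Proof. by move=> rs x h i; have /andP[h1 h2] := h i; apply/andP; split; lra. Qed.

Lemma cube_norm n r (x : 'rV[R]_n) : 0 < r -> cube n r x <-> `|x| < r.
Proof.
move=> r0; split=> h.
  by apply: normr_rv_lt => // i; rewrite ltr_norml; exact: h.
move=> i; rewrite -ltr_norml; apply: le_lt_trans h; exact: normr_coord_le.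
Qed.

Lemma bigcup_cube n : \bigcup_(k : nat) cube n k%:R = [set: 'rV[R]_n].
Proof.
apply/seteqP; split => // x _; exists (Num.trunc `|x|).+1 => //=.
by apply/cube_norm; [rewrite ltr0n|rewrite truncnS_gt].
Qed.

(** The sigma-algebra is generated by the coordinates, so f is written as a limit of measurable
    functions: each coordinate is rounded down to a multiple of 1 / (k + 1), which leaves countably
    many values, each taken on a measurable set. *)
Lemma continuous_measurable_rv n (f : 'rV[R]_n -> R) : continuous f ->
  measurable_fun setT f.
Proof.
move=> cf.
pose rnd (k : nat) (x : 'rV[R]_n) : 'rV[R]_n :=
  \row_i ((Num.floor (k.+1%:R * x 0 i))%:~R / k.+1%:R).
apply: (@measurable_fun_cvg _ _ _ _ (fun k x => f (rnd k x))) => [k|x _]; last first.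
  apply: (@continuous_cvg _ _ _ _ _ (rnd ^~ x) f x (cf x)).
  apply/cvgrPdist_lt => e e0; near=> k.
  apply: normr_rv_lt => // i; rewrite !mxE.
  have k0 : 0 < k.+1%:R :> R by rewrite ltr0n.
  rewrite -[X in X - _](mulfK (lt0r_neq0 k0)) -mulrBl normrM [X in _ * X]ger0_norm ?invr_ge0 ?ltW//.
  rewrite mulrC; apply: (@le_lt_trans _ _ (k.+1%:R^-1 * 1)).
    rewrite ler_wpM2l ?invr_ge0 ?ltW// mulrC.
    have /andP[h1 h2] := floor_itv (k.+1%:R * x 0 i).
    by rewrite ger0_norm ?subr_ge0// ltrBlDl -intrD1.
  rewrite mulr1; near: k; exact: (near_infty_natSinv_lt (PosNum e0)).
move=> _ Y mY; rewrite setTI.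
pose g (z : {ffun 'I_n -> int}) : 'rV[R]_n := \row_i ((z i)%:~R / k.+1%:R).
rewrite (_ : _ @^-1` Y = \bigcup_(z in [set z | Y (f (g z))])
    [set x : 'rV[R]_n | forall i, Num.floor (k.+1%:R * x 0 i) = z i]).
  rewrite bigcup_mkcond; apply: countable_bigcupT_measurable => [|z]; first exact: countableP.
  case: ifP => // _.
  rewrite (_ : [set x | _] = \bigcap_(i in [set: 'I_n])
      ((fun x : 'rV[R]_n => x 0 i) @^-1` [set t | Num.floor (k.+1%:R * t) = z i])).
    apply: fin_bigcap_measurable => // i _; rewrite -[X in measurable X]setTI.
    apply: measurable_coord => //.
    have k0 : 0 < k.+1%:R :> R by rewrite ltr0n.
    rewrite (_ : [set t | _] = `[(z i)%:~R / k.+1%:R, (z i + 1)%:~R / k.+1%:R[%classic)//.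
    apply/seteqP; split=> t /=; rewrite in_itv/= ler_pdivrMr// ltr_pdivlMr// mulrC.
      by move=> <-; exact: floor_itv.
    by move=> h; exact: floor_def.
  by apply/seteqP; split => [x h i _|x h i]; exact: h.
apply/seteqP; split => x /=.
  move=> Yx; exists [ffun i => Num.floor (k.+1%:R * x 0 i)] => /=; last by move=> i; rewrite ffunE.
  rewrite (_ : g _ = rnd k x)//; by apply/rowP => i; rewrite !mxE ffunE.
move=> [z Yz xz]; rewrite (_ : rnd k x = g z)//.
by apply/rowP => i; rewrite !mxE xz.
Unshelve. all: by end_near. Qed.

End leb_facts.

Arguments cube {R} n r.

(** * Smooth functions and cutoffs *)

Section smooth_real_functions.
Context {R : realType}.
Implicit Types f g : R -> R.

(** The derivative is provided as a witness g, so that closure under products, inverses and affine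
    substitutions follows by induction on n. *)
Fixpoint times_derivable (n : nat) f : Prop :=
  if n is m.+1 then
    exists2 g, (forall x, is_derive x (1 : R) f (g x)) & times_derivable m g
  else True.

Lemma times_derivableW n f : times_derivable n.+1 f -> times_derivable n f.
Proof.
elim: n f => [//|n ih] f [g fg /ih hg]; by exists g.
Qed.

Definition smooth1 f := forall n, times_derivable n f.

Lemma smooth1_derive f : smooth1 f ->
  exists2 g, (forall x, is_derive x (1 : R) f (g x)) & smooth1 g.
Proof.
move=> sf; have [g fg _] := sf 1%N; exists g => // n.
have [h fh hn] := sf n.+1; rewrite (_ : g = h)//; apply/funext => x.
by have := fg x; have := fh x => -[_ <-] [_ <-].
Qed.

Lemma times_derivable_cst n (c : R) : times_derivable n (cst c).
Proof. by elim: n c => // n ih c; exists (cst 0) => // x; exact: is_derive_cst. Qed.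

Lemma times_derivableD n f g : times_derivable n f -> times_derivable n g ->
  times_derivable n (fun x => f x + g x).
Proof.
elim: n f g => // n ih f g [f' ff' hf] [g' gg' hg].
by exists (fun x => f' x + g' x); [move=> x; exact: is_deriveD|exact: ih].
Qed.

Lemma times_derivableM n f g : times_derivable n f -> times_derivable n g ->
  times_derivable n (fun x => f x * g x).
Proof.
elim: n f g => // n ih f g /[dup] sf [f' ff' hf] /[dup] sg [g' gg' hg].
exists (fun x => f x * g' x + g x * f' x).
  by move=> x; exact: is_deriveM.
apply: times_derivableD; apply: ih => //; exact: times_derivableW.
Qed.

Lemma times_derivableV n f : (forall x, f x != 0) -> times_derivable n f ->
  times_derivable n (fun x => (f x)^-1).
Proof.
move=> f0; elim: n => // n ih /[dup] /times_derivableW /ih sV [f' ff' hf].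
exists (fun x => (-1) * ((f x)^-1 * (f x)^-1 * f' x)); last first.
  apply: times_derivableM; first exact: times_derivable_cst.
  by apply: times_derivableM => //; exact: times_derivableM.
move=> x; have -> : -1 * ((f x)^-1 * (f x)^-1 * f' x) = - (f x) ^- 2 *: f' x.
  by rewrite -exprVn expr2 mulN1r scaleNr.
have [df <-] := ff' x; split; first exact: derivableV.
exact: deriveV.
Qed.

Lemma times_derivable_affine n f (a b : R) : times_derivable n f ->
  times_derivable n (fun x => f (a * x + b)).
Proof.
elim: n f => // n ih f [f' ff' hf].
exists (fun x => a * f' (a * x + b)); last first.
  by apply: times_derivableM; [exact: times_derivable_cst|exact: ih].
move=> x; rewrite mulrC.
apply: (@is_derive1_comp _ f (fun x => a * x + b)).
have h : is_derive x (1:R) ( *%R a \+ cst b) (a + 0).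
  apply: is_deriveD; have := @is_deriveZ _ _ _ (id : R -> R) a x 1 1 (is_derive_id _ _).
  by rewrite /GRing.scale /= mulr1.
by rewrite addr0 in h.
Qed.

(* [flat p] is the function t |-> p(1/t) exp(-1/t) for t > 0, extended by 0. *)
Definition flat (p : {poly R}) (t : R) : R :=
  if 0 < t then p.[t^-1] * expR (- t^-1) else 0.

(** The inequality exp(s) >= s^(m + 2) / (m + 2)! at s = 1 / t absorbs the growth t^-m of p(1 / t)
    and leaves t^2, which makes the difference quotient at 0 vanish in the limit. *)
Lemma flat_le p : exists2 C, 0 <= C & forall t, `|t| <= 1 -> `|flat p t| <= C * t ^+ 2.
Proof.
pose m := size p.
pose K := \sum_(i < size p) `|p`_i|.
have K0 : 0 <= K by apply: sumr_ge0.
exists (K * m.+2`!%:R); first by rewrite mulr_ge0.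
move=> t t1; rewrite /flat; case: ifPn => t0; last first.
  by rewrite normr0 mulr_ge0 ?sqr_ge0// mulr_ge0.
have s1 : 1 <= t^-1 by rewrite invf_ge1// (le_trans _ t1)// ler_norm.
have s0 : 0 < t^-1 by rewrite invr_gt0.
have pK : `|p.[t^-1]| <= K * t^-1 ^+ m.
  rewrite horner_coef mulr_suml; apply: le_trans (ler_norm_sum _ _ _) _.
  apply: ler_sum => i _; rewrite normrM ler_wpM2l// normrX gtr0_norm//.
  by rewrite ler_weXn2l// ltnW.
have eK : expR (- t^-1) <= m.+2`!%:R * t ^+ m.+2.
  rewrite expRN -[leRHS]invrK lef_pV2 ?posrE ?expR_gt0//; last first.
    by rewrite invr_gt0 mulr_gt0 ?ltr0n ?fact_gt0// exprn_gt0.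
  apply: le_trans (expR_ge1Dxn m.+1 (ltW s0)).
  by rewrite invfM -exprVn mulrC lerDr.
rewrite normrM [X in _ * X]ger0_norm ?expR_ge0//.
apply: (@le_trans _ _ (K * t^-1 ^+ m * (m.+2`!%:R * t ^+ m.+2))).
  by apply: ler_pM => //; exact: expR_ge0.
rewrite le_eqVlt; apply/orP; left; apply/eqP.
have tm : t^-1 ^+ m * t ^+ m = 1 by rewrite -exprMn mulVf ?expr1n// gt_eqF.
rewrite -[in t ^+ m.+2]addn2 exprD -[RHS]mulr1 -tm; ring.
Qed.

(** With s = 1 / t the derivative of p(s) exp(-s) is s^2 (p(s) - p'(s)) exp(-s). It has the same
    shape, so smoothness follows by induction for all polynomials at once. *)
Lemma is_derive_flat p t : is_derive t (1 : R) (flat p) (flat ('X^2 * (p - p^`())) t).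
Proof.
have [t0|t0|t0] := ltrgtP t 0.
- rewrite {2}/flat ltNge (ltW t0) /=.
  apply: (@near_eq_is_derive _ _ _ (cst 0)).
    near=> s; rewrite /flat ltNge ltW//; near: s.
    exact: (@cvgr_lt _ _ _ _ id t).
- rewrite {2}/flat t0.
  apply: (@near_eq_is_derive _ _ _ (fun s : R => p.[s^-1] * expR (- s^-1))).
    near=> s; rewrite /flat ifT//; near: s.
    exact: (@cvgr_gt _ _ _ _ id t).
  have tn0 : t != 0 by rewrite gt_eqF.
  have dV := @is_deriveV R id t 1 1 tn0 (is_derive_id _ _).
  have d1 := @is_derive1_comp R (horner p) (fun s => s^-1) t _ _ (is_derive_poly p _) dV.
  have dN := @is_deriveN _ _ _ (fun s : R => s^-1) t 1 _ dV.
  have d2 := @is_derive1_comp R expR (fun s => - s^-1) t _ _ (is_derive_expR _) dN.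
  apply: is_derive_eq (is_deriveM d1 d2) _.
  rewrite /GRing.scale /= !hornerE /=.
  by rewrite -exprVn; ring.
- rewrite t0 {2}/flat ltxx.
  have [C C0 hC] := flat_le p.
  have h : h^-1 *: ((flat p \o shift 0) (h *: (1 : R)) - flat p 0) @[h --> 0^'] --> (0 : R).
    apply/cvgrPdist_le => e e0; near=> h.
    have h1 : `|h| <= 1.
      by rewrite ltW//; near: h; apply: (@dnbhs0_lt _ _ 1).
    have h2 : `|h| < e / (C + 1).
      by near: h; apply: dnbhs0_lt; rewrite divr_gt0// ltr_wpDl.
    have h0 : h != 0 by near: h; exact: nbhs_dnbhs_neq.
    rewrite /flat ltxx subr0 -/(flat p _) sub0r normrN /GRing.scale /= mulr1 addr0 normrM normfV.
    rewrite ler_pdivrMl ?normr_gt0//; apply: le_trans (hC _ h1) _.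
    rewrite -real_normK ?num_real// expr2 mulrCA ler_wpM2l//.
    rewrite ltr_pdivlMr ?ltr_wpDl// in h2.
    by have := normr_ge0 h; nra.
  have dp : derivable (flat p) 0 1 by apply/cvg_ex; exists 0.
  by split => //; apply: cvg_lim h.
Unshelve. all: by end_near. Qed.

Lemma smooth1_flat p : smooth1 (flat p).
Proof.
by move=> n; elim: n p => // n ih p; eexists; [exact: is_derive_flat|exact: ih].
Qed.

(** The standard smooth transition from 0 (for t <= 0) to 1 (for t >= 1); the denominator is
    positive because t and 1 - t are never both nonpositive. *)
Definition sstep (t : R) : R := flat 1 t / (flat 1 t + flat 1 (1 - t)).

Lemma flat1_ge0 t : 0 <= flat 1 t.
Proof. by rewrite /flat; case: ifP => // _; rewrite hornerC mul1r expR_ge0. Qed.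

Lemma flat1_gt0 t : 0 < t -> 0 < flat 1 t.
Proof. by move=> t0; rewrite /flat t0 hornerC mul1r expR_gt0. Qed.

Lemma sstep_den_gt0 t : 0 < flat 1 t + flat 1 (1 - t).
Proof.
have [t0|t0] := ltP 0 t; first by rewrite ltr_pwDl ?flat1_gt0 ?flat1_ge0.
by rewrite ltr_wpDl ?flat1_ge0// flat1_gt0// subr_gt0 (le_lt_trans t0).
Qed.

Lemma smooth1_sstep : smooth1 sstep.
Proof.
move=> n; apply: times_derivableM; first exact: smooth1_flat.
apply: times_derivableV; first by move=> t; rewrite gt_eqF// sstep_den_gt0.
apply: times_derivableD; first exact: smooth1_flat.
under eq_fun do rewrite -mulN1r addrC.
exact/times_derivable_affine/smooth1_flat.
Qed.

Lemma sstep_ge0 t : 0 <= sstep t.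
Proof. by rewrite divr_ge0 ?flat1_ge0// ltW// sstep_den_gt0. Qed.

Lemma sstep_le1 t : sstep t <= 1.
Proof. by rewrite ler_pdivrMr ?sstep_den_gt0// mul1r lerDl flat1_ge0. Qed.

Lemma sstep_eq0 t : t <= 0 -> sstep t = 0.
Proof. by move=> t0; rewrite /sstep {1}/flat ltNge t0 mul0r. Qed.

Lemma sstep_eq1 t : 1 <= t -> sstep t = 1.
Proof.
move=> t1; rewrite /sstep [X in _ + X]/flat subr_gt0 ltNge t1 /= addr0 divff//.
by rewrite gt_eqF// flat1_gt0// (lt_le_trans _ t1).
Qed.

Definition dsstep : R -> R := projT1 (cid2 (smooth1_derive smooth1_sstep)).

Lemma is_derive_sstep t : is_derive t (1 : R) sstep (dsstep t).
Proof. by rewrite /dsstep; case: cid2. Qed.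

Lemma smooth1_dsstep : smooth1 dsstep.
Proof. by rewrite /dsstep; case: cid2. Qed.

Lemma smooth1_continuous f : smooth1 f -> continuous f.
Proof.
move=> /(_ 1%N)[g fg _] x; apply: differentiable_continuous.
by apply/derivable1_diffP; have [] := fg x.
Qed.

(** At such points [sstep] attains its global minimum 0 or maximum 1. Fermat's rule covers the
    endpoints 0 and 1 as well. *)
Lemma dsstep_eq0 t : ~~ (0 < t < 1) -> dsstep t = 0.
Proof.
have tt : t \in `](t - 1), (t + 1)[ by rewrite in_itv/= ltrBlDr !ltrDl ltr01.
have dS s : derivable sstep s 1 by have [] := is_derive_sstep s.
have lt1 : t - 1 < t + 1 by lra.
have [_ <-] := is_derive_sstep t.
rewrite negb_and -!leNgt => /orP[t0|t1].
  have := @derive1_at_min R sstep (t - 1) (t + 1) t (ltW lt1) (fun s _ => dS s) tt.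
  move=> -[] // s _; by rewrite (sstep_eq0 t0) sstep_ge0.
have := @derive1_at_max R sstep (t - 1) (t + 1) t (ltW lt1) (fun s _ => dS s) tt.
move=> -[] // s _; by rewrite (sstep_eq1 t1) sstep_le1.
Qed.

Lemma dsstep_bounded : exists2 K, 0 <= K & forall t, `|dsstep t| <= K.
Proof.
have cd : {within `[0, 1], continuous (fun t => `|dsstep t|)}.
  apply: continuous_subspaceT => t.
  apply: (@continuous_comp _ _ _ dsstep (fun x => `|x|)).
    exact: smooth1_continuous smooth1_dsstep _.
  exact: norm_continuous.
have [c _ hc] := EVT_max ler01 cd.
exists `|dsstep c| => // t; have [t01|t01] := boolP (0 < t < 1).
  by apply: hc; rewrite in_itv/=; case/andP: t01 => /ltW-> /ltW->.
by rewrite dsstep_eq0// normr0.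
Qed.

End smooth_real_functions.

Section partial_derivatives.
Context {R : realType} {n : nat}.
Implicit Types (f g : 'rV[R]_n -> R) (x : 'rV[R]_n) (i j : 'I_n).

Definition pd i f : 'rV[R]_n -> R := fun x => 'D_(basisv i) f x.

(** The counterpart of [smooth] with a recursion on the order, the innermost derivative being taken
    first; this suits inductive proofs for sums and products. *)
Fixpoint kdiff (k : nat) f : Prop :=
  (forall x, differentiable f x) /\
  (if k is m.+1 then forall i, kdiff m (pd i f) else True).

Lemma kdiff_differentiable k f x : kdiff k f -> differentiable f x.
Proof. by case: k => [|k] [+ _]; exact. Qed.

Lemma kdiff_smooth f : (forall k, kdiff k f) -> smooth f.
Proof.
move=> kf s; elim/last_ind: s f kf => [|s i ih] f kf x.
  exact: kdiff_differentiable (kf 0%N).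
rewrite /iter_partial foldr_rcons; apply: ih => k.
by have [_] := kf k.+1; exact.
Qed.

Lemma smooth_kdiff f : smooth f -> forall k, kdiff k f.
Proof.
move=> sf k; elim: k f sf => [|k ih] f sf; split => //; try exact: (sf [::]).
move=> i; apply: ih => s x; have := sf (rcons s i) x.
by rewrite /iter_partial foldr_rcons.
Qed.

Lemma kdiffW k f : kdiff k.+1 f -> kdiff k f.
Proof.
elim: k f => [|k ih] f [df hf]; split => // i; exact/ih/hf.
Qed.

Lemma pdD i f g : (forall x, differentiable f x) -> (forall x, differentiable g x) ->
  pd i (fun x => f x + g x) = fun x => pd i f x + pd i g x.
Proof.
by move=> df dg; apply/funext => x; apply: deriveD; exact: diff_derivable.
Qed.

Lemma pdM i f g : (forall x, differentiable f x) -> (forall x, differentiable g x) ->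
  pd i (fun x => f x * g x) = fun x => f x * pd i g x + g x * pd i f x.
Proof.
by move=> df dg; apply/funext => x; apply: deriveM; exact: diff_derivable.
Qed.

Lemma pd_cst i (c : R) : pd i (cst c) = cst 0.
Proof. by apply/funext => x; exact: derive_cst. Qed.

Lemma kdiff_cst k (c : R) : kdiff k (cst c).
Proof. by elim: k c => [|k ih] c; split => // i; rewrite pd_cst; exact: ih. Qed.

Lemma kdiffD k f g : kdiff k f -> kdiff k g -> kdiff k (fun x => f x + g x).
Proof.
elim: k f g => [|k ih] f g [df hf] [dg hg]; split => //.
- by move=> x; exact: differentiableD.
- by move=> x; exact: differentiableD.
- by move=> i; rewrite pdD//; apply: ih; [exact: hf|exact: hg].
Qed.

Lemma kdiffM k f g : kdiff k f -> kdiff k g -> kdiff k (fun x => f x * g x).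
Proof.
elim: k f g => [|k ih] f g /[dup] kf [df hf] /[dup] kg [dg hg]; split => //.
- by move=> x; exact: differentiableM.
- by move=> x; exact: differentiableM.
- move=> i; rewrite pdM//; apply: kdiffD; apply: ih; try exact: kdiffW; [exact: hg|exact: hf].
Qed.

Lemma is_derive_coord (h h' : R -> R) j i x :
  (forall t, is_derive t (1 : R) h (h' t)) ->
  is_derive x (basisv i) (fun x => h (x 0 j)) ((i == j)%:R * h' (x 0 j)).
Proof.
move=> hh'; have dh : differentiable h (x 0 j).
  by apply/derivable1_diffP; have [] := hh' (x 0 j).
have dc := @differentiable_coord R _ _ x 0 j.
have df : differentiable (h \o (fun y : 'rV[R]_n => y 0 j)) x by exact: differentiable_comp.
split; first exact: diff_derivable.
have [_ hx] := hh' (x 0 j); rewrite -hx /derive.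
have [ij|ij] := eqVneq i j; last first.
  rewrite mul0r; apply/cvg_lim => //; rewrite [X in X @ _](_ : _ = cst 0); first exact: cvg_cst.
  apply/funext => t /=; rewrite !mxE (eq_sym j) (negbTE ij) andbF mulr0 add0r subrr.
  by rewrite scaler0.
rewrite ij mul1r; set F := (X in lim (X @ _)); set G := (X in _ = lim (X @ _)).
suff -> : F = G by [].
by apply/funext => t; rewrite /F /G /= !mxE !eqxx.
Qed.

Lemma differentiable_coord_comp (h : R -> R) j x : (forall t, derivable h t (1 : R)) ->
  differentiable (fun x : 'rV[R]_n => h (x 0 j)) x.
Proof.
move=> dh; apply: (@differentiable_comp _ _ _ _ (fun y : 'rV[R]_n => y 0 j) h).
  exact: differentiable_coord.
exact/derivable1_diffP/dh.
Qed.

Lemma pd_coord (h h' : R -> R) j i : (forall t, is_derive t (1 : R) h (h' t)) ->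
  pd i (fun x => h (x 0 j)) = fun x => (i == j)%:R * h' (x 0 j).
Proof.
by move=> hh'; apply/funext => x; have [_] := is_derive_coord j i x hh'.
Qed.

Lemma kdiff_coord k h j : smooth1 h -> kdiff k (fun x => h (x 0 j)).
Proof.
elim: k h => [|k ih] h /smooth1_derive[h' hh' sh'].
  by split => // x; apply: differentiable_coord_comp => t; have [] := hh' t.
split=> [x|i]; first by apply: differentiable_coord_comp => t; have [] := hh' t.
rewrite (pd_coord j i hh'); apply: kdiffM; first exact: kdiff_cst.
exact: ih.
Qed.

Lemma is_derive_affine f (c : R) v i x : (forall x, differentiable f x) ->
  is_derive x (basisv i) (fun x => f (c *: x + v)) (c * pd i f (c *: x + v)).
Proof.
move=> df.
have da : is_diff x (fun x : 'rV[R]_n => c *: x + v) (fun y => c *: y).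
  have h := @is_diffD _ _ _ ( *:%R c) (cst v) _ _ x (is_diff_scaler c x) (is_diff_cst v x).
  by apply: is_diff_eq h _; apply/funext => y /=; rewrite addr0.
have dfa : differentiable (f \o (fun x : 'rV[R]_n => c *: x + v)) x.
  by apply: differentiable_comp => //; case: da.
split; first exact: diff_derivable.
rewrite deriveE// diff_comp//.
rewrite /= [X in 'd f _ X](_ : _ = c *: basisv i); last by rewrite diff_val.
by rewrite linearZ /pd deriveE.
Qed.

Lemma differentiable_affine f (c : R) v x : (forall x, differentiable f x) ->
  differentiable (fun x => f (c *: x + v)) x.
Proof.
by move=> df; apply: (@differentiable_comp _ _ _ _ (fun x : 'rV[R]_n => c *: x + v) f).
Qed.

Lemma pd_affine i f (c : R) v : (forall x, differentiable f x) ->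
  pd i (fun x => f (c *: x + v)) = fun x => c * pd i f (c *: x + v).
Proof.
by move=> df; apply/funext => x; have [_] := is_derive_affine c v i x df.
Qed.

Lemma kdiff_affine k f (c : R) v : kdiff k f -> kdiff k (fun x => f (c *: x + v)).
Proof.
elim: k f => [|k ih] f [df hf]; split => //; try by move=> x; exact: differentiable_affine.
move=> i; rewrite pd_affine//; apply: kdiffM; first exact: kdiff_cst.
exact/ih/hf.
Qed.

(* Symmetry of second derivatives is carried along, so that Schwarz's theorem is not needed. *)
Definition smooth_sym f := (forall k, kdiff k f) /\
  forall i j, pd i (pd j f) = pd j (pd i f).

Lemma smooth_sym_cst (c : R) : smooth_sym (cst c).
Proof. by split=> [k|i j]; [exact: kdiff_cst|rewrite !pd_cst]. Qed.

Lemma smooth_symD f g : smooth_sym f -> smooth_sym g -> smooth_sym (fun x => f x + g x).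
Proof.
move=> [sf hf] [sg hg]; split=> [k|i j]; first exact: kdiffD.
have df x := kdiff_differentiable x (sf 0%N).
have dg x := kdiff_differentiable x (sg 0%N).
have ddf i x : differentiable (pd i f) x := @kdiff_differentiable 0%N _ x ((sf 1%N).2 i).
have ddg i x : differentiable (pd i g) x := @kdiff_differentiable 0%N _ x ((sg 1%N).2 i).
by rewrite (pdD j df dg) (pdD i df dg) (pdD i (ddf j) (ddg j)) (pdD j (ddf i) (ddg i)) (hf i j) (hg i j).
Qed.

Lemma smooth_symM f g : smooth_sym f -> smooth_sym g -> smooth_sym (fun x => f x * g x).
Proof.
move=> [sf hf] [sg hg]; split=> [k|i j]; first exact: kdiffM.
have df x := kdiff_differentiable x (sf 0%N).
have dg x := kdiff_differentiable x (sg 0%N).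
have ddf i x : differentiable (pd i f) x := @kdiff_differentiable 0%N _ x ((sf 1%N).2 i).
have ddg i x : differentiable (pd i g) x := @kdiff_differentiable 0%N _ x ((sg 1%N).2 i).
have dfg k x : differentiable (fun x => f x * pd k g x) x by exact: differentiableM.
have dgf k x : differentiable (fun x => g x * pd k f x) x by exact: differentiableM.
rewrite (pdM j df dg) (pdM i df dg) (pdD i (dfg j) (dgf j)) (pdD j (dfg i) (dgf i)).
rewrite (pdM i df (ddg j)) (pdM i dg (ddf j)) (pdM j df (ddg i)) (pdM j dg (ddf i)).
rewrite (hf i j) (hg i j); apply/funext => x.
move: (pd j (pd i f) x) (pd j (pd i g) x) (pd i f x) (pd j f x) (pd i g x) (pd j g x).
by move: (f x) (g x) => *; ring.
Qed.

Lemma smooth_sym_coord h j : smooth1 h -> smooth_sym (fun x => h (x 0 j)).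
Proof.
move=> sh; split=> [k|i l]; first exact: kdiff_coord.
have [h' hh' sh'] := smooth1_derive sh; have [h'' hh'' _] := smooth1_derive sh'.
rewrite !(pd_coord _ _ hh') !pdM//; try (by move=> x; apply: differentiable_coord_comp => t; have [] := hh'' t).
rewrite !pd_cst !(pd_coord _ _ hh'').
apply/funext => x; rewrite /cst !mulr0 !addr0 !mulrA; congr (_ * _).
exact: mulrC.
Qed.

Lemma smooth_sym_sum (I : Type) (r : seq I) (F : I -> 'rV[R]_n -> R) :
  (forall k, smooth_sym (F k)) -> smooth_sym (fun x => \sum_(i <- r) F i x).
Proof.
move=> sF; elim: r => [|i r ih].
  rewrite (_ : (fun _ => _) = cst 0); first exact: smooth_sym_cst.
  by apply/funext => x; rewrite big_nil.
rewrite (_ : (fun _ => _) = fun x => F i x + \sum_(j <- r) F j x).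
  exact: (smooth_symD (sF i) ih).
by apply/funext => x; rewrite big_cons.
Qed.

Lemma smooth_sym_prod (I : Type) (r : seq I) (F : I -> 'rV[R]_n -> R) :
  (forall k, smooth_sym (F k)) -> smooth_sym (fun x => \prod_(i <- r) F i x).
Proof.
move=> sF; elim: r => [|i r ih].
  rewrite (_ : (fun _ => _) = cst 1); first exact: smooth_sym_cst.
  by apply/funext => x; rewrite big_nil.
rewrite (_ : (fun _ => _) = fun x => F i x * \prod_(j <- r) F j x).
  exact: (smooth_symM (sF i) ih).
by apply/funext => x; rewrite big_cons.
Qed.

Lemma smooth_sym_smooth f : smooth_sym f -> smooth f.
Proof. by move=> [sf _]; exact: kdiff_smooth. Qed.

Lemma cube_test_function f r : 0 < r -> smooth f -> (forall x, ~ cube n r x -> f x = 0) ->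
  test_function f.
Proof.
move=> r0 sf f0; split => //.
apply: bounded_closed_compact; last exact: closed_closure.
exists r; split; first exact: num_real.
move=> M rM x /(_ (ball x (M - r))) [|y [fy]].
  by apply: nbhsx_ballx; rewrite subr_gt0.
rewrite -ball_normE /= => xy.
have yr : `|y| < r.
  by apply/cube_norm => //; apply: contrapT => ny; move: fy; rewrite /= (f0 _ ny) eqxx.
rewrite -(subrK y x); apply: le_trans (ler_normD _ _) _; lra.
Qed.

Lemma test_function_cube f : test_function f ->
  exists2 r, 0 < r & forall x, ~ cube n r x -> f x = 0.
Proof.
move=> [_ /compact_bounded [M [Mr hM]]].
exists (`|M| + 1); first by rewrite ltr_wpDl.
move=> x nx; apply: contrapT => /eqP fx; apply: nx; apply/cube_norm.
  by rewrite ltr_wpDl.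
apply: (@le_lt_trans _ _ (`|M| + 2^-1)); last by lra.
apply: hM; first by have := ler_norm M; lra.
exact: subset_closure.
Qed.

Lemma test_function_pd f i : test_function f -> test_function (pd i f).
Proof.
move=> [sf cf]; split.
  by apply: kdiff_smooth => k; have [_] := smooth_kdiff sf k.+1; exact.
apply: (subclosed_compact _ cf); first exact: closed_closure.
rewrite [X in _ `<=` X](closure_id _).1; last exact: closed_closure.
apply: closure_subset => x /=; apply: contraNP => nx; apply/eqP.
have : \near x, f x = cst 0 x.
  have : open_nbhs x (~` closure [set x | f x != 0]).
    by split => //; apply: closed_openC; exact: closed_closure.
  move=> /open_nbhs_nbhs; apply: filterS => y ny; apply/eqP; apply: contrapT => /negP fy.
  by apply: ny; exact: subset_closure.
move=> /(near_eq_derive (basisv i)); rewrite /pd => ->.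
by rewrite derive_cst.
Qed.

Lemma test_function_continuous f : test_function f -> continuous f.
Proof.
by move=> [sf _] x; apply: differentiable_continuous; exact: (sf [::]).
Qed.

Lemma test_function_bounded f : test_function f ->
  exists M r, [/\ 0 <= M, 0 < r & forall x, `|f x| <= M * \1_(cube n r) x].
Proof.
move=> tf; have [r r0 hr] := test_function_cube tf.
have cf := test_function_continuous tf.
have : compact [set x : 'rV[R]_n | `|x| <= r].
  apply: bounded_closed_compact.
    by exists r; split=> [|M rM x /= xr]; [exact: num_real|rewrite (le_trans xr)// ltW].
  have := @closed_closed_ball_ _ 'rV[R]_n 0 r.
  by rewrite /closed_ball_; under eq_set do rewrite sub0r normrN.
move=> cK; have K0 : [set x : 'rV[R]_n | `|x| <= r] !=set0 by exists 0; rewrite /= normr0 ltW.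
have cn : {within [set x : 'rV[R]_n | `|x| <= r], continuous (fun x => `|f x|)}.
  apply: continuous_subspaceT => x; exact: (cvg_norm (cf x)).
have [c _ hc] := compact_EVT_max K0 cK cn.
exists `|f c|, r; split => // x; rewrite indicE.
have [xr|xr] := pselect (cube n r x); last by rewrite hr// normr0 mulr_ge0.
rewrite mem_set// mulr1; apply: hc; rewrite inE /= ltW//; exact/cube_norm.
Qed.

End partial_derivatives.

(** * Fubini's theorem for real-valued integrals and for null sets *)

Section fubini_facts.
Context {R : realType} {d1 d2 : measure_display}
  {X : measurableType d1} {Y : measurableType d2}.
Variables (m1 : {sigma_finite_measure set X -> \bar R})
  (m2 : {sigma_finite_measure set Y -> \bar R}).
Let mu := (m1 \x m2)%E.

Lemma ae_prodl (Q : X * Y -> Prop) : {ae mu, forall z, Q z} ->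
  {ae m1, forall x, {ae m2, forall y, Q (x, y)}}.
Proof.
move=> [N [mN N0 QN]].
have : (\int[m1]_x `|m2 (xsection N x)| = 0)%E.
  by rewrite -[RHS]N0; apply: eq_integral => x _; rewrite gee0_abs.
have mx := measurable_fun_xsection m2 mN.
move/(ae_eq_integral_abs m1 measurableT mx).
apply: filterS => x /= /(_ I) Nx; exists (xsection N x); split => //.
  exact: measurable_xsection.
by move=> y /= nQ; rewrite /xsection /= inE; exact: QN.
Qed.

Lemma ae_prodr (Q : X * Y -> Prop) : {ae mu, forall z, Q z} ->
  {ae m2, forall y, {ae m1, forall x, Q (x, y)}}.
Proof.
move=> [N [mN N0 QN]].
have : (\int[m2]_y `|m1 (ysection N y)| = 0)%E.
  rewrite -[RHS]N0 -[RHS](_ : (\int[mu]_z (\1_N z)%:E)%E = _); last by rewrite integral_indic ?setIT.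
  rewrite fubini_tonelli2//; last by apply/measurable_EFinP; exact: measurable_indic.
  apply: eq_integral => y _; rewrite gee0_abs//.
  by have := indic_fubini_tonelli_GE m1 mN => /(congr1 (fun f => f y)).
have my := measurable_fun_ysection m1 mN.
move/(ae_eq_integral_abs m2 measurableT my).
apply: filterS => y /= /(_ I) Ny; exists (ysection N y); split => //.
  exact: measurable_ysection.
by move=> x /= nQ; rewrite /ysection /= inE; exact: QN.
Qed.

Lemma rintg_fubini1 (f : X * Y -> R) : rintg mu f ->
  rintg m1 (fun x => \int[m2]_y f (x, y)).
Proof.
move=> rf; have mf := measurable_int _ rf.
have mF : measurable_fun setT (fun x => \int[m2]_y f (x, y)).
  apply: (measurableT_comp (fine_measurable measurableT)).
  exact: measurable_fubini_F rf.
apply/rintgP; split => //; have := (integrable12ltyP _ _ mf).1 rf; apply: le_lt_trans.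
apply: ge0_le_integral => //.
- by apply/measurable_EFinP; exact: measurableT_comp.
- apply: (measurable_fun_fubini_tonelli_F (abse \o (EFin \o f))) => [|z]; last exact: abse_ge0.
  exact: measurableT_comp.
- move=> x _; apply: le_trans (le_abse_integral _ measurableT _).
    (* [fine] sends an infinite integral to 0, so the bound holds on every slice, integrable or
       not. *)
    by rewrite /Rintegral; case: (\int[m2]_y _)%E => [r|//|//] /=; rewrite ?normr0 ?leey.
  exact: (measurableT_comp mf).
Qed.

Lemma Rint_fubini1 (f : X * Y -> R) : rintg mu f ->
  \int[mu]_z f z = \int[m1]_x \int[m2]_y f (x, y).
Proof.
move=> rf; rewrite {1}/Rintegral -(integral12_prod_meas1 rf) {1}/Rintegral; congr fine.
apply: ae_eq_integral => //.
- exact: measurable_fubini_F rf.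
- by apply/measurable_EFinP; exact: rintg_measurable (rintg_fubini1 rf).
- apply: filterS (ae_integrable1 rf) => x rx _.
  by rewrite /fubini_F RintE.
Qed.

Lemma rintg_fubini2 (f : X * Y -> R) : rintg mu f ->
  rintg m2 (fun y => \int[m1]_x f (x, y)).
Proof.
move=> rf; have mf := measurable_int _ rf.
have mF : measurable_fun setT (fun y => \int[m1]_x f (x, y)).
  apply: (measurableT_comp (fine_measurable measurableT)).
  exact: measurable_fubini_G rf.
apply/rintgP; split => //; have := (integrable21ltyP _ _ mf).1 rf; apply: le_lt_trans.
apply: ge0_le_integral => //.
- by apply/measurable_EFinP; exact: measurableT_comp.
- apply: (measurable_fun_fubini_tonelli_G (abse \o (EFin \o f))) => [|z]; last exact: abse_ge0.
  exact: measurableT_comp.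
- move=> x _; apply: le_trans (le_abse_integral _ measurableT _).
    by rewrite /Rintegral; case: (\int[m1]_y _)%E => [r|//|//] /=; rewrite ?normr0 ?leey.
  exact: (measurableT_comp mf).
Qed.

Lemma Rint_fubini2 (f : X * Y -> R) : rintg mu f ->
  \int[mu]_z f z = \int[m2]_y \int[m1]_x f (x, y).
Proof.
move=> rf; rewrite {1}/Rintegral -(integral21_prod_meas1 rf) {1}/Rintegral; congr fine.
apply: ae_eq_integral => //.
- exact: measurable_fubini_G rf.
- by apply/measurable_EFinP; exact: rintg_measurable (rintg_fubini2 rf).
- apply: filterS (ae_integrable2 rf) => x rx _.
  by rewrite /fubini_G RintE.
Qed.

Lemma sqint_fubini1 (f : X * Y -> R) : measurable_fun setT f ->
  sqint mu f = (\int[m1]_x sqint m2 (fun y => f (x, y)))%E.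
Proof.
move=> mf; rewrite /sqint (fubini_tonelli1 (fun z => ((f z) ^+ 2)%:E))//.
- exact: measurable_sq.
- by move=> z; rewrite lee_fin sqr_ge0.
Qed.

Lemma measurable_pair1 d (Z : measurableType d) (f : X * Y -> Z) x :
  measurable_fun setT f -> measurable_fun setT (fun y => f (x, y)).
Proof. by move=> mf; apply: (measurableT_comp mf). Qed.

Lemma measurable_pair2 d (Z : measurableType d) (f : X * Y -> Z) y :
  measurable_fun setT f -> measurable_fun setT (fun x => f (x, y)).
Proof. by move=> mf; apply: (measurableT_comp mf). Qed.

End fubini_facts.

(** * Generators of sigma-algebras and the pi-lambda argument *)

Section generators.
Context {R : realType}.

(** The sets A for which the integral vanishes form a lambda-system, increasing unions being handled
    by dominated convergence. The case of the whole space is a separate hypothesis, because bounded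
    boxes do not contain it. The map p allows the sets to constrain one component only. *)
Lemma Rint_gen_eq0 d (X : measurableType d) (mu : {measure set X -> \bar R})
    (V : X -> R) d' (Y : measurableType d') (p : X -> Y) (G : set (set Y)) :
  rintg mu V -> measurable_fun setT p -> setI_closed G -> @measurable _ Y = <<s G >> ->
  \int[mu]_x V x = 0 ->
  (forall A, G A -> \int[mu]_x (V x * \1_A (p x)) = 0) ->
  forall A, measurable A -> \int[mu]_x (V x * \1_A (p x)) = 0.
Proof.
move=> rV mp GI GE V0 GV.
have m1 A : measurable A -> measurable_fun setT (fun x => \1_A (p x) : R).
  by move=> mA; apply: measurableT_comp => //; exact: measurable_indic.
have rA A : measurable A -> rintg mu (fun x => V x * \1_A (p x)).
  by move=> mA; apply: (@rintg_bounded _ _ _ _ 1 _ _ (m1 _ mA)) => // x; exact: normr_indic_le1.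
pose H := [set A : set Y | measurable A /\ \int[mu]_x (V x * \1_A (p x)) = 0].
suff : @measurable _ Y `<=` H by move=> h A /h[].
rewrite GE; apply: lambda_system_subset => //.
- split.
  + by [].
  + split => //; rewrite -[RHS]V0; apply: eq_Rintegral => x _.
    by rewrite indicT mulr1.
  + move=> A B BA [mA A0] [mB B0]; split; first exact: measurableD.
    rewrite -[RHS]subr0 -{1}A0 -B0 -RintB; [|exact: rA|exact: rA].
    apply: eq_Rintegral => x _; rewrite -mulrBr; congr (_ * _).
    rewrite !indicE in_setD; case: (boolP (p x \in B)) => /= xB; last by rewrite andbT subr0.
    by rewrite (mem_set (BA _ (set_mem xB))) subrr.
  + move=> F ndF HF; have mF i : measurable (F i) by have [] := HF i.
    have mU : measurable (\bigcup_i F i) by exact: bigcup_measurable.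
    split => //.
    have [] := @Rint_dominated _ _ _ mu (fun n x => V x * \1_(F n) (p x))
      (fun x => V x * \1_(\bigcup_i F i) (p x)) (fun x => `|V x|).
    * by move=> n; exact: rintg_measurable (rA _ (mF n)).
    * exact: rintg_measurable (rA _ mU).
    * apply: aeW => x; apply: cvgM; first exact: cvg_cst.
      have [[k _ Fk]|nF] := pselect ((\bigcup_i F i) (p x)).
        apply: cvg_near_cst; near=> n; rewrite !indicE !mem_set//; first by exists k.
        by move: Fk; apply/subsetPset/ndF; near: n; exact: nbhs_infty_ge.
      apply: cvg_near_cst; near=> n; rewrite !indicE !memNset// => Fn.
      by apply: nF; exists n.
    * exact: rintg_norm.
    * by move=> n x; rewrite normrM ler_piMr// normr_indic_le1.
    * move=> _ /cvg_lim <-//; apply/cvg_lim => //; apply: cvg_near_cst; apply: nearW => n.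
      by have [] := HF n.
- by move=> A GA; split; [rewrite GE; exact: sub_gen_smallest|exact: GV].
Unshelve. all: by end_near. Qed.

Lemma Rint_indic_eq0 d (X : measurableType d) (mu : {measure set X -> \bar R})
    (V : X -> R) : rintg mu V ->
  (forall A, measurable A -> \int[mu]_x (V x * \1_A x) = 0) ->
  {ae mu, forall x, V x = 0}.
Proof.
move=> rV V0.
have : ae_eq mu setT (EFin \o V) (cst 0%E).
  apply: integral_ae_eq => // E _ mE; rewrite integral0 integral_mkcond.
  rewrite (_ : _ \_ E = EFin \o (fun x => V x * \1_E x)).
    rewrite -RintE ?V0//; apply: (@rintg_bounded _ _ _ _ 1) => //.
    by move=> x; exact: normr_indic_le1.
  apply/funext => x; rewrite patchE /= indicE.
  by case: ifP; rewrite ?mulr1 ?mulr0.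
by apply: filterS => x /(_ I) [].
Qed.

Definition boxes n : set (set 'rV[R]_n) := [set A | exists a b, A = box a b].

Lemma setI_closed_boxes n : setI_closed (@boxes n).
Proof.
move=> _ _ [a [b ->]] [a' [b' ->]].
exists (fun i => Num.max (a i) (a' i)), (fun i => Num.min (b i) (b' i)).
apply/seteqP; split => x /= h.
  move=> i; have [h1 h2] := h; have := h1 i; have := h2 i.
  by rewrite gt_max lt_min => /andP[-> ->] /andP[-> ->].
split=> i; have := h i; rewrite gt_max lt_min => /andP[/andP[h1 h2] /andP[h3 h4]];
  by apply/andP.
Qed.

Lemma measurable_boxes n : @measurable _ 'rV[R]_n = <<s @boxes n >>.
Proof.
apply/seteqP; split; last first.
  by apply: smallest_sub; [exact: sigma_algebra_measurable|move=> _ [a [b ->]]; exact: measurable_box].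
apply: smallest_sub; first exact: smallest_sigma_algebra.
move=> Z; elim/big_ind : _ => [//|A B hA hB [/hA|/hB]//|i _ [B mB <-]].
rewrite setTI.
have mc : measurable_fun setT ((fun x => x 0 i) : g_sigma_algebraType (@boxes n) -> R).
  apply: (measurability (@RGenOInfty.G R)); first exact: RGenOInfty.measurableE.
  move=> _ [_ [a ->] <-]; rewrite setTI.
  (* The half-space is exhausted by boxes whose other faces move to infinity. *)
  pose lo (k : nat) l : R := if l == i then a else - k%:R.
  rewrite (_ : _ @^-1` _ = \bigcup_k box (lo k) (fun=> k%:R)).
    by apply: bigcup_measurable => k _; apply: sub_sigma_algebra; exists (lo k), (fun=> k%:R).
  apply/seteqP; split => [x /=|x [k _ /(_ i)/=]]; last first.
    by rewrite /lo eqxx in_itv/= andbT => /andP[].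
  rewrite in_itv/= andbT => ax.
  have [k _ kx] : (\bigcup_(k : nat) cube n k%:R) x by rewrite bigcup_cube.
  exists k => // l; have /andP[h1 h2] := kx l; rewrite /lo h2 andbT.
  by case: eqP => [->|].
by have := mc measurableT _ mB; rewrite setTI.
Qed.

End generators.

(** * Smooth approximations of boxes *)

Section smooth_boxes.
Context {R : realType} {n : nat}.

(** For k > 0 it vanishes outside ]a, b[ and equals 1 at points at distance at least 1 / k from both
    ends. Large k approximates the indicator; k = 1 gives cutoffs whose gradient is bounded
    independently of the box. *)
Definition plateau (k a b t : R) : R := sstep (k * (t - a)) * sstep (k * (b - t)).

Lemma smooth1_affine (f : R -> R) a b : smooth1 f -> smooth1 (fun t => f (a * t + b)).
Proof. by move=> sf m; exact: times_derivable_affine. Qed.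

Lemma smooth1_plateau k a b : smooth1 (plateau k a b).
Proof.
rewrite (_ : plateau k a b = fun t => sstep (k * t + - (k * a)) * sstep ((- k) * t + k * b)).
  move=> m; apply: times_derivableM.
    exact: (smooth1_affine k (- (k * a)) smooth1_sstep).
  exact: (smooth1_affine (- k) (k * b) smooth1_sstep).
by apply/funext => t; rewrite /plateau; congr (sstep _ * sstep _); ring.
Qed.

Lemma plateau_ge0 k a b t : 0 <= plateau k a b t.
Proof. by rewrite mulr_ge0 ?sstep_ge0. Qed.

Lemma plateau_le1 k a b t : plateau k a b t <= 1.
Proof. by rewrite mulr_ile1 ?sstep_ge0 ?sstep_le1. Qed.

Lemma plateau_eq0 k a b t : 0 <= k -> ~~ (a < t < b) -> plateau k a b t = 0.
Proof.
move=> k0; rewrite negb_and -!leNgt => /orP[ta|bt]; rewrite /plateau.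
  by rewrite sstep_eq0 ?mul0r// mulr_ge0_le0// subr_le0.
by rewrite [X in _ * X]sstep_eq0 ?mulr0// mulr_ge0_le0// subr_le0.
Qed.

Lemma plateau_eq1 k a b t : 1 <= k * (t - a) -> 1 <= k * (b - t) -> plateau k a b t = 1.
Proof. by move=> h1 h2; rewrite /plateau !sstep_eq1// mulr1. Qed.

Lemma sstep_gt0 (t : R) : 0 < t -> 0 < sstep t.
Proof. by move=> t0; rewrite divr_gt0 ?flat1_gt0// sstep_den_gt0. Qed.

Lemma plateau_gt0 k a b t : 0 < k -> a < t < b -> 0 < plateau k a b t.
Proof.
by move=> k0 /andP[ta tb]; rewrite mulr_gt0// sstep_gt0// mulr_gt0// subr_gt0.
Qed.

Definition boxf (k : R) (a b : 'I_n -> R) (x : 'rV[R]_n) : R :=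
  \prod_i plateau k (a i) (b i) (x 0 i).

Lemma boxf_ge0 k a b x : 0 <= boxf k a b x.
Proof. by apply: prodr_ge0 => i _; exact: plateau_ge0. Qed.

Lemma boxf_le1 k a b x : boxf k a b x <= 1.
Proof. by apply: prodr_ile1 => i _; rewrite plateau_ge0 plateau_le1. Qed.

Lemma boxf_eq0 k a b x : 0 <= k -> ~ box a b x -> boxf k a b x = 0.
Proof.
move=> k0 /existsNP[i /negP nx]; rewrite /boxf (bigD1 i)//= plateau_eq0 ?mul0r//.
Qed.

Lemma boxf_gt0 k a b x : 0 < k -> box a b x -> 0 < boxf k a b x.
Proof. by move=> k0 bx; apply: prodr_gt0 => i _; apply: plateau_gt0 => //; exact: bx. Qed.

Lemma boxf_cvg a b x : boxf k.+1%:R a b x @[k --> \oo] --> (\1_(box a b) x : R).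
Proof.
have [bx|nbx] := pselect (box a b x); last first.
  rewrite indicE memNset//; apply: cvg_near_cst; apply: nearW => k.
  by rewrite boxf_eq0.
rewrite indicE mem_set//=.
(* A product of numbers in ]0, 1] lies below each of them, so e is a positive lower bound for the
   distances to all faces. *)
pose e := \prod_i ((Num.min (Num.min (x 0 i - a i) (b i - x 0 i)) 1)).
have mi i : 0 < Num.min (Num.min (x 0 i - a i) (b i - x 0 i)) 1.
  by have /andP[h1 h2] := bx i; rewrite !lt_min ltr01 !subr_gt0 h1 h2.
have e0 : 0 < e by apply: prodr_gt0 => i _; exact: mi.
have ei i : e <= Num.min (Num.min (x 0 i - a i) (b i - x 0 i)) 1.
  rewrite /e (bigD1 i)//=; apply: ler_piMr; first exact: ltW.
  by apply: prodr_ile1 => l _; rewrite (ltW (mi l)) /= ge_min lexx orbT.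
apply: cvg_near_cst; near=> k; rewrite /boxf big1// => i _.
have ke : 1 <= k.+1%:R * e.
  rewrite -ler_pdivrMl ?ltr0n// mulr1 ltW//; near: k.
  exact: (near_infty_natSinv_lt (PosNum e0)).
have := ei i; rewrite !le_min => /andP[/andP[h1 h2] _].
by apply: plateau_eq1; apply: le_trans ke _; rewrite ler_wpM2l.
Unshelve. all: by end_near. Qed.

Lemma smooth_sym_boxf k a b : smooth_sym (boxf k a b).
Proof. by apply: smooth_sym_prod => i; apply: smooth_sym_coord; exact: smooth1_plateau. Qed.

Lemma sub_box_cube (a b : 'I_n -> R) : exists2 r, 0 < r & box a b `<=` cube n r.
Proof.
exists (\sum_i (`|a i| + `|b i|) + 1).
  by rewrite ltr_wpDl// sumr_ge0// => i _; rewrite addr_ge0.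
move=> x bx i; have /andP[h1 h2] := bx i.
have : `|a i| + `|b i| <= \sum_i (`|a i| + `|b i|).
  by rewrite (bigD1 i)//= lerDl sumr_ge0// => j _; rewrite addr_ge0.
have := ler_norm (b i); have := normr_ge0 (a i); have := normr_ge0 (b i).
have := ler_norm (- a i); rewrite normrN.
by move=> *; apply/andP; split; lra.
Qed.

Lemma boxf_test k a b : 0 <= k -> test_function (boxf k a b).
Proof.
move=> k0; have [r r0 br] := sub_box_cube a b.
apply: (cube_test_function r0); first exact: smooth_sym_smooth (smooth_sym_boxf k a b).
by move=> x nx; apply: boxf_eq0 => // /br.
Qed.

Lemma test_functionM (f g : 'rV[R]_n -> R) : test_function f -> test_function g ->
  test_function (fun x => f x * g x).
Proof.
move=> tf tg; have [r r0 fr] := test_function_cube tf.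
apply: (cube_test_function r0); last by move=> x /fr ->; rewrite mul0r.
by apply: kdiff_smooth => k; apply: kdiffM; apply: smooth_kdiff; [case: tf|case: tg].
Qed.

Lemma test_function_measurable (f : 'rV[R]_n -> R) : test_function f -> measurable_fun setT f.
Proof. by move=> /test_function_continuous; exact: continuous_measurable_rv. Qed.

Lemma rintg_indic_cube r : rintg (leb R n) (\1_(cube n r)).
Proof.
apply/rintgP; split; first by apply: measurable_indic; exact: measurable_box.
rewrite (_ : (\int[_]_x _)%E = leb R n (cube n r)); first exact: leb_cube_lty.
rewrite -[RHS](_ : (\int[leb R n]_x (\1_(cube n r) x)%:E)%E = _).
  by apply: eq_integral => x _; rewrite ger0_norm// indicE.
by rewrite integral_indic ?setIT//; exact: measurable_box.
Qed.

Lemma test_function_rintg (f : 'rV[R]_n -> R) : test_function f -> rintg (leb R n) f.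
Proof.
move=> tf; have [M [r [M0 r0 fM]]] := test_function_bounded tf.
apply: (@le_rintg _ _ _ _ _ (fun x => M * \1_(cube n r) x)).
- exact: test_function_measurable.
- by move=> x; apply: le_trans (fM x) _; exact: ler_norm.
- by apply: rintgZ; exact: rintg_indic_cube.
Qed.

Lemma test_function_L2 (f : 'rV[R]_n -> R) : test_function f -> f \in Lfun (leb R n) 2%:E.
Proof.
move=> tf; apply/L2P; split; first exact: test_function_measurable.
have /rintgP[_] := test_function_rintg (test_functionM tf tf).
rewrite /sqint; apply: le_lt_trans.
rewrite le_eqVlt; apply/orP; left; apply/eqP; apply: eq_integral => x _.
by rewrite ger0_norm -expr2// sqr_ge0.
Qed.

End smooth_boxes.

(** * Weak gradients *)

Section fundamental_lemma.
Context {R : realType} {n : nat} {disp : measure_display}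
  {Omega : measurableType disp}.
Variables (P : probability Omega R).
Let mu := (leb R n \x P)%E.

Lemma measurable_fst_fun (f : 'rV[R]_n -> R) : measurable_fun setT f ->
  measurable_fun setT (fun z : 'rV[R]_n * Omega => f z.1).
Proof. by move=> mf; exact: measurableT_comp. Qed.

Lemma measurable_snd_fun (f : Omega -> R) : measurable_fun setT f ->
  measurable_fun setT (fun z : 'rV[R]_n * Omega => f z.2).
Proof. by move=> mf; exact: measurableT_comp. Qed.

Lemma sqint_prod (f : 'rV[R]_n -> R) (g : Omega -> R) :
  measurable_fun setT f -> measurable_fun setT g ->
  sqint mu (fun z => f z.1 * g z.2) = (sqint (leb R n) f * sqint P g)%E.
Proof.
move=> mf mg; rewrite sqint_fubini1; last first.
  by apply: measurable_funM; [exact: measurable_fst_fun|exact: measurable_snd_fun].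
transitivity (\int[leb R n]_x (((f x) ^+ 2)%:E * sqint P g))%E.
  by apply: eq_integral => x _; exact: (sqintZ P (f x) mg).
rewrite ge0_integralZr//; last exact: sqint_ge0.
  exact: measurable_sq.
by move=> x _; rewrite lee_fin sqr_ge0.
Qed.

Lemma L2_prod (f : 'rV[R]_n -> R) (g : Omega -> R) :
  f \in Lfun (leb R n) 2%:E -> g \in Lfun P 2%:E ->
  (fun z => f z.1 * g z.2) \in Lfun mu 2%:E.
Proof.
move=> /L2P[mf fo] /L2P[mg go]; apply/L2P; split.
  by apply: measurable_funM; [exact: measurable_fst_fun|exact: measurable_snd_fun].
rewrite sqint_prod// lte_mul_pinfty ?sqint_ge0// ge0_fin_numE ?sqint_ge0//.
Qed.

(** Test functions give indicators of boxes by dominated convergence along [boxf]; the pi-lambda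
    argument, applied in x and then on the product, gives all measurable sets. *)
Lemma fundamental_lemma_rintg (V : 'rV[R]_n * Omega -> R) : rintg mu V ->
  (forall f F, test_function f -> measurable F ->
    \int[mu]_z (V z * (f z.1 * \1_F z.2)) = 0) ->
  {ae mu, forall z, V z = 0}.
Proof.
move=> rV V0.
have m1F (F : set Omega) : measurable F -> measurable_fun setT (fun z : 'rV[R]_n * Omega => \1_F z.2 : R).
  by move=> mF; apply: measurable_snd_fun; exact: measurable_indic.
have VF F : measurable F -> rintg mu (fun z => V z * \1_F z.2).
  by move=> mF; apply: (@rintg_bounded _ _ _ _ 1) => //; [exact: m1F|move=> z; exact: normr_indic_le1].
have boxF F a b : measurable F -> \int[mu]_z ((V z * \1_F z.2) * \1_(box a b) z.1) = 0.
  move=> mF.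
  have [] := @Rint_dominated _ _ _ mu (fun k z => V z * \1_F z.2 * boxf k.+1%:R a b z.1)
      (fun z => V z * \1_F z.2 * \1_(box a b) z.1) (fun z => `|V z|).
  - move=> k; apply: measurable_funM; first exact: rintg_measurable (VF _ mF).
    by apply: measurable_fst_fun; apply: test_function_measurable; exact: boxf_test.
  - apply: measurable_funM; first exact: rintg_measurable (VF _ mF).
    by apply: measurable_fst_fun; apply: measurable_indic; exact: measurable_box.
  - by apply: aeW => z; apply: cvgM; [exact: cvg_cst|exact: boxf_cvg].
  - exact: rintg_norm.
  - move=> k z; rewrite !normrM -mulrA ler_piMr// mulr_ile1// ?normr_indic_le1//.
    by rewrite ger0_norm ?boxf_ge0// boxf_le1.
  - move=> _ /cvg_lim <- //; apply/cvg_lim => //; apply: cvg_near_cst; apply: nearW => k.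
    rewrite -[RHS](V0 (boxf k.+1%:R a b) F) //; last exact: boxf_test.
    by apply: eq_Rintegral => z _; ring.
have allF F : measurable F -> \int[mu]_z (V z * \1_F z.2) = 0.
  move=> mF.
  have [] := @Rint_dominated _ _ _ mu (fun k z => V z * \1_F z.2 * \1_(cube n k%:R) z.1)
      (fun z => V z * \1_F z.2) (fun z => `|V z|).
  - move=> k; apply: measurable_funM; first exact: rintg_measurable (VF _ mF).
    by apply: measurable_fst_fun; apply: measurable_indic; exact: measurable_box.
  - exact: rintg_measurable (VF _ mF).
  - apply: aeW => z; rewrite -[X in _ --> X]mulr1; apply: cvgM; first exact: cvg_cst.
    apply: cvg_near_cst; near=> k; rewrite indicE mem_set//.
    have k0 : 0 < k%:R :> R by rewrite ltr0n; near: k; exact: nbhs_infty_gt.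
    apply/cube_norm => //.
    apply: lt_le_trans (truncnS_gt _) _; rewrite ler_nat; near: k.
    exact: nbhs_infty_ge.
  - exact: rintg_norm.
  - by move=> k z; rewrite !normrM -mulrA ler_piMr// mulr_ile1// ?normr_indic_le1.
  - move=> _ /cvg_lim <- //; apply/cvg_lim => //; apply: cvg_near_cst; apply: nearW => k.
    exact: boxF.
have rectF F A : measurable F -> measurable A -> \int[mu]_z ((V z * \1_F z.2) * \1_A z.1) = 0.
  move=> mF; apply: (Rint_gen_eq0 (VF _ mF) measurable_fst (@setI_closed_boxes R n) (@measurable_boxes R n)).
    exact: allF.
  by move=> _ [a [b ->]]; exact: boxF.
apply: Rint_indic_eq0 => //.
apply: (Rint_gen_eq0 (p := id) rV (@measurable_id _ _ _) _ (@measurable_prod_measurableType _ _ _ _)).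
- move=> _ _ [A mA [B mB <-]] [A' mA' [B' mB' <-]].
  exists (A `&` A'); first exact: measurableI.
  exists (B `&` B'); first exact: measurableI.
  by apply/seteqP; split => [z /= [[? ?] [? ?]]|z /= [[? ?] [? ?]]].
- by rewrite -[RHS](allF setT)//; apply: eq_Rintegral => z _; rewrite indicT mulr1.
- move=> _ [A mA [F mF <-]]; rewrite -[RHS](rectF F A)//; apply: eq_Rintegral => z _.
  by rewrite !indicE in_setX -mulnb natrM; ring.
Unshelve. all: by end_near. Qed.

(** The underlying measure is infinite, so U is made integrable by cutoffs; these are positive on
    cubes exhausting R^d, so U itself must vanish. *)
Lemma fundamental_lemma (U : 'rV[R]_n * Omega -> R) : U \in Lfun mu 2%:E ->
  (forall f F, test_function f -> measurable F ->
    \int[mu]_z (U z * (f z.1 * \1_F z.2)) = 0) ->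
  {ae mu, forall z, U z = 0}.
Proof.
move=> UL U0.
pose chi (k : nat) := @boxf R n 1 (fun=> - k%:R) (fun=> k%:R).
have tchi k : test_function (chi k) by apply: boxf_test.
have L1 : (fun=> 1 : R) \in Lfun P 2%:E by exact: Lfun_cst.
have rk k : rintg mu (fun z => U z * chi k z.1).
  apply: L2_mul_integrable => //.
  have := L2_prod (test_function_L2 (tchi k)) L1.
  by under eq_fun do rewrite mulr1.
have : forall k, {ae mu, forall z, U z * chi k z.1 = 0}.
  move=> k; apply: fundamental_lemma_rintg => // f F tf mF.
  rewrite -[RHS](U0 (fun x => chi k x * f x) F)//; last exact: test_functionM.
  by apply: eq_Rintegral => z _; ring.
move/ae_foralln; apply: filterS => z Uz.
have [k _ zk] : (\bigcup_(k : nat) cube n k%:R) z.1 by rewrite bigcup_cube.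
have /eqP := Uz k; rewrite mulf_eq0 => /orP[/eqP//|].
by rewrite gt_eqF// boxf_gt0.
Qed.

Lemma L2_fst (g : 'rV[R]_n -> R) : g \in Lfun (leb R n) 2%:E ->
  (fun z => g z.1) \in Lfun mu 2%:E.
Proof.
move=> gL; have L1 : (fun=> 1 : R) \in Lfun P 2%:E by exact: Lfun_cst.
by have := L2_prod gL L1; under eq_fun do rewrite mulr1.
Qed.

Lemma ae_fst (Q : 'rV[R]_n -> Prop) : {ae leb R n, forall x, Q x} ->
  {ae mu, forall z, Q z.1}.
Proof.
move=> [N [mN N0 QN]]; exists (N `*` setT); split.
- exact: measurableX.
- by apply: etrans (product_measure1E _ _ mN measurableT) _; rewrite [X in (X * _)%E]N0 mul0e.
- by move=> z /= nQ; split => //; exact: QN.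
Qed.

(** Serves to draw conclusions about x from the points with w outside O, where microscopic
    components vanish. *)
Lemma ae_fst_inv (Q : 'rV[R]_n -> Prop) (A : set Omega) : measurable A -> (0 < P A)%E ->
  {ae mu, forall z, A z.2 -> Q z.1} -> {ae leb R n, forall x, Q x}.
Proof.
move=> mA PA /ae_prodl; apply: filterS => x [N [mN N0 QN]].
apply: contrapT => nQ; move: PA; rewrite ltNge => /negP; apply.
rewrite -N0; apply: le_measure; rewrite ?inE// => w Aw; apply: QN => /= h.
exact/nQ/h.
Qed.

Lemma ae_snd (Q : Omega -> Prop) : {ae P, forall w, Q w} ->
  {ae mu, forall z, Q z.2}.
Proof.
move=> [N [mN N0 QN]]; exists (setT `*` N); split.
- exact: measurableX.
- by apply: etrans (product_measure1E _ _ measurableT mN) _; rewrite [X in (_ * X)%E]N0 mule0.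
- by move=> z /= nQ; split => //; exact: QN.
Qed.

Lemma Rint_fst (g : 'rV[R]_n -> R) (F : set Omega) : measurable F -> rintg (leb R n) g ->
  \int[mu]_z (g z.1 * \1_F z.2) = \int[leb R n]_x g x * fine (P F).
Proof.
move=> mF rg; have mg := rintg_measurable rg.
have r1 : rintg P (\1_F : Omega -> R).
  apply: (@le_rintg _ _ _ _ _ (fun=> 1)); first exact: measurable_indic.
    by move=> w; rewrite normr1 normr_indic_le1.
  exact: finite_measure_integrable_cst.
rewrite Rint_fubini1; last first.
  apply: (@rintg_bounded _ _ _ _ 1 (fun z => g z.1)).
  - by apply: measurable_snd_fun; exact: measurable_indic.
  - by move=> z; exact: normr_indic_le1.
  apply/rintgP; split; first exact: measurable_fst_fun.
  have /rintgP[_] := rg; apply: le_lt_trans.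
  rewrite (fubini_tonelli1 (fun z => `|g z.1|%:E))//; last first.
    by apply/measurable_EFinP; apply: measurableT_comp => //; exact: measurable_fst_fun.
  apply: ge0_le_integral => //.
  - by move=> x _; exact: integral_ge0.
  - apply: (measurable_fun_fubini_tonelli_F (fun z => `|g z.1|%:E)) => //.
    by apply/measurable_EFinP; apply: measurableT_comp => //; exact: measurable_fst_fun.
  - by apply/measurable_EFinP; exact: measurableT_comp.
  - move=> x _; rewrite (_ : fubini_F P _ x = `|g x|%:E * P setT)%E.
      by rewrite probability_setT mule1.
    by rewrite -(integral_cst P measurableT).
rewrite mulrC -RintZ//; apply: eq_Rintegral => x _ /=.
rewrite mulrC RintZ//; congr (_ * _).
by rewrite /Rintegral integral_indic ?setIT.
Qed.

(** The product version, with an arbitrary probability space as a dummy second factor. *)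
Lemma fundamental_lemma_leb (g : 'rV[R]_n -> R) : g \in Lfun (leb R n) 2%:E ->
  (forall f, test_function f -> \int[leb R n]_x (g x * f x) = 0) ->
  {ae leb R n, forall x, g x = 0}.
Proof.
move=> gL g0; apply: (@ae_fst_inv _ setT) => //; first by rewrite probability_setT.
suff : {ae mu, forall z, g z.1 = 0} by apply: filterS.
apply: fundamental_lemma; first exact: L2_fst.
move=> f F tf mF.
transitivity (\int[mu]_z ((g z.1 * f z.1) * \1_F z.2)).
  by apply: eq_Rintegral => z _; rewrite mulrA.
rewrite (Rint_fst (g := fun x => g x * f x))// ?g0 ?mul0r//.
exact: L2_mul_integrable gL (test_function_L2 tf).
Qed.

End fundamental_lemma.

(** * Changes of variables and integration by parts *)

Section integration_by_parts.
Context {R : realType} {n : nat}.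
Implicit Types (f g u : 'rV[R]_n -> R) (i j : 'I_n).
Let L := leb R n.

Lemma measurable_affine_comp (c : R) v f : measurable_fun setT f ->
  measurable_fun setT (fun x : 'rV[R]_n => f (c *: x + v)).
Proof. by move=> mf; exact: (measurableT_comp mf (measurable_rv_affine c v)). Qed.

Lemma rintg_affine (c : R) v f : 0 < c -> rintg L f -> rintg L (fun x => f (c *: x + v)).
Proof.
move=> c0 /rintgP[mf fo]; apply/rintgP; split; first exact: measurable_affine_comp.
rewrite (ge0_integral_leb_affine (f := fun x => `|f x|%:E) v c0)//.
  by rewrite lte_mul_pinfty// lee_fin invr_ge0 exprn_ge0// ltW.
by apply/measurable_EFinP; exact: measurableT_comp.
Qed.

Lemma Rint_affine (c : R) v f : 0 < c -> rintg L f ->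
  \int[L]_x f (c *: x + v) = c ^- n * \int[L]_x f x.
Proof.
move=> c0 rf.
have pos g : rintg L g -> (forall x, 0 <= g x) ->
    \int[L]_x g (c *: x + v) = c ^- n * \int[L]_x g x.
  move=> rg g0; rewrite {1}/Rintegral.
  rewrite (ge0_integral_leb_affine (f := fun x => (g x)%:E) v c0)//; last first.
    by apply/measurable_EFinP; exact: rintg_measurable rg.
  by rewrite -RintE// -EFinM.
have rn := rintg_norm rf.
have rs := rintgD rn rf.
have s0 x : 0 <= `|f x| + f x by have := ler_norm (- f x); rewrite normrN; lra.
transitivity (\int[L]_x ((`|f (c *: x + v)| + f (c *: x + v)) - `|f (c *: x + v)|)).
  by apply: eq_Rintegral => x _; ring.
have ra := rintg_affine v c0 rs; have rb := rintg_affine v c0 rn.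
rewrite RintB// (pos _ rs s0) (pos _ rn (fun x => normr_ge0 _)) RintD//.
by ring.
Qed.

Lemma sqint_affine (c : R) v f : 0 < c -> measurable_fun setT f ->
  sqint L (fun x => f (c *: x + v)) = ((c ^- n)%:E * sqint L f)%E.
Proof.
move=> c0 mf; rewrite /sqint.
rewrite (ge0_integral_leb_affine (f := fun x => ((f x) ^+ 2)%:E) v c0)//.
  exact: measurable_sq.
by move=> x; rewrite lee_fin sqr_ge0.
Qed.

Lemma L2_affine (c : R) v f : 0 < c -> f \in Lfun L 2%:E ->
  (fun x => f (c *: x + v)) \in Lfun L 2%:E.
Proof.
move=> c0 /L2P[mf fo]; apply/L2P; split; first exact: measurable_affine_comp.
by rewrite sqint_affine// lte_mul_pinfty// lee_fin invr_ge0 exprn_ge0// ltW.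
Qed.

Lemma is_derive_line f x (v : 'rV[R]_n) (t : R) : (forall x, differentiable f x) ->
  is_derive t (1 : R) (fun h : R => f (h *: v + x)) ('D_v f (t *: v + x)).
Proof.
move=> df.
have da : is_diff t (fun h : R => h *: v + x) (fun h : R => h *: v).
  have h := @is_diffD _ _ _ (fun h : R => h *: v) (cst x) _ _ t (is_diff_scalel _ _) (is_diff_cst x t).
  by apply: is_diff_eq h _; apply/funext => y /=; rewrite addr0.
have dfa : differentiable (f \o (fun h : R => h *: v + x)) t.
  by apply: differentiable_comp => //; case: da.
split; first exact: diff_derivable.
rewrite deriveE// diff_comp//.
rewrite /= [X in 'd f _ X](_ : _ = v); last by rewrite diff_val scale1r.
by rewrite deriveE.
Qed.

Lemma mvt_line f x (v : 'rV[R]_n) (t : R) : (forall x, differentiable f x) -> 0 < t ->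
  exists2 c, 0 < c < t & f (t *: v + x) - f x = t * 'D_v f (c *: v + x).
Proof.
move=> df t0.
have [] := @MVT R (fun h => f (h *: v + x)) (fun h => 'D_v f (h *: v + x)) 0 t t0.
- by move=> s _; exact: is_derive_line.
- apply: derivable_within_continuous => s _.
  by have [] := is_derive_line x v s df.
move=> c; rewrite in_itv/= => ct; rewrite scale0r add0r subr0 => E.
by exists c => //; rewrite E mulrC.
Qed.

(** Fermat's rule on a line. Applied to functions with values in [0, 1], it shows that their
    gradient vanishes wherever they equal 0 or 1, boundary points included. *)
Lemma pd_line_min f i x : (forall x, differentiable f x) ->
  (forall t : R, f x <= f (t *: basisv i + x)) -> pd i f x = 0.
Proof.
move=> df fx; have d t := is_derive_line x (basisv i) t df.
have N1 : (-1 : R) <= 1 by lra.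
have t0 : (0 : R) \in `]-1, 1[ by rewrite in_itv/=; apply/andP; split; lra.
have [_] := d 0; rewrite scale0r add0r -/(pd i f x) => <-.
have := @derive1_at_min R _ (-1) 1 0 N1 (fun s _ => @ex_derive _ _ _ _ _ _ _ (d s)) t0.
by case=> // s _; rewrite scale0r add0r.
Qed.

Lemma pd_line_max f i x : (forall x, differentiable f x) ->
  (forall t : R, f (t *: basisv i + x) <= f x) -> pd i f x = 0.
Proof.
move=> df fx; have d t := is_derive_line x (basisv i) t df.
have N1 : (-1 : R) <= 1 by lra.
have t0 : (0 : R) \in `]-1, 1[ by rewrite in_itv/=; apply/andP; split; lra.
have [_] := d 0; rewrite scale0r add0r -/(pd i f x) => <-.
have := @derive1_at_max R _ (-1) 1 0 N1 (fun s _ => @ex_derive _ _ _ _ _ _ _ (d s)) t0.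
by case=> // s _; rewrite scale0r add0r.
Qed.

Lemma cvg_dnbhs_seq (W : topologicalType) (F : R -> W) (l : W) :
  F h @[h --> 0^'] --> l -> F k.+1%:R^-1 @[k --> \oo] --> l.
Proof.
move=> Fl; apply: cvg_comp Fl => A [e /= e0 Ae].
near=> k; apply: Ae => /=; last by rewrite gt_eqF.
rewrite sub0r normrN gtr0_norm//; near: k; exact: (near_infty_natSinv_lt (PosNum e0)).
Unshelve. all: by end_near. Qed.

Lemma normr_basisv_coord i l : `|(basisv i : 'rV[R]_n) 0 l| <= 1.
Proof. by rewrite mxE eqxx /=; case: (l == i); rewrite ?normr1 ?normr0. Qed.

Lemma cube_shift r (c : R) i (x : 'rV[R]_n) : `|c| <= 1 ->
  cube n r (c *: basisv i + x) -> cube n (r + 1) x.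
Proof.
move=> c1 h l; have := h l.
have : `|(c *: basisv i : 'rV[R]_n) 0 l| <= 1.
  by rewrite mxE normrM mulr_ile1// normr_basisv_coord.
have -> : (c *: basisv i + x) 0 l = (c *: basisv i : 'rV[R]_n) 0 l + x 0 l by rewrite mxE.
rewrite ler_norml => /andP[h1 h2] /andP[h3 h4]; apply/andP; split; lra.
Qed.

(** Difference quotients have integral zero by translation invariance. The mean value theorem
    dominates them by the bound on the derivative, on a cube enlarged by 1 since the increments are
    at most 1. *)
Lemma Rint_pd_eq0 f i : test_function f -> \int[L]_x pd i f x = 0.
Proof.
move=> tf; have tpf := test_function_pd i tf.
have [M [r [M0 r0 fM]]] := test_function_bounded tpf.
have df x : differentiable f x by case: tf => sf _; exact: (sf [::]).
pose q (k : nat) x := k.+1%:R * (f (k.+1%:R^-1 *: basisv i + x) - f x).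
have k0 (k : nat) : 0 < k.+1%:R^-1 :> R by rewrite invr_gt0 ltr0n.
have qE k x : exists2 c : R, `|c| <= 1 & q k x = pd i f (c *: basisv i + x).
  have [c /andP[c0 ck] E] := mvt_line x (basisv i) df (k0 k).
  exists c; first by rewrite gtr0_norm// ltW// (lt_le_trans ck)// invf_le1 ?ler1n// ltr0n.
  by rewrite /q E mulrA divff ?mul1r// pnatr_eq0.
have mf := test_function_measurable tf.
have mq k : measurable_fun setT (q k).
  apply: measurable_funM => //; apply: measurable_funB => //.
  under eq_fun do rewrite addrC -[X in X + _]scale1r.
  exact: measurable_affine_comp.
have [] := @Rint_dominated _ _ _ L q (pd i f) (fun x => M * \1_(cube n (r + 1)) x).
- exact: mq.
- exact: test_function_measurable.
- apply: aeW => x.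
  have : derivable f x (basisv i) by exact: diff_derivable.
  move=> /cvg_dnbhs_seq; rewrite -/(pd i f x).
  apply: cvg_trans; apply: near_eq_cvg; apply: nearW => k /=.
  by rewrite invrK.
- by apply: rintgZ; exact: rintg_indic_cube.
- move=> k x; have [c c1 ->] := qE k x; apply: le_trans (fM _) _.
  rewrite ler_wpM2l// !indicE.
  have [h|h] := pselect (cube n r (c *: basisv i + x)).
    by rewrite !mem_set//; exact: cube_shift h.
  by rewrite memNset.
- move=> _ /cvg_lim <- //; apply/cvg_lim => //; apply: cvg_near_cst; apply: nearW => k.
  have rf := test_function_rintg tf.
  have E x : f (k.+1%:R^-1 *: basisv i + x) = f (1 *: x + k.+1%:R^-1 *: basisv i).
    by rewrite scale1r addrC.
  have rfa := rintg_affine (k.+1%:R^-1 *: basisv i) ltr01 rf.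
  rewrite /q RintZ; last first.
    by under eq_fun do rewrite E; exact: rintgB.
  under eq_Rintegral do rewrite E.
  by rewrite RintB// Rint_affine// expr1n invr1 mul1r subrr mulr0.
Qed.

Lemma test_function_weak_grad f : test_function f ->
  weak_grad f (fun x => \row_i pd i f x).
Proof.
move=> tf g tg j.
have df x : differentiable f x by case: tf => sf _; exact: (sf [::]).
have dg x : differentiable g x by case: tg => sf _; exact: (sf [::]).
have r1 : rintg L (fun x => f x * pd j g x).
  by apply: test_function_rintg; apply: test_functionM => //; exact: test_function_pd.
have r2 : rintg L (fun x => g x * pd j f x).
  by apply: test_function_rintg; apply: test_functionM => //; exact: test_function_pd.
have := Rint_pd_eq0 j (test_functionM tf tg).
rewrite pdM// RintD// => /eqP; rewrite addr_eq0 => /eqP h.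
rewrite -/L /= [LHS]h; congr (- _); apply: eq_Rintegral => x _.
by rewrite mxE mulrC.
Qed.

Lemma test_function_W12 f : test_function f -> W12 f (fun x => \row_i pd i f x).
Proof.
move=> tf; split; [exact: test_function_L2| |exact: test_function_weak_grad].
move=> j; under eq_fun do rewrite mxE.
exact/test_function_L2/test_function_pd.
Qed.

Lemma test_function_affine f (c : R) v : 0 < c -> test_function f ->
  test_function (fun x => f (c *: x + v)).
Proof.
move=> c0 tf; have [r r0 fr] := test_function_cube tf.
apply: (@cube_test_function _ _ _ (c^-1 * (r + `|v|))).
- by rewrite mulr_gt0 ?invr_gt0// ltr_wpDr.
- by apply: kdiff_smooth => k; apply: kdiff_affine; apply: smooth_kdiff; case: tf.
- move=> x nx; apply: fr => h; apply: nx; apply/cube_norm.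
    by rewrite mulr_gt0 ?invr_gt0// ltr_wpDr.
  move/cube_norm : h => /(_ r0) h.
  rewrite -ltr_pdivrMl ?invrK ?invr_gt0// -[X in X * _](gtr0_norm c0) -normrZ.
  rewrite -[c *: x](addrK v); apply: le_lt_trans (ler_normB _ _) _.
  by rewrite ltrD2r.
Qed.

Lemma W12_dilation u (g : 'rV[R]_n -> 'rV[R]_n) (c : R) : 0 < c -> W12 u g ->
  W12 (fun x => u (c *: x)) (fun x => c *: g (c *: x)).
Proof.
move=> c0 [uL gL wg].
have E (h : 'rV[R]_n -> R) : (fun x => h (c *: x)) = (fun x => h (c *: x + 0)).
  by apply/funext => x; rewrite addr0.
split.
- by rewrite E; exact: L2_affine.
- move=> j; under eq_fun do rewrite mxE.
  by apply: L2Z; have := L2_affine 0 c0 (gL j); under eq_fun do rewrite addr0.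
- move=> f tf j.
  have ci0 : 0 < c^-1 by rewrite invr_gt0.
  have tfc := test_function_affine 0 ci0 tf.
  have df x : differentiable f x by case: tf => sf _; exact: (sf [::]).
  have h : c^-1 * \int[L]_x (u x * pd j f (c^-1 *: x + 0)) =
      - \int[L]_x (g x 0 j * f (c^-1 *: x + 0)).
    rewrite -(wg _ tfc j) -RintZ; last first.
      exact: L2_mul_integrable uL (L2_affine 0 ci0 (test_function_L2 (test_function_pd j tf))).
    have pE := pd_affine j c^-1 0 df.
    by apply: eq_Rintegral => x _; rewrite -/(pd j _ _) pE mulrCA.
  have scale (k : 'rV[R]_n -> R) (w : 'rV[R]_n -> R) : k \in Lfun L 2%:E -> w \in Lfun L 2%:E ->
      \int[L]_x (k (c *: x) * w x) = c ^- n * \int[L]_x (k x * w (c^-1 *: x + 0)).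
    move=> kL wL; rewrite -(Rint_affine 0 c0); last first.
      exact: L2_mul_integrable kL (L2_affine 0 ci0 wL).
    apply: eq_Rintegral => x _; rewrite !addr0 scalerA mulVf ?scale1r//.
    by rewrite gt_eqF.
  have fL := test_function_L2 tf.
  have pfL := test_function_L2 (test_function_pd j tf).
  rewrite [LHS](scale u (pd j f))//.
  transitivity (- (c * \int[L]_x (g (c *: x) 0 j * f x))); last first.
    congr (- _); rewrite -RintZ; last first.
      apply: L2_mul_integrable => //; have := L2_affine 0 c0 (gL j).
      by under eq_fun do rewrite addr0.
    by apply: eq_Rintegral => x _; rewrite mxE mulrA.
  rewrite (scale (fun x => g x 0 j) f)// mulrCA -mulrN -mulrN -h.
  by congr (_ * _); rewrite mulrA divff ?mul1r// gt_eqF.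
Qed.

End integration_by_parts.

(** * Square-integrable functions with a vanishing weak derivative *)

Section zero_weak_gradient.
Context {R : realType} {n : nat}.
Implicit Types (f g u : 'rV[R]_n -> R) (i j : 'I_n).
Let L := leb R n.

(** The mean value theorem used twice; it gives the constant 1 instead of 1/2, and only the order
    t^2 matters. *)
Lemma taylor_line f x (v : 'rV[R]_n) (t : R) : (forall k, kdiff k f) -> forall i, 0 < t ->
  exists2 c, 0 < c < t & `|f (t *: basisv i + x) - f x - t * pd i f x| <=
    t ^+ 2 * `|pd i (pd i f) (c *: basisv i + x)|.
Proof.
move=> kf i t0.
have df y : differentiable f y by have [] := kf 0.
have dpf y : differentiable (pd i f) y by have [_ /(_ i)[]] := kf 1.
have [c /andP[c0 ct] ->] := mvt_line x (basisv i) df t0.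
have [c' /andP[c0' ct'] E] := mvt_line x (basisv i) dpf c0.
exists c'; first by rewrite c0' (lt_trans ct').
have -> : t * 'D_(basisv i) f (c *: basisv i + x) - t * pd i f x =
    t * (pd i f (c *: basisv i + x) - pd i f x) by rewrite mulrBr.
rewrite E !normrM (gtr0_norm t0) (gtr0_norm c0) expr2 mulrA.
by rewrite ler_wpM2r// ler_wpM2l// ltW.
Qed.

Lemma small_quadratic (a C : R) : (forall m, `|a| * m.+1%:R <= C) -> a = 0.
Proof.
move=> h; apply/eqP; rewrite -normr_eq0 eq_le normr_ge0 andbT leNgt; apply/negP => a0.
have := h (Num.truncn (C / `|a|)).
rewrite leNgt => /negP; apply.
by rewrite mulrC -ltr_pdivrMr// truncnS_gt.
Qed.

(** Over a step h the pairing changes by O(h^2), because the first-order term is the weak derivative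
    tested with a translate of f. Covering the length k by k (m + 1) steps of length 1 / (m + 1)
    leaves a change of order 1 / (m + 1), for every m. *)
Lemma weak_grad0_shift u f j : u \in Lfun L 2%:E ->
  (forall f, test_function f -> \int[L]_x (u x * pd j f x) = 0) ->
  test_function f -> forall k : nat,
  \int[L]_x (u x * f (x + k%:R *: basisv j)) = \int[L]_x (u x * f x).
Proof.
move=> uL wu tf.
have [M [r [M0 r0 fM]]] := test_function_bounded (test_function_pd j (test_function_pd j tf)).
(* B bounds the integral of |u| over every translate of the cube, by |u| <= u^2 + 1. *)
pose B := \int[L]_x (u x ^+ 2) + \int[L]_x (\1_(cube n (r + 1)) x : R).
have tft t : test_function (fun x => f (x + t *: basisv j)).
  have := test_function_affine (t *: basisv j) ltr01 tf.
  by under eq_fun do rewrite scale1r.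
pose G t := \int[L]_x (u x * f (x + t *: basisv j)).
have df x : differentiable f x by case: tf => sf _; exact: (sf [::]).
have kf k : kdiff k f by apply: smooth_kdiff; case: tf.
have rG t : rintg L (fun x => u x * f (x + t *: basisv j)).
  exact: L2_mul_integrable uL (test_function_L2 (tft t)).
have step t h : 0 < h -> h <= 1 -> `|G (t + h) - G t| <= h ^+ 2 * (M * B).
  move=> h0 h1.
  have pE : pd j (fun x => f (x + t *: basisv j)) = fun x => pd j f (x + t *: basisv j).
    have := pd_affine j 1 (t *: basisv j) df.
    under eq_fun do rewrite scale1r.
    by move=> ->; apply/funext => x; rewrite scale1r mul1r.
  have rp : rintg L (fun x => u x * pd j f (x + t *: basisv j)).
    by have := L2_mul_integrable uL (test_function_L2 (test_function_pd j (tft t))); rewrite pE.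
  have : \int[L]_x (u x * pd j (fun x => f (x + t *: basisv j)) x) = 0 by exact: wu.
  rewrite pE => E.
  have -> : G (t + h) - G t = \int[L]_x (u x * f (x + (t + h) *: basisv j) -
     u x * f (x + t *: basisv j) - h * (u x * pd j f (x + t *: basisv j))).
    rewrite RintB; [|exact: rintgB|exact: rintgZ].
    by rewrite RintB// RintZ// E mulr0 subr0.
  have rc : rintg L (fun x => \1_(cube n (r + 1)) (1 *: x + t *: basisv j)).
    exact: (rintg_affine (t *: basisv j) ltr01 (rintg_indic_cube (r + 1))).
  have -> : h ^+ 2 * (M * B) = \int[L]_x (h ^+ 2 * (M * (u x ^+ 2 +
      \1_(cube n (r + 1)) (1 *: x + t *: basisv j)))).
    have ru := L2_sqr_integrable uL.
    rewrite RintZ; last by apply: rintgZ; exact: rintgD.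
    rewrite RintZ; last exact: rintgD.
    rewrite RintD// (Rint_affine (f := \1_(cube n (r + 1))) _ ltr01)//; last exact: rintg_indic_cube.
    by rewrite expr1n invr1 mul1r.
  have rD : rintg L (fun x => u x * f (x + (t + h) *: basisv j) -
     u x * f (x + t *: basisv j) - h * (u x * pd j f (x + t *: basisv j))).
    by apply: rintgB; [exact: rintgB|exact: rintgZ].
  apply: le_trans (le_norm_Rint rD) _; apply: le_Rint; first exact: rintg_norm.
    by do 2 apply: rintgZ; apply: rintgD => //; exact: L2_sqr_integrable.
  move=> x; rewrite scale1r.
  have [c /andP[c0 ch]] := taylor_line (x + t *: basisv j) (basisv j) kf j h0.
  rewrite (_ : h *: basisv j + (x + t *: basisv j) = x + (t + h) *: basisv j); last first.
    by rewrite scalerDl addrCA [h *: _ + _]addrC.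
  set D := f _ - f _ - _ => D1.
  have -> : u x * f (x + (t + h) *: basisv j) - u x * f (x + t *: basisv j) -
    h * (u x * pd j f (x + t *: basisv j)) = u x * D by rewrite /D; ring.
  have D2 : `|D| <= h ^+ 2 * (M * \1_(cube n (r + 1)) (x + t *: basisv j)).
    apply: le_trans D1 _; rewrite ler_wpM2l ?sqr_ge0//; apply: le_trans (fM _) _.
    rewrite ler_wpM2l// !indicE.
    have [hc|hc] := pselect (cube n r (c *: basisv j + (x + t *: basisv j))); last by rewrite memNset.
    rewrite !mem_set//; apply: cube_shift hc.
    by rewrite gtr0_norm// (le_trans (ltW ch)).
  set I := \1_(_) _ in D2 *.
  have I01 : I = 0 \/ I = 1 by rewrite /I indicE; case: (_ \in _); [right|left].
  rewrite normrM; apply: (@le_trans _ _ (`|u x| * (h ^+ 2 * (M * I)))); first by rewrite ler_wpM2l.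
  rewrite (_ : `|u x| * (h ^+ 2 * (M * I)) = h ^+ 2 * (M * (`|u x| * I))); last by ring.
  rewrite ler_wpM2l ?sqr_ge0// ler_wpM2l//.
  rewrite -[u x ^+ 2]real_normK ?num_real//.
  have := normr_ge0 (u x); have := sqr_ge0 (`|u x| - 1).
  by case: I01 => ->; nra.
have MB0 : 0 <= M * B.
  rewrite mulr_ge0// addr_ge0//; apply: Rintegral_ge0 => x _; first exact: sqr_ge0.
  by rewrite indicE ler0n.
have cst k : G k%:R = G 0.
  apply/eqP; rewrite -subr_eq0; apply/eqP; apply: (@small_quadratic _ (k%:R * (M * B))) => m.
  have h0 : 0 < m.+1%:R^-1 :> R by rewrite invr_gt0 ltr0n.
  have h1 : m.+1%:R^-1 <= 1 :> R by rewrite invf_le1 ?ler1n ?ltr0n.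
  have tele (q : nat) : `|G (q%:R * m.+1%:R^-1) - G 0| <= q%:R * (m.+1%:R^-1 ^+ 2 * (M * B)).
    elim: q => [|q IH]; first by rewrite !mul0r subrr normr0.
    have := step (q%:R * m.+1%:R^-1) _ h0 h1.
    rewrite -{2}[m.+1%:R^-1]mul1r -mulrDl natr1 => s.
    rewrite -(subrKA (G (q%:R / m.+1%:R))); apply: le_trans (ler_normD _ _) _.
    by apply: le_trans (lerD s IH) _; rewrite -[in leRHS]natr1 mulrDl mul1r addrC.
  have := tele (k * m.+1)%N.
  have m0 : m.+1%:R != 0 :> R by rewrite pnatr_eq0.
  rewrite natrM mulfK// => s.
  rewrite -ler_pdivlMr ?ltr0n//; apply: le_trans s _.
  rewrite le_eqVlt; apply/orP; left; apply/eqP; by field.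
move=> k; rewrite [LHS](cst k).
by apply: eq_Rintegral => x _; rewrite scale0r addr0.
Qed.

(** Translating f by multiples of e_j leaves its pairing with u unchanged, while Cauchy-Schwarz
    bounds the pairing by the mass of u^2 on a cube that moves to infinity. *)
Lemma weak_grad0_eq0 u j : u \in Lfun L 2%:E ->
  (forall f, test_function f -> \int[L]_x (u x * pd j f x) = 0) ->
  {ae L, forall x, u x = 0}.
Proof.
move=> uL wu; apply: (@fundamental_lemma_leb R n _ _ (dirac (0 : 'rV[R]_n))) => // f tf.
have [r r0 fr] := test_function_cube tf.
pose chi (k : nat) x : R := \1_(cube n r) (x + k%:R *: basisv j).
have tft t : test_function (fun x => f (x + t *: basisv j)).
  have := test_function_affine (t *: basisv j) ltr01 tf.
  by under eq_fun do rewrite scale1r.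
have mchi k : measurable_fun setT (chi k).
  rewrite /chi; under eq_fun do rewrite -[X in X + _]scale1r.
  by apply: measurable_affine_comp; apply: measurable_indic; exact: measurable_box.
have chi1 k x : `|chi k x| <= 1 by exact: normr_indic_le1.
have uchi k : (fun x => u x * chi k x) \in Lfun L 2%:E.
  apply: (le_L2 _ uL); first by apply: measurable_funM => //; exact: L2_measurable uL.
  by move=> x; rewrite normrM ler_piMr.
have f2 (k : nat) : \int[L]_x (f (x + k%:R *: basisv j) ^+ 2) = \int[L]_x (f x ^+ 2).
  have := Rint_affine (f := fun x => f x ^+ 2) (k%:R *: basisv j) ltr01 (L2_sqr_integrable (test_function_L2 tf)).
  by rewrite expr1n invr1 mul1r; under eq_Rintegral do rewrite scale1r.
have key k : (\int[L]_x (u x * f x)) ^+ 2 <=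
    \int[L]_x (u x ^+ 2 * chi k x) * \int[L]_x (f x ^+ 2).
  have := L2_cauchy_schwarz (uchi k) (test_function_L2 (tft k%:R)).
  rewrite f2 (_ : \int[L]_x (u x * chi k x * _) = \int[L]_x (u x * f x)); last first.
    rewrite -(weak_grad0_shift uL wu tf k); apply: eq_Rintegral => x _.
    rewrite /chi -mulrA; congr (_ * _); rewrite indicE.
    have [h|h] := pselect (cube n r (x + k%:R *: basisv j)).
      by rewrite mem_set// mul1r.
    by rewrite memNset// mul0r fr.
  rewrite (_ : \int[L]_x ((u x * chi k x) ^+ 2) = \int[L]_x (u x ^+ 2 * chi k x))//.
  apply: eq_Rintegral => x _; rewrite exprMn; congr (_ * _).
  by rewrite /chi indicE; case: (_ \in _); rewrite ?expr1n ?expr0n.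
have [] := @Rint_dominated _ _ _ L (fun k x => u x ^+ 2 * chi k x) (fun=> 0) (fun x => u x ^+ 2).
- move=> k; apply: measurable_funM => //; apply: rintg_measurable; exact: L2_sqr_integrable uL.
- exact: measurable_cst.
- apply: aeW => x; apply: cvg_near_cst; near=> k; rewrite /chi indicE memNset ?mulr0//.
  move=> /(_ j); rewrite !mxE !eqxx /= mulr1 => /andP[_].
  apply/negP; rewrite -leNgt.
  have : r - x 0 j <= k%:R.
    apply: le_trans (ltW (truncnS_gt _)) _; rewrite ler_nat; near: k; exact: nbhs_infty_ge.
  by lra.
- exact: L2_sqr_integrable.
- by move=> k x; rewrite normrM [X in X * _]ger0_norm ?sqr_ge0// ler_piMr// sqr_ge0.
- move=> _; rewrite Rint0 => h0.
  have h1 : \int[L]_x (u x ^+ 2 * chi k x) * \int[L]_x (f x ^+ 2) @[k --> \oo] --> (0 : R).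
    by rewrite -[X in _ --> X](mul0r (\int[L]_x (f x ^+ 2))); apply: cvgM h0 (cvg_cst _).
  apply/eqP; rewrite -sqrf_eq0 eq_le sqr_ge0 andbT.
  rewrite -(cvg_lim _ h1)//; apply: limr_ge; first by apply/cvg_ex; eexists; exact: h1.
  by apply: nearW => k; exact: key.
Unshelve. all: by end_near. Qed.

End zero_weak_gradient.

Section bilinear.
Context {R : realType} {n : nat}.
Implicit Types (x y z : 'rV[R]_n) (A : 'M[R]_n).

Lemma dotvE x y : dotv x y = \sum_k x 0 k * y 0 k.
Proof. by rewrite /dotv !mxE; apply: eq_bigr => k _; rewrite mxE. Qed.

Lemma mxformE A x y : mxform A x y = \sum_k \sum_l A k l * (x 0 l * y 0 k).
Proof.
rewrite /mxform dotvE; apply: eq_bigr => k _; rewrite mxE mulr_suml.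
by apply: eq_bigr => l _; rewrite mxE; ring.
Qed.

Lemma mxform_sym A x y : A^T = A -> mxform A x y = mxform A y x.
Proof.
move=> sA; rewrite !mxformE exchange_big /=; apply: eq_bigr => k _.
by apply: eq_bigr => l _; rewrite -{1}sA mxE; ring.
Qed.

Lemma mxformZ A a b x y : mxform A (a *: x) (b *: y) = a * b * mxform A x y.
Proof.
rewrite !mxformE mulr_sumr; apply: eq_bigr => k _; rewrite mulr_sumr.
by apply: eq_bigr => l _; rewrite !mxE; ring.
Qed.

Lemma mxform_rintg d (X : measurableType d) (mu : {measure set X -> \bar R}) A
    (g h : X -> 'rV[R]_n) :
  (forall j : 'I_n, (fun x : X => g x 0 j) \in Lfun mu 2%:E) ->
  (forall j : 'I_n, (fun x : X => h x 0 j) \in Lfun mu 2%:E) ->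
  rintg mu (fun x : X => mxform A (g x) (h x)).
Proof.
move=> gL hL; under eq_fun do rewrite mxformE.
by do 2 apply: rintg_sum => ?; apply: rintgZ; exact: L2_mul_integrable.
Qed.

Lemma dotv_mxform x y : dotv x y = mxform 1%:M x y.
Proof. by rewrite /mxform trmx1 mulmx1. Qed.

Lemma dotv_rintg d (X : measurableType d) (mu : {measure set X -> \bar R})
    (g h : X -> 'rV[R]_n) :
  (forall j : 'I_n, (fun x : X => g x 0 j) \in Lfun mu 2%:E) ->
  (forall j : 'I_n, (fun x : X => h x 0 j) \in Lfun mu 2%:E) ->
  rintg mu (fun x : X => dotv (g x) (h x)).
Proof. by move=> gL hL; under eq_fun do rewrite dotv_mxform; exact: mxform_rintg. Qed.

End bilinear.

(** * Dilations *)

Section dilation.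
Context {R : realType} {n : nat}.
Implicit Types (f u : 'rV[R]_n -> R) (g : 'rV[R]_n -> 'rV[R]_n).
Let L := leb R n.

Lemma dilation_add0 (f : 'rV[R]_n -> R) c : (fun x => f (c *: x)) = (fun x => f (c *: x + 0)).
Proof. by apply/funext => x; rewrite addr0. Qed.

Lemma L2_dilation (c : R) f : 0 < c -> f \in Lfun L 2%:E ->
  (fun x => f (c *: x)) \in Lfun L 2%:E.
Proof. by move=> c0 fL; rewrite dilation_add0; exact: L2_affine. Qed.

Lemma Rint_dilation (c : R) f : 0 < c -> rintg L f ->
  \int[L]_x f (c *: x) = c ^- n * \int[L]_x f x.
Proof.
move=> c0 rf; rewrite -(Rint_affine 0 c0 rf).
by apply: eq_Rintegral => x _; rewrite addr0.
Qed.

(** Bessel's inequality in finite form. If c <> 0, the pairing of phi with a sum S of N late terms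
    is of order N |c|, whereas the squared norm of S is at most N B by orthogonality; Cauchy-Schwarz
    then bounds N. *)
Lemma orthogonal_weak_limit d (X : measurableType d) (mu : {measure set X -> \bar R})
    (w : nat -> X -> R) (phi : X -> R) (B c : R) :
  (forall k, w k \in Lfun mu 2%:E) -> phi \in Lfun mu 2%:E ->
  (forall k l, k != l -> \int[mu]_x (w k x * w l x) = 0) ->
  (forall k, \int[mu]_x (w k x ^+ 2) <= B) ->
  \int[mu]_x (phi x * w k x) @[k --> \oo] --> c -> c = 0.
Proof.
move=> wL pL ort wB cvg_c; apply: contrapT => /eqP c0.
have c2 : 0 < c ^+ 2 by rewrite exprn_even_gt0.
have : c * \int[mu]_x (phi x * w k x) @[k --> \oo] --> c ^+ 2.
  by rewrite expr2; apply: cvgM; [exact: cvg_cst|].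
move=> /cvgr_gt /(_ (c ^+ 2 / 2)) [|K _ Kc]; first by rewrite ltr_pdivrMr//; lra.
pose D := \int[mu]_x (phi x ^+ 2).
have D0 : 0 <= D by apply: Rintegral_ge0 => x _; exact: sqr_ge0.
have B0 : 0 <= B.
  by apply: le_trans (wB 0); apply: Rintegral_ge0 => x _; exact: sqr_ge0.
have main N : N%:R * (c ^+ 2 / 2) ^+ 2 <= c ^+ 2 * D * B.
  case: N => [|N]; first by rewrite mul0r mulr_ge0// mulr_ge0// sqr_ge0.
  pose S x := \sum_(k < N.+1) w (K + k)%N x.
  have SL : S \in Lfun mu 2%:E by exact: L2_sum.
  have pS : \int[mu]_x (phi x * S x) = \sum_(k < N.+1) \int[mu]_x (phi x * w (K + k)%N x).
    rewrite -Rint_sum; last by move=> k; exact: L2_mul_integrable.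
    by apply: eq_Rintegral => x _; rewrite mulr_sumr.
  have S2 : \int[mu]_x (S x ^+ 2) <= N.+1%:R * B.
    rewrite (_ : \int[mu]_x _ = \sum_(k < N.+1) \int[mu]_x (w (K + k)%N x ^+ 2)).
      apply: (@le_trans _ _ (\sum_(k < N.+1) B)); first by apply: ler_sum.
      by rewrite sumr_const card_ord mulr_natl.
    rewrite (_ : \int[mu]_x _ = \int[mu]_x
        (\sum_(k < N.+1) \sum_(l < N.+1) (w (K + k)%N x * w (K + l)%N x))); last first.
      apply: eq_Rintegral => x _; rewrite expr2 mulr_suml; apply: eq_bigr => k _.
      by rewrite mulr_sumr.
    rewrite Rint_sum; last by move=> k; apply: rintg_sum => l; exact: L2_mul_integrable.
    apply: eq_bigr => k _; rewrite Rint_sum; last by move=> l; exact: L2_mul_integrable.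
    rewrite (bigD1 k)//= big1 ?addr0; last first.
      by move=> l lk; apply: ort; rewrite eqn_add2l eq_sym.
    by apply: eq_Rintegral => x _; rewrite expr2.
  have lb : N.+1%:R * (c ^+ 2 / 2) <= c * \int[mu]_x (phi x * S x).
    rewrite pS mulr_sumr (_ : N.+1%:R * _ = \sum_(k < N.+1) (c ^+ 2 / 2)); last first.
      by rewrite sumr_const card_ord mulr_natl.
    by apply: ler_sum => k _; apply/ltW/Kc; exact: leq_addr.
  have := L2_cauchy_schwarz pL SL; rewrite -/D => cs.
  have N0 : 0 < N.+1%:R :> R by rewrite ltr0n.
  rewrite -(ler_pM2l N0) (_ : N.+1%:R * (N.+1%:R * _) = (N.+1%:R * (c ^+ 2 / 2)) ^+ 2); last by ring.
  apply: (@le_trans _ _ ((c * \int[mu]_x (phi x * S x)) ^+ 2)).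
    have lb0 : 0 <= N.+1%:R * (c ^+ 2 / 2) by rewrite mulr_ge0// divr_ge0// ltW.
    by rewrite ler_sqr// nnegrE// (le_trans lb0).
  rewrite exprMn; apply: (@le_trans _ _ (c ^+ 2 * (D * (N.+1%:R * B)))).
    by rewrite ler_wpM2l ?sqr_ge0//; apply: le_trans cs _; rewrite ler_wpM2l.
  by rewrite le_eqVlt; apply/orP; left; apply/eqP; ring.
have q0 : 0 < (c ^+ 2 / 2) ^+ 2 by rewrite exprn_gt0// divr_gt0.
have := main (Num.truncn (c ^+ 2 * D * B / (c ^+ 2 / 2) ^+ 2)).+1.
by rewrite leNgt -ltr_pdivrMr// truncnS_gt.
Qed.

(** A change of variables moves the dilation from u, which is merely in L^2, to f, where continuity
    and dominated convergence apply. *)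
Lemma test_function_dilation_cvg f u (s : nat -> R) : test_function f -> u \in Lfun L 2%:E ->
  (forall k, 1 <= s k <= 2) -> s k @[k --> \oo] --> (1 : R) ->
  \int[L]_x (f x * u (s k *: x)) @[k --> \oo] --> \int[L]_x (f x * u x).
Proof.
move=> tf uL s12 s1.
have s0 k : 0 < s k by have /andP[h _] := s12 k; apply: lt_le_trans h.
have si0 k : 0 < (s k)^-1 by rewrite invr_gt0.
have [M [r [M0 r0 fM]]] := test_function_bounded tf.
have fL := test_function_L2 tf.
have E k : \int[L]_x (f x * u (s k *: x)) = (s k) ^- n * \int[L]_x (f ((s k)^-1 *: x) * u x).
  rewrite -Rint_dilation//; last by apply: L2_mul_integrable => //; exact: L2_dilation.
  by apply: eq_Rintegral => x _; rewrite scalerA mulVf ?scale1r// gt_eqF.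
rewrite (_ : (fun k => _) = fun k => (s k) ^- n * \int[L]_x (f ((s k)^-1 *: x) * u x)); last exact/funext.
rewrite -[X in _ --> X]mul1r; apply: cvgM.
  have h : s k ^+ n @[k --> \oo] --> (1 : R).
    have h := @exprn_continuous R n 1; rewrite /continuous_at expr1n in h.
    exact: (@cvg_comp _ _ _ s (fun x => x ^+ n) _ _ _ s1 h).
  by rewrite -[X in _ `=>` nbhs X]invr1; exact: (@cvgV _ _ _ _ _ _ (oner_neq0 R) h).
(* As [s k <= 2], all the dilates of f vanish outside the cube of radius 2 r. *)
have [] := @Rint_dominated _ _ _ L (fun k x => f ((s k)^-1 *: x) * u x) (fun x => f x * u x)
   (fun x => M * (`|u x * \1_(cube n (2 * r)) x|)).
- move=> k; apply: measurable_funM; last exact: L2_measurable uL.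
  exact: L2_measurable (L2_dilation (si0 k) fL).
- exact: rintg_measurable (L2_mul_integrable fL uL).
- apply: aeW => x; apply: cvgM; last exact: cvg_cst.
  apply: (@cvg_comp _ _ _ (fun k => (s k)^-1 *: x) f _ (nbhs x)); last exact: test_function_continuous.
  have h : (s k)^-1 *: x @[k --> \oo] --> (1^-1 : R) *: x.
    by apply: cvgZr_tmp; exact: (@cvgV _ _ _ _ _ _ (oner_neq0 R) s1).
  by rewrite invr1 scale1r in h.
- apply: rintgZ; apply: rintg_norm; apply: L2_mul_integrable => //.
  apply/L2P; split; first by apply: measurable_indic; exact: measurable_box.
  have /rintgP[_] := rintg_indic_cube (n := n) (2 * r); apply: le_lt_trans.
  apply: ge0_le_integral => //.
  - by apply: measurable_sq; apply: measurable_indic; exact: measurable_box.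
  - by apply/measurable_EFinP; apply: measurableT_comp => //; apply: measurable_indic; exact: measurable_box.
  - by move=> x _; rewrite lee_fin indicE; case: (_ \in _); rewrite ?expr1n ?expr0n ?normr1 ?normr0.
- move=> k x; rewrite !normrM mulrCA mulrC ler_wpM2l//; apply: le_trans (fM _) _.
  rewrite ler_wpM2l// ger0_norm ?indicE ?ler0n//.
  have [h|h] := pselect (cube n r ((s k)^-1 *: x)); last by rewrite memNset.
  rewrite mem_set// mem_set//; apply/cube_norm; first by rewrite mulr_gt0.
  move/cube_norm : h => /(_ r0); rewrite normrZ gtr0_norm// ltr_pdivrMl// => h.
  apply: lt_le_trans h _; rewrite ler_pM2r//; by have /andP[] := s12 k.
by [].
Qed.

(** Let J be the integral of u(x) u(s x) and K the energy pairing of g(x) with g(s x). Testing with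
    u(s x), and with u(x / s) followed by rescaling, gives s K = beta J = s^-1 K, hence (s^2 - 1)
    beta J = 0. *)
Lemma dilation_eigenfunction u g (A : 'M[R]_n) (beta : R) : W12 u g -> A^T = A -> beta != 0 ->
  (forall v h, W12 v h -> \int[L]_x mxform A (g x) (h x) = beta * \int[L]_x (u x * v x)) ->
  {ae L, forall x, u x = 0}.
Proof.
move=> ug sA b0 eig.
have uL : u \in Lfun L 2%:E by case: ug.
have gL j : (fun x => g x 0 j) \in Lfun L 2%:E by case: ug.
have gsL c j : 0 < c -> (fun x => g (c *: x) 0 j) \in Lfun L 2%:E.
  by move=> c0; exact: (L2_dilation c0 (gL j)).
have ort1 s : 0 < s -> s != 1 -> \int[L]_x (u x * u (s *: x)) = 0.
  move=> s0 s1; have si0 : 0 < s^-1 by rewrite invr_gt0.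
  have sn0 : s != 0 by rewrite gt_eqF.
  have /= E1 := eig _ _ (W12_dilation s0 ug).
  have /= E2 := eig _ _ (W12_dilation si0 ug).
  pose J := \int[L]_x (u x * u (s *: x)); pose K := \int[L]_x mxform A (g x) (g (s *: x)).
  have F1 : \int[L]_x mxform A (g x) (s *: g (s *: x)) = s * K.
    rewrite -RintZ; last by apply: mxform_rintg => // j; exact: gsL.
    by apply: eq_Rintegral => x _; rewrite -{1}[g x]scale1r mxformZ mul1r.
  have F2 : s ^- n * \int[L]_x mxform A (g x) (s^-1 *: g (s^-1 *: x)) = s^-1 * K.
    rewrite -Rint_dilation//; last first.
      apply: mxform_rintg => // j; under eq_fun do rewrite mxE; apply: L2Z; exact: gsL.
    rewrite -RintZ; last by apply: mxform_rintg => // j; exact: gsL.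
    apply: eq_Rintegral => x _; rewrite scalerA mulVf// scale1r.
    by rewrite -{1}[g (s *: x)]scale1r mxformZ mul1r mxform_sym.
  have F3 : s ^- n * \int[L]_x (u x * u (s^-1 *: x)) = J.
    rewrite -Rint_dilation//; last by apply: L2_mul_integrable => //; exact: L2_dilation.
    by apply: eq_Rintegral => x _; rewrite scalerA mulVf// scale1r mulrC.
  have : s^-1 * K = beta * J by rewrite -F2 E2 mulrCA F3.
  rewrite F1 -/J in E1 => E3.
  have : (s ^+ 2 - 1) * (beta * J) = 0.
    rewrite mulrBl mul1r -{2}E1 -E3; field.
    exact: sn0.
  move/eqP; rewrite mulf_eq0 mulf_eq0 (negbTE b0) /= => /orP[|/eqP//].
  rewrite subr_eq0 sqrf_eq1 (negbTE s1) /= => /eqP sN1.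
  by move: s0; rewrite sN1 oppr_gt0 ltr10.
(* Distinct factors in [1, 2] that tend to 1; two different dilates are orthogonal because rescaling
   reduces them to the ratio [s l / s k]. *)
pose s (k : nat) : R := 1 + k.+1%:R^-1.
have sk k : 0 < k.+1%:R^-1 :> R by rewrite invr_gt0 ltr0n.
have s12 k : 1 <= s k <= 2.
  rewrite lerDl ltW//= /s (_ : 2 = 1 + 1)// lerD2l invf_le1 ?ler1n ?ltr0n//.
have s0 k : 0 < s k by rewrite addr_gt0.
apply: (@fundamental_lemma_leb R n _ _ (dirac (0 : 'rV[R]_n))) => // f tf.
have fL := test_function_L2 tf.
under eq_Rintegral do rewrite mulrC.
apply: (@orthogonal_weak_limit _ _ L (fun k x => u (s k *: x)) f (\int[L]_x (u x ^+ 2))) => //.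
- by move=> k; exact: L2_dilation.
- move=> k l kl.
  have q0 : 0 < s l / s k by rewrite divr_gt0.
  rewrite -[RHS](mulr0 ((s k) ^- n)) -(ort1 (s l / s k) q0); last first.
    apply/negP => /eqP h; move/negP: kl; apply.
    have : s l = s k by rewrite -[RHS]mul1r -h divfK// gt_eqF.
    by move=> /addrI/invr_inj/eqP; rewrite eqr_nat => /eqP[->].
  rewrite -Rint_dilation//; last by apply: L2_mul_integrable => //; exact: L2_dilation.
  by apply: eq_Rintegral => x _; rewrite scalerA divfK// gt_eqF.
- move=> k; rewrite (Rint_dilation (f := fun x => u x ^+ 2))//; last exact: L2_sqr_integrable.
  rewrite ler_piMl//; first by apply: Rintegral_ge0 => x _; exact: sqr_ge0.
  rewrite invf_le1 ?exprn_gt0// exprn_ege1//; by have /andP[] := s12 k.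
- apply: test_function_dilation_cvg => //.
  rewrite -[X in _ --> X]addr0; apply: cvgD; first exact: cvg_cst.
  exact: cvg_harmonic.
Qed.

Lemma elliptic_eigenfunction u g (A : 'M[R]_n) (beta : R) : (0 < n)%N -> W12 u g -> A^T = A ->
  (forall i : 'I_n, exists2 c : R, 0 < c & forall y : 'rV[R]_n, c * y 0 i ^+ 2 <= mxform A y y) ->
  (forall v h, W12 v h -> \int[L]_x mxform A (g x) (h x) = beta * \int[L]_x (u x * v x)) ->
  {ae L, forall x, u x = 0}.
Proof.
move=> n0 ug sA Apos eig; have [b0|b0] := eqVneq beta 0; last exact: dilation_eigenfunction eig.
have [uL gL wg] := ug.
have /= := eig _ _ ug; rewrite b0 mul0r => E.
have g0 j : {ae L, forall x, g x 0 j = 0}.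
  have [c c0 cA] := Apos j.
  apply: sqint_eq0; first exact: L2_measurable (gL j).
  rewrite -integral_sqE//; congr EFin; apply/eqP; rewrite eq_le; apply/andP; split; last first.
    by apply: Rintegral_ge0 => x _; exact: sqr_ge0.
  rewrite -(pmulr_rle0 _ c0) -RintZ; last exact: L2_sqr_integrable.
  rewrite -E; apply: le_Rint => //; last exact: mxform_rintg.
  by apply: rintgZ; exact: L2_sqr_integrable.
pose j := Ordinal n0.
apply: (@weak_grad0_eq0 _ _ _ j) => // f tf.
rewrite [LHS](wg _ tf j) (_ : \int[_]_x _ = 0) ?oppr0//.
rewrite -(Rint0 L); apply: ae_eq_Rintegral.
- apply: rintg_measurable; apply: L2_mul_integrable => //; exact: test_function_L2.
- exact: measurable_cst.
- by apply: filterS (g0 j) => x ->; rewrite mul0r.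
Qed.

End dilation.

(** * Positivity of the homogenised matrix *)

Section one_dimensional_partition.
Context {R : realType}.

(** A difference of consecutive translates of [sstep]: it lives on ]-1, 1[ and its integer
    translates telescope to a partition of unity. *)
Definition hat (t : R) : R := sstep (t + 1) - sstep t.
Definition dhat (t : R) : R := dsstep (t + 1) - dsstep t.

Lemma hat_ge0 t : 0 <= hat t.
Proof.
rewrite subr_ge0; have [t0|t0] := leP t 0; first by rewrite (sstep_eq0 t0) sstep_ge0.
by rewrite [leRHS]sstep_eq1 ?sstep_le1// lerDr ltW.
Qed.

Lemma hat_eq0 t : ~~ (-1 < t < 1) -> hat t = 0.
Proof.
rewrite /hat negb_and -!leNgt => /orP[t1|t1].
  by rewrite !sstep_eq0 ?subrr//; lra.
by rewrite !sstep_eq1 ?subrr//; lra.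
Qed.

Lemma is_derive_sstep_affine (a b t : R) :
  is_derive t (1 : R) (fun t => sstep (a * t + b)) (a * dsstep (a * t + b)).
Proof.
have h : is_derive t (1 : R) (fun t : R => a * t + b) a.
  have h1 := @is_deriveD _ _ _ ( *%R a) (cst b) t (1 : R) _ _ (is_deriveZ a (is_derive_id t 1)) (is_derive_cst b t 1).
  have E : a%:A + 0 = a :> R by rewrite addr0; exact: mulr1.
  by rewrite E in h1.
have h2 := @is_derive1_comp _ sstep (fun t => a * t + b) t _ _ (is_derive_sstep (a * t + b)) h.
by apply: is_derive_eq h2 _; rewrite mulrC.
Qed.

Lemma is_derive_hat_affine (a b t : R) :
  is_derive t (1 : R) (fun t => hat (a * t + b)) (a * dhat (a * t + b)).
Proof.
have h1 := is_derive_sstep_affine a (b + 1) t; have h2 := is_derive_sstep_affine a b t.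
rewrite /hat /dhat; under eq_fun do rewrite -addrA.
by rewrite mulrBr -addrA; exact: is_deriveB.
Qed.

Lemma smooth1_hat_affine (a b : R) : smooth1 (fun t => hat (a * t + b)).
Proof.
rewrite (_ : (fun _ => _) = fun t => sstep (a * t + (b + 1)) + (-1) * sstep (a * t + b)).
  move=> m; apply: times_derivableD; first exact: (smooth1_affine a (b + 1) smooth1_sstep).
  apply: times_derivableM; first exact: times_derivable_cst.
  exact: (smooth1_affine a b smooth1_sstep).
by apply/funext => t; rewrite /hat -addrA mulN1r.
Qed.

Lemma sum_hat (t : R) M : \sum_(k < M) hat (t - k%:R) = sstep (t + 1) - sstep (t + 1 - M%:R).
Proof.
elim: M => [|M IH]; first by rewrite big_ord0 subr0 subrr.
rewrite big_ord_recr /= IH /hat -natr1.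
rewrite (_ : t - M%:R + 1 = t + 1 - M%:R); last by ring.
rewrite (_ : t + 1 - (M%:R + 1) = t - M%:R); last by ring.
by ring.
Qed.

Lemma sum_hat_le1 (t : R) M : \sum_(k < M) hat (t - k%:R) <= 1.
Proof. by rewrite sum_hat; have := sstep_le1 (t + 1); have := sstep_ge0 (t + 1 - M%:R); lra. Qed.

Lemma sum_hat_eq1 (t : R) M : 0 <= t <= M%:R - 1 -> \sum_(k < M) hat (t - k%:R) = 1.
Proof.
by move=> /andP[t0 tM]; rewrite sum_hat (@sstep_eq1 _ (t + 1)) ?sstep_eq0; lra.
Qed.

(** Integer translates of [dsstep] live on disjoint unit intervals, so at most one term survives and
    the bound does not grow with M. *)
Lemma sum_dsstep_le (t K : R) M : (forall t, `|dsstep t : R| <= K) -> 0 <= K ->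
  \sum_(k < M) `|dsstep (t - k%:R)| <= K.
Proof.
move=> dK K0; have [/existsP[k tk]|/existsPn tk] := boolP [exists k : 'I_M, 0 < t - k%:R < 1].
  rewrite (bigD1 k)//= big1 ?addr0// => l lk.
  rewrite dsstep_eq0 ?normr0//; apply: contra lk => tl.
  move: tk tl; case/andP=> h1 h2 /andP[h3 h4].
  have h5 : k%:R < l%:R + 1 :> R by lra.
  have h6 : l%:R < k%:R + 1 :> R by lra.
  move: h5 h6; rewrite !natr1 !ltr_nat !ltnS => h5 h6.
  by apply/eqP/val_inj/anti_leq; rewrite /= h5 h6.
by rewrite big1// => k _; rewrite dsstep_eq0 ?normr0.
Qed.

Lemma sum_dhat_le (t K : R) M : (forall t, `|dsstep t : R| <= K) -> 0 <= K ->
  \sum_(k < M) `|dhat (t - k%:R)| <= 2 * K.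
Proof.
move=> dK K0.
apply: (@le_trans _ _ (\sum_(k < M) (`|dsstep ((t + 1) - k%:R)| + `|dsstep (t - k%:R)|))).
  apply: ler_sum => k _; rewrite /dhat (_ : t - k%:R + 1 = t + 1 - k%:R); last by ring.
  exact: ler_normB.
rewrite big_split /=; have := sum_dsstep_le (t + 1) M dK K0; have := sum_dsstep_le t M dK K0.
by lra.
Qed.

End one_dimensional_partition.

Section separable_products.
Context {R : realType} {n : nat}.
Implicit Types (x y : 'rV[R]_n) (l j : 'I_n).

Definition prodf (h : 'I_n -> R -> R) (x : 'rV[R]_n) : R := \prod_l h l (x 0 l).

Lemma smooth_sym_prodf h : (forall l, smooth1 (h l)) -> smooth_sym (prodf h).
Proof. by move=> sh; apply: smooth_sym_prod => l; exact: smooth_sym_coord. Qed.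

Lemma pd_prodf h h' l x : (forall k, smooth1 (h k)) ->
  (forall k t, is_derive t (1 : R) (h k) (h' k t)) ->
  pd l (prodf h) x = h' l (x 0 l) * \prod_(k | k != l) h k (x 0 k).
Proof.
(* The factors other than l form a product that is constant along e_l, so its derivative vanishes by
   [pd_line_min]. *)
move=> sh hh'; pose h0 k t := if k == l then 1 else h k t.
have sh0 k : smooth1 (h0 k).
  rewrite /h0; case: (k == l) => //.
  by move=> m; exact: times_derivable_cst.
have d0 y : differentiable (prodf h0) y by have [/(_ 0)[]] := smooth_sym_prodf sh0.
have d1 y : differentiable (fun x : 'rV[R]_n => h l (x 0 l)) y.
  by apply: differentiable_coord_comp => t; have [] := hh' l t.
have p0 y : prodf h0 y = \prod_(k | k != l) h k (y 0 k).
  rewrite /prodf (bigD1 l)//= /h0 eqxx mul1r.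
  by apply: eq_bigr => k /negPf ->.
have -> : prodf h = fun x => h l (x 0 l) * prodf h0 x.
  by apply/funext => y; rewrite p0 /prodf (bigD1 l).
rewrite pdM// (pd_coord _ _ (hh' l)) eqxx mul1r (pd_line_min d0) ?mulr0 ?add0r ?p0 1?mulrC//.
move=> t; rewrite !p0 le_eqVlt; apply/orP; left; apply/eqP; apply: eq_bigr => k kl.
by rewrite !mxE eqxx (negPf kl) mulr0 add0r.
Qed.

Lemma pd_sum (I : Type) (r : seq I) (F : I -> 'rV[R]_n -> R) l x :
  (forall k x, differentiable (F k) x) ->
  pd l (fun x => \sum_(k <- r) F k x) x = \sum_(k <- r) pd l (F k) x.
Proof.
move=> dF; elim: r => [|k r IH].
  rewrite big_nil (_ : (fun _ => _) = cst 0) ?pd_cst//.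
  by apply/funext => y; rewrite big_nil.
have dS y : differentiable (fun x => \sum_(k <- r) F k x) y.
  elim: (r) => [|k' r' IH'].
    rewrite (_ : (fun _ => _) = cst 0); first exact: differentiable_cst.
    by apply/funext => z; rewrite big_nil.
  rewrite (_ : (fun _ => _) = fun x => F k' x + \sum_(k <- r') F k x); first exact: differentiableD.
  by apply/funext => z; rewrite big_cons.
rewrite big_cons -IH (_ : (fun _ => _) = fun x => F k x + \sum_(k <- r) F k x).
  by rewrite pdD.
by apply/funext => y; rewrite big_cons.
Qed.

Lemma near_eq_pd (f g : 'rV[R]_n -> R) l x : (\forall y \near x, f y = g y) -> pd l f x = pd l g x.
Proof. by move=> fg; apply: near_eq_derive. Qed.

End separable_products.

(** * A smooth function with gradient e_j on the inclusions *)

Section corrector.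
Context {R : realType} {n : nat}.
Implicit Types (x y : 'rV[R]_n) (l j : 'I_n).
Variables (kap : R) (N : nat).
Hypothesis kap0 : 0 < kap.
Let index := {ffun 'I_n -> 'I_(2 * N).+1}.
Implicit Types z : index.

(** The open cube of side 2 / kap centred at (z - N) / kap; the shift by N lets indices from 0 to 2
    N cover both signs. *)
Definition cell z x := forall l, -1 < kap * x 0 l + (N%:R - (z l)%:R) < 1.

Definition bump_cell z : 'rV[R]_n -> R :=
  prodf (fun l t => hat (kap * t + (N%:R - (z l)%:R))).

Lemma smooth_sym_bump_cell z : smooth_sym (bump_cell z).
Proof. by apply: smooth_sym_prodf => l; exact: smooth1_hat_affine. Qed.

Lemma differentiable_bump_cell z x : differentiable (bump_cell z) x.
Proof. by have [/(_ 0)[]] := smooth_sym_bump_cell z. Qed.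

Lemma bump_cell_ge0 z x : 0 <= bump_cell z x.
Proof. by apply: prodr_ge0 => l _; exact: hat_ge0. Qed.

Lemma bump_cell_eq0 z x : ~ cell z x -> bump_cell z x = 0.
Proof.
move=> /existsNP[l /negP nl].
by rewrite /bump_cell /prodf (bigD1 l)//= hat_eq0// mul0r.
Qed.

Lemma sum_bump_cell x :
  \sum_z bump_cell z x = \prod_l \sum_(k < (2 * N).+1) hat (kap * x 0 l + N%:R - k%:R).
Proof.
rewrite bigA_distr_bigA; apply: eq_bigr => z _; apply: eq_bigr => l _.
by rewrite addrA.
Qed.

Lemma sum_bump_cell_le1 x : \sum_z bump_cell z x <= 1.
Proof.
rewrite sum_bump_cell; apply: prodr_ile1 => l _; rewrite sum_hat_le1 andbT.
by apply: sumr_ge0 => k _; exact: hat_ge0.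
Qed.

Lemma sum_bump_cell_eq1 x : (forall l, `|kap * x 0 l| <= N%:R) -> \sum_z bump_cell z x = 1.
Proof.
move=> xN; rewrite sum_bump_cell big1// => l _; apply: sum_hat_eq1.
have := xN l; rewrite ler_norml => /andP[h1 h2].
have -> : (2 * N).+1%:R - 1 = 2 * N%:R :> R by rewrite -natr1 addrK natrM.
apply/andP; split; lra.
Qed.

Lemma pd_bump_cell z l x : pd l (bump_cell z) x =
  kap * (dhat (kap * x 0 l + (N%:R - (z l)%:R)) *
         \prod_(k | k != l) hat (kap * x 0 k + (N%:R - (z k)%:R))).
Proof.
have h1 k : smooth1 (fun t => hat (kap * t + (N%:R - (z k)%:R))) by exact: smooth1_hat_affine.
have h2 k t := is_derive_hat_affine kap (N%:R - (z k)%:R) t.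
by rewrite [LHS](pd_prodf l x h1 h2) mulrA.
Qed.

Lemma pd_bump_cell_eq0 z l x : ~ cell z x -> pd l (bump_cell z) x = 0.
Proof.
move=> ncx; apply: pd_line_min => [y|t]; first exact: differentiable_bump_cell.
by rewrite (bump_cell_eq0 ncx) bump_cell_ge0.
Qed.

(** The sum over cells factorises over the coordinates: the factor of direction l is at most 2 K,
    the others at most 1. The bound is independent of N, that is, of the size of the region
    covered. *)
Lemma sum_pd_bump_cell_le (K : R) l x : (forall t : R, `|dsstep t| <= K) -> 0 <= K ->
  \sum_z `|pd l (bump_cell z) x| <= kap * (2 * K).
Proof.
move=> dK K0; pose w k (i : 'I_(2 * N).+1) :=
  if k == l then `|dhat (kap * x 0 k + N%:R - i%:R)| else hat (kap * x 0 k + N%:R - i%:R).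
rewrite (_ : \sum_z _ = kap * \prod_k \sum_(i < (2 * N).+1) w k i).
  rewrite ler_pM2l// (bigD1 l)//= -[leRHS]mulr1 ler_pM//.
  - by apply: sumr_ge0 => i _; rewrite /w eqxx.
  - apply: prodr_ge0 => k _; apply: sumr_ge0 => i _; rewrite /w; case: ifP => // _.
    exact: hat_ge0.
  - by rewrite /w eqxx sum_dhat_le.
  - apply: prodr_ile1 => k kl; rewrite /w (negPf kl) sum_hat_le1 andbT.
    by apply: sumr_ge0 => i _; exact: hat_ge0.
rewrite bigA_distr_bigA mulr_sumr; apply: eq_bigr => z _.
rewrite pd_bump_cell !normrM (gtr0_norm kap0); congr (_ * _).
rewrite [RHS](bigD1 l)//= {1}/w eqxx addrA; congr (_ * _).
rewrite ger0_norm; last by apply: prodr_ge0 => k _; exact: hat_ge0.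
by apply: eq_bigr => k kl; rewrite /w (negPf kl) addrA.
Qed.

Variables (tau c : index -> R) (j : 'I_n).
Hypothesis tau01 : forall z, tau z = 0 \/ tau z = 1.
Hypothesis cell_c : forall x z, cell z x -> tau z != 0 -> `|x 0 j - c z| <= 1.

(** The weight [tau z] will mark the cells that meet an inclusion, and [c z] will be the j-th
    coordinate of a reference point of it. Where all cells nearby meet the same inclusion the sum is
    x_j - c, with gradient e_j; subtracting c keeps the function bounded on the whole space. *)
Definition corrector x : R := \sum_z tau z * (bump_cell z x * (x 0 j + - c z)).

Lemma smooth1_subc (a : R) : smooth1 (fun t : R => t + a).
Proof.
have h : smooth1 (fun t : R => t).
  case=> //= m; exists (cst 1); first by move=> t; exact: is_derive_id.
  exact: times_derivable_cst.
by have := smooth1_affine 1 a h; under [X in smooth1 X -> _]eq_fun do rewrite mul1r.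
Qed.

Lemma smooth_sym_corrector : smooth_sym corrector.
Proof.
apply: smooth_sym_sum => z; apply: smooth_symM; first exact: smooth_sym_cst.
apply: smooth_symM; first exact: smooth_sym_bump_cell.
exact: (@smooth_sym_coord _ _ (fun t => t + - c z) j (smooth1_subc _)).
Qed.

Lemma corrector_le1 x : `|corrector x| <= 1.
Proof.
apply: le_trans (ler_norm_sum _ _ _) _; apply: le_trans (sum_bump_cell_le1 x).
apply: ler_sum => z _.
have [cz|ncz] := pselect (cell z x); last by rewrite bump_cell_eq0// mul0r mulr0 normr0.
have [t0|t0] := eqVneq (tau z) 0; first by rewrite t0 mul0r normr0 bump_cell_ge0.
have [/eqP|->] := tau01 z; first by rewrite (negPf t0).
rewrite mul1r normrM ger0_norm ?bump_cell_ge0//.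
by rewrite ler_piMr ?bump_cell_ge0// cell_c.
Qed.

Lemma pd_corrector l x : pd l corrector x = \sum_z tau z *
  (bump_cell z x * (l == j)%:R + (x 0 j - c z) * pd l (bump_cell z) x).
Proof.
have d1 z y : differentiable (fun x : 'rV[R]_n => x 0 j + - c z) y.
  by have [/(_ 0)[]] := @smooth_sym_coord _ _ (fun t => t + - c z) j (smooth1_subc _).
have d2 z y : differentiable (fun x => bump_cell z x * (x 0 j + - c z)) y.
  by apply: differentiableM => //; exact: differentiable_bump_cell.
rewrite pd_sum; last first.
  by move=> z y; apply: differentiableM => //; exact: differentiable_cst.
apply: eq_bigr => z _.
rewrite (@pdM _ _ _ (cst (tau z)) _ (fun=> differentiable_cst _ _) (d2 z)).
rewrite pd_cst mulr0 addr0; congr (_ * _).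
rewrite pdM//; last exact: differentiable_bump_cell.
congr (_ * _ + _).
have h (t : R) : is_derive t (1 : R) (fun t => t + - c z) 1.
  have := is_deriveD (is_derive_id t (1 : R)) (is_derive_cst (- c z) t (1 : R)).
  by rewrite addr0.
by rewrite (pd_coord _ _ h) mulr1.
Qed.

Lemma pd_corrector_le (K : R) l x : (forall t : R, `|dsstep t| <= K) -> 0 <= K ->
  `|pd l corrector x| <= kap * (2 * K) + 1.
Proof.
move=> dK K0; rewrite pd_corrector; apply: le_trans (ler_norm_sum _ _ _) _.
apply: (@le_trans _ _ (\sum_z (`|pd l (bump_cell z) x| + bump_cell z x))); last first.
  by rewrite big_split/= lerD ?sum_bump_cell_le1 ?sum_pd_bump_cell_le.
apply: ler_sum => z _.
have [cz|ncz] := pselect (cell z x); last first.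
  by rewrite bump_cell_eq0// pd_bump_cell_eq0// !mulr0 mul0r addr0 mulr0 normr0 addr0.
have b0 := bump_cell_ge0 z x.
have [t0|t0] := eqVneq (tau z) 0; first by rewrite t0 mul0r normr0 addr_ge0.
have [/eqP|->] := tau01 z; first by rewrite (negPf t0).
rewrite mul1r; apply: le_trans (ler_normD _ _) _; rewrite addrC lerD//.
  by rewrite normrM ler_piMl// cell_c.
by case: (l == j); rewrite ?mulr1 ?mulr0 ?normr0// ger0_norm.
Qed.

(** The strict bound on the coordinates persists near x, where the bumps therefore sum to 1 and the
    corrector coincides with x_j - c0. *)
Lemma pd_corrector_linear l x c0 : (forall k, `|kap * x 0 k| < N%:R) ->
  (\forall y \near x, forall z, cell z y -> tau z = 1 /\ c z = c0) ->
  pd l corrector x = (l == j)%:R.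
Proof.
move=> xN xS.
have h (t : R) : is_derive t (1 : R) (fun t => t + - c0) 1.
  have := is_deriveD (is_derive_id t (1 : R)) (is_derive_cst (- c0) t (1 : R)).
  by rewrite addr0.
transitivity (pd l (fun x : 'rV[R]_n => x 0 j + - c0) x); last first.
  by rewrite (pd_coord _ _ h) mulr1.
apply: near_eq_pd.
have nN : \forall y \near x, forall k : 'I_n, `|kap * (y : 'rV[R]_n) 0 k| < N%:R.
  have : forall k : 'I_n, \forall y \near x, `|kap * (y : 'rV[R]_n) 0 k| < N%:R.
    move=> k; have ck : (fun y : 'rV[R]_n => `|kap * y 0 k|) @ x --> `|kap * x 0 k|.
      apply: (@cvg_comp _ _ _ (fun y : 'rV[R]_n => kap * y 0 k) Num.norm _ (nbhs (kap * x 0 k))).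
        have h1 : (fun y : 'rV[R]_n => y 0 k) @ x --> x 0 k by exact: coord_continuous.
        exact: (@cvgM _ _ _ _ (fun=> kap) _ _ _ (cvg_cst kap) h1).
      exact: norm_continuous.
    exact: (cvgr_lt _ ck).
  by move/filter_forall.
near=> y.
have yN : forall k, `|kap * y 0 k| < N%:R by near: y.
have yS : forall z, cell z y -> tau z = 1 /\ c z = c0 by near: y.
rewrite -[RHS]mul1r -(sum_bump_cell_eq1 (x := y)); last by move=> k; exact/ltW/yN.
rewrite mulr_suml; apply: eq_bigr => z _.
have [cz|ncz] := pselect (cell z y); last by rewrite bump_cell_eq0// !mul0r mulr0.
by have [-> ->] := yS _ cz; rewrite mul1r.
Unshelve. all: by end_near. Qed.

End corrector.

Section euclidean_facts.
Context {R : realType} {n : nat}.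
Implicit Types (x y v : 'rV[R]_n) (A B : set 'rV[R]_n).

Lemma dotv_sqr v : dotv v v = \sum_l v 0 l ^+ 2.
Proof. by rewrite dotvE; apply: eq_bigr => l _; rewrite expr2. Qed.

Lemma normr_coord_enorm v l : `|v 0 l| <= enorm v.
Proof.
rewrite -sqrtr_sqr ler_wsqrtr// dotv_sqr (bigD1 l)//= lerDl.
by apply: sumr_ge0 => k _; exact: sqr_ge0.
Qed.

Lemma enorm_le_sum v : enorm v <= \sum_l `|v 0 l|.
Proof.
have s0 : 0 <= \sum_l `|v 0 l| by exact: sumr_ge0.
rewrite -[leRHS]ger0_norm// -sqrtr_sqr ler_wsqrtr// dotv_sqr.
rewrite expr2 mulr_suml; apply: ler_sum => l _.
rewrite -real_normK ?num_real// expr2 ler_wpM2l//.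
by rewrite (bigD1 l)//= lerDl sumr_ge0.
Qed.

Lemma euclid_dist_lt (r : R) A B x y : (r%:E < euclid_dist A B)%E -> A x -> B y ->
  r < enorm (x - y).
Proof.
move=> AB Ax By; rewrite -lte_fin; apply: lt_le_trans AB _.
by apply: ereal_inf_lbound; exists x => //; exists y.
Qed.

Lemma euclid_diam_lt (r : R) A x y : (euclid_diam A < r%:E)%E -> A x -> A y ->
  enorm (x - y) < r.
Proof.
move=> Ar Ax Ay; rewrite -lte_fin; apply: le_lt_trans Ar.
by apply: ereal_sup_ubound; exists x => //; exists y.
Qed.

End euclidean_facts.

(** * The curl identity tested with a cut-off corrector *)

Section inclusions.
Context {R : realType} {n : nat}.
Implicit Types (x y : 'rV[R]_n) (l j : 'I_n).

Definition separated_inclusions (r0 : R) (S : set 'rV[R]_n) :=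
  exists Ok : (set 'rV[R]_n)^nat,
    [/\ S = \bigcup_k Ok k, forall k, open (Ok k),
        forall k, (euclid_diam (Ok k) < (2^-1)%:E)%E &
        forall k l : nat, k <> l -> (r0%:E < euclid_dist (Ok k) (Ok l))%E].

(** Cells have side 2 / kap. By 2 n / kap <= r0 a cell meets at most one inclusion. By kap >= 4 its
    side is at most 1/2, and the inclusion it meets has diameter below 1/2, which together give the
    bound 1. *)
Lemma corrector_choice (r0 kap : R) S N j : 0 < r0 -> 4 <= kap -> n%:R * 2 <= r0 * kap ->
  separated_inclusions r0 S ->
  exists tau c : {ffun 'I_n -> 'I_(2 * N).+1} -> R,
  [/\ forall z, tau z = 0 \/ tau z = 1,
      forall x z, cell kap z x -> tau z != 0 -> `|x 0 j - c z| <= 1 &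
      forall x, S x -> exists c0, \forall y \near x, forall z, cell kap z y -> tau z = 1 /\ c z = c0].
Proof.
move=> r00 kap4 kapr [Ok [SE oOk dOk sOk]].
have kap0 : 0 < kap by apply: lt_le_trans kap4.
pose t z (k : nat) (q : 'rV[R]_n) := Ok k q /\ cell kap (N := N) z q.
(* [xget] selects a reference point in each inclusion; in [c] its default value 0 occurs only for
   cells with [tau z = 0]. *)
pose ctr k : R := xget 0 (Ok k) 0 j.
pose tau z : R := if `[< exists k q, t z k q >] then 1 else 0.
pose c z : R := xget 0 [set a | exists k q, t z k q /\ a = ctr k].
have cellE z x q l : cell kap z x -> cell kap z q -> `|x 0 l - q 0 l| < 2 / kap.
  move=> /(_ l)/andP[h1 h2] /(_ l)/andP[h3 h4].
  rewrite ltr_pdivlMr// mulrC -{1}(gtr0_norm kap0) -normrM ltr_norml mulrBr.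
  by apply/andP; split; lra.
have cE z k q : t z k q -> exists k' q', t z k' q' /\ c z = ctr k'.
  move=> tz; rewrite /c; case: xgetP => [a _ [k' [q' [tz' ->]]]|]; first by exists k', q'.
  by move=> /(_ (ctr k))[]; exists k, q.
have uniq z k k' q q' : t z k q -> t z k' q' -> k = k'.
  move=> [Okq cq] [Okq' cq']; apply: contrapT => kk'.
  have := euclid_dist_lt (sOk _ _ kk') Okq Okq'; apply/negP; rewrite -leNgt.
  apply: le_trans (enorm_le_sum _) _.
  apply: (@le_trans _ _ (\sum_(l < n) (2 / kap))).
    by apply: ler_sum => l _; rewrite !mxE; apply: ltW; exact: cellE cq cq'.
  by rewrite sumr_const card_ord -[leLHS]mulr_natl mulrA ler_pdivrMr.
exists tau, c; split.
- by move=> z; rewrite /tau; case: ifP => _; [right|left].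
- move=> x z cx; rewrite /tau; case: ifPn => [/asboolP[k [q tz]] _|]; last by rewrite eqxx.
  have [k' [q' [[Okq' cq'] ->]]] := cE _ _ _ tz.
  have Oc : Ok k' (xget 0 (Ok k')) by case: xgetP => [a -> //|/(_ q')].
  have h1 := cellE _ _ _ _ j cx cq'.
  have h2 : `|q' 0 j - ctr k'| < 2^-1.
    have h := normr_coord_enorm (q' - xget 0 (Ok k')) j.
    rewrite !mxE in h; apply: le_lt_trans h _; exact: euclid_diam_lt (dOk k') Okq' Oc.
  have h3 : 2 / kap <= 2^-1 :> R by rewrite ler_pdivrMr//; lra.
  rewrite -(subrKA (q' 0 j)); apply: le_trans (ler_normD _ _) _; lra.
- move=> x; rewrite SE => -[k _ Okx]; exists (ctr k).
  have : \forall y \near x, Ok k y by exact: open_nbhs_nbhs.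
  apply: filterS => y Oky z cy; have tz : t z k y by [].
  split; first by rewrite /tau; case: asboolP => // -[]; exists k, y.
  by have [k' [q' [tz' ->]]] := cE _ _ _ tz; rewrite (uniq _ _ _ _ _ tz tz').
Qed.

Definition cut (r : R) : 'rV[R]_n -> R := boxf 1 (fun=> - (r + 1)) (fun=> r + 1).

Lemma is_derive_plateau1 (a b t : R) : is_derive t (1 : R) (plateau 1 a b)
  (sstep (1 * (t - a)) * ((-1) * dsstep (1 * (b - t))) +
   sstep (1 * (b - t)) * (1 * dsstep (1 * (t - a)))).
Proof.
rewrite (_ : plateau 1 a b = fun t => sstep (1 * t + - a) * sstep ((-1) * t + b)); last first.
  by apply/funext => s; rewrite /plateau; congr (sstep _ * sstep _); ring.
rewrite (_ : 1 * (t - a) = 1 * t + - a); last by ring.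
rewrite (_ : 1 * (b - t) = (-1) * t + b); last by ring.
exact: (is_deriveM (is_derive_sstep_affine 1 (- a) t) (is_derive_sstep_affine (-1) b t)).
Qed.

Lemma cut_eq0 r x : ~ cube n (r + 1) x -> cut r x = 0.
Proof. exact: boxf_eq0. Qed.

Lemma cut_eq1 r x : cube n r x -> cut r x = 1.
Proof.
by move=> cx; rewrite /cut /boxf big1// => l _; have /andP[? ?] := cx l; rewrite plateau_eq1//; lra.
Qed.

Lemma pd_cut_eq0 r l x : ~ cube n (r + 1) x \/ cube n r x -> pd l (cut r) x = 0.
Proof.
have sc : smooth_sym (cut r) by exact: smooth_sym_boxf.
have dc y : differentiable (cut r) y by have [/(_ 0)[]] := sc.
move=> [/cut_eq0 c0|/cut_eq1 c1]; first by apply: pd_line_min => // t; rewrite c0 boxf_ge0.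
by apply: pd_line_max => // t; rewrite c1 boxf_le1.
Qed.

Lemma pd_cut_le (K r : R) l x : (forall t : R, `|dsstep t| <= K) -> `|pd l (cut r) x| <= 2 * K.
Proof.
move=> dK; rewrite (pd_prodf l x (fun=> smooth1_plateau 1 _ _) (fun=> is_derive_plateau1 _ _)).
have s1 (u : R) : `|sstep u| <= 1 by rewrite ger0_norm ?sstep_ge0 ?sstep_le1.
rewrite normrM -[leRHS]mulr1 ler_pM//; last first.
  rewrite ger0_norm; first by apply: prodr_ile1 => k _; rewrite plateau_ge0 plateau_le1.
  by apply: prodr_ge0 => k _; exact: plateau_ge0.
apply: le_trans (ler_normD _ _) _; rewrite mulN1r mul1r (_ : 2 * K = K + K); last by ring.
by rewrite lerD// [leLHS]normrM ?normrN -[leRHS]mul1r ler_pM// mul1r.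
Qed.

Let L := leb R n.

Lemma le_ae_Rint d (X : measurableType d) (mu : {measure set X -> \bar R}) (f g : X -> R) :
  rintg mu f -> rintg mu g -> {ae mu, forall x : X, f x <= g x} ->
  \int[mu]_x f x <= \int[mu]_x g x.
Proof.
move=> rf rg fg.
have mm : measurable_fun setT (fun x : X => Num.max (f x) (g x)).
  exact: measurable_maxr (rintg_measurable rf) (rintg_measurable rg).
have E : {ae mu, forall x : X, g x = Num.max (f x) (g x)} by apply: filterS fg => x /max_idPr.
rewrite (ae_eq_Rintegral (rintg_measurable rg) mm E); apply: le_Rint => //.
  exact: (ae_eq_rintg mm E).
by move=> x; rewrite le_max lexx.
Qed.

Lemma rintg_loc (f B : 'rV[R]_n -> R) (M r : R) : 0 <= M -> (forall r, rintg L (fun x => \1_(cube n r) x * f x)) ->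
  measurable_fun setT B -> (forall x, `|B x| <= M * \1_(cube n r) x) ->
  rintg L (fun x => f x * B x).
Proof.
move=> M0 rf mB BM.
rewrite (_ : (fun _ => _) = fun x => (\1_(cube n r) x * f x) * B x).
  apply: (@rintg_bounded _ _ _ _ M) => // x; apply: le_trans (BM x) _.
  by rewrite ler_piMr// indicE lern1 leq_b1.
apply/funext => x; have [h|h] := pselect (cube n r x); first by rewrite indicE mem_set// mul1r.
have := BM x; rewrite indicE memNset// mulr0 normr_le0 => /eqP ->.
by rewrite !mulr0.
Qed.

Lemma corrector_exists (r0 : R) : 0 < r0 -> exists2 C, 0 <= C &
  forall S j r, separated_inclusions r0 S -> exists m : 'rV[R]_n -> R,
    [/\ smooth_sym m, forall x, `|m x| <= 1, forall l x, `|pd l m x| <= C &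
        forall l x, S x -> cube n r x -> pd l m x = (l == j)%:R].
Proof.
move=> r00; have [K K0 dK] := @dsstep_bounded R.
(* Large enough for both constraints of [corrector_choice], and dependent on n and r0 alone, so that
   the gradient bound is the same for all realisations and cubes. *)
pose kap := 4 + n%:R * 2 / r0.
have kap4 : 4 <= kap by rewrite lerDl divr_ge0 ?mulr_ge0// ltW.
have kap0 : 0 < kap by apply: lt_le_trans kap4.
have kapr : n%:R * 2 <= r0 * kap.
  have -> : r0 * kap = r0 * 4 + n%:R * 2 by rewrite /kap; field; rewrite gt_eqF.
  by rewrite lerDr mulr_ge0// ltW.
exists (kap * (2 * K) + 1); first by rewrite addr_ge0// mulr_ge0 ?mulr_ge0// ltW.
move=> S j r sepS.
(* Enough cells to cover the cube of radius r with the strict inequality that [pd_corrector_linear]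
   asks for. *)
pose N := (Num.truncn (kap * r)).+1.
have kN x : cube n r x -> forall k, `|kap * x 0 k| < N%:R.
  move=> cx k; apply: lt_trans (truncnS_gt _); rewrite normrM (gtr0_norm kap0) ltr_pM2l//.
  by have := cx k; rewrite ltr_norml.
have [tau [c [tau01 cell_c tau_S]]] := @corrector_choice r0 kap S N j r00 kap4 kapr sepS.
exists (corrector kap tau c j); split.
- exact: smooth_sym_corrector.
- exact: corrector_le1.
- by move=> l x; exact: pd_corrector_le.
- move=> l x Sx cx; have [c0 nS] := tau_S _ Sx.
  by apply: pd_corrector_linear nS => //; exact: kN.
Qed.

(** With m the corrector and F = cut m, the curl identity tested with F is subtracted from the
    integral of cut Y_i. The integrand becomes cut (Y_i (1 - d_j m) + Y_j d_i m), which vanishes on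
    S where grad m = e_j, plus m (Y_j d_i cut - Y_i d_j cut), which lives on the shell between the
    cubes. Since m is bounded by 1, the shell term carries no factor of order r. The functions [h]
    and [H] are given almost everywhere only, as measurable versions of realisations are. *)
Lemma corrector_bound (r0 : R) : 0 < r0 -> exists2 C, 0 <= C &
  forall S i j (Y : 'I_n -> 'rV[R]_n -> R) (h H : 'rV[R]_n -> R) r,
  i != j -> separated_inclusions r0 S -> 0 < r ->
  (forall F, test_function F -> smooth_sym F ->
     \int[L]_x (Y i x * pd j F x) = \int[L]_x (Y j x * pd i F x)) ->
  (forall l r, rintg L (fun x => \1_(cube n r) x * Y l x)) ->
  (forall r, rintg L (fun x => \1_(cube n r) x * h x)) ->
  (forall r, rintg L (fun x => \1_(cube n r) x * H x)) ->
  {ae L, forall x, h x = \1_(~` S) x * (`|Y i x| + `|Y j x|)} ->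
  {ae L, forall x, H x = `|Y i x| + `|Y j x|} ->
  `|\int[L]_x (cut r x * Y i x)| <=
  C * (\int[L]_x (\1_(cube n (r + 1)) x * h x) +
       \int[L]_x (\1_(cube n (r + 1)) x * H x - \1_(cube n r) x * H x)).
Proof.
move=> r00; have [K K0 dK] := @dsstep_bounded R.
have [C2 C20 exm] := corrector_exists r00.
(* The part 1 + C2 bounds 1 - d_j m, and 2 K bounds the gradient of the cutoff. *)
exists (1 + C2 + 2 * K); first by rewrite addr_ge0 ?mulr_ge0// addr_ge0.
set C := 1 + C2 + 2 * K.
move=> S i j Y h H r ij sepS r_gt0 curl rY rh rH hE HE.
have [m [sm m1 dm1 pm]] := exm S j (r + 1) sepS.
have sc : smooth_sym (cut r) by exact: smooth_sym_boxf.
pose F x := cut r x * m x.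
have sF : smooth_sym F by exact: smooth_symM.
have r10 : 0 < r + 1 by rewrite addr_gt0.
have tF : test_function F.
  apply: (cube_test_function r10); first exact: smooth_sym_smooth.
  by move=> x nx; rewrite /F cut_eq0// mul0r.
have tc : test_function (cut r).
  exact: boxf_test.
have dm x : differentiable m x by have [/(_ 0)[]] := sm.
have dc x : differentiable (cut r) x by have [/(_ 0)[]] := sc.
have pF l x : pd l F x = cut r x * pd l m x + m x * pd l (cut r) x by rewrite pdM.
have rtest l f : test_function f -> rintg L (fun x => Y l x * f x).
  move=> tf; have [M [s [M0 s0 fM]]] := test_function_bounded tf.
  by apply: (rintg_loc M0 (rY l) _ fM); exact: test_function_measurable.
have r1 := rtest i _ tc.
have r2 := rtest i _ (test_function_pd j tF).
have r3 := rtest j _ (test_function_pd i tF).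
have -> : \int[L]_x (cut r x * Y i x) =
    \int[L]_x (Y i x * cut r x - (Y i x * pd j F x - Y j x * pd i F x)).
  rewrite (RintB r1 (rintgB r2 r3)) (RintB r2 r3) (curl F tF sF) subrr subr0.
  by apply: eq_Rintegral => x _; rewrite mulrC.
have rG := rintgB r1 (rintgB r2 r3).
apply: le_trans (le_norm_Rint rG) _.
have rHd := rintgB (rH (r + 1)) (rH r).
rewrite -(RintD (rh (r + 1)) rHd) -(RintZ _ (rintgD (rh (r + 1)) rHd)).
apply: (le_ae_Rint (rintg_norm rG) (rintgZ _ (rintgD (rh (r + 1)) rHd))).
apply: filterS2 hE HE => x -> ->; rewrite !pF.
set a := Y i x; set b := Y j x.
have ab0 : 0 <= `|a| + `|b| by rewrite addr_ge0.
have [cx|ncx] := pselect (cube n (r + 1) x); last first.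
  rewrite cut_eq0// !(@pd_cut_eq0 r _ x); try by left.
  rewrite !(mul0r, mulr0) addr0 !mulr0 !subr0 normr0 indicE memNset// !mul0r.
  rewrite [\1_(cube n r) x]indicE memNset ?mul0r ?subr0 ?addr0 ?mulr0//.
  by move=> cx; apply: ncx; apply: sub_cube cx; rewrite lerDl.
rewrite [\1_(cube n (r + 1)) x]indicE mem_set//= !mul1r.
have c0 : 0 <= cut r x by exact: boxf_ge0.
have c1 : cut r x <= 1 by exact: boxf_le1.
have alg (c q dj di cj ci : R) : a * c - (a * (c * dj + q * cj) - b * (c * di + q * ci)) =
    c * (a * (1 - dj) + b * di) + q * (b * ci - a * cj) by ring.
rewrite {}alg.
apply: le_trans (ler_normD _ _) _; rewrite [leRHS]mulrDr lerD//.
  have [Sx|nSx] := pselect (S x).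
    rewrite !pm// eqxx (negPf ij) subrr !mulr0 addr0 mulr0 normr0.
    by rewrite !mulr_ge0// ?indicE ?ler0n// !addr_ge0// mulr_ge0.
  rewrite indicE mem_set//= mul1r normrM (ger0_norm c0).
  apply: (@le_trans _ _ `|a * (1 - pd j m x) + b * pd i m x|); first by rewrite ler_piMl.
  apply: le_trans (ler_normD _ _) _; rewrite !normrM [leRHS]mulrDr lerD// mulrC.
    rewrite ler_wpM2r//; apply: le_trans (ler_normB _ _) _; rewrite normr1.
    by have := dm1 j x; rewrite /C; lra.
  by rewrite ler_wpM2r//; have := dm1 i x; rewrite /C; lra.
have [cr|ncr] := pselect (cube n r x).
  rewrite !(@pd_cut_eq0 r _ x); try by right.
  by rewrite !mulr0 subrr mulr0 normr0 indicE mem_set// mul1r subrr mulr0.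
rewrite [\1_(cube n r) x]indicE memNset// mul0r subr0 normrM.
apply: (@le_trans _ _ `|b * pd i (cut r) x - a * pd j (cut r) x|); first by rewrite ler_piMl.
have gen p q : `|p| <= C -> `|q| <= C -> `|b * p - a * q| <= C * (`|a| + `|b|).
  move=> pC qC; apply: le_trans (ler_normB _ _) _; rewrite !normrM [leRHS]mulrDr addrC.
  by rewrite lerD// mulrC ler_wpM2r.
have dcl l : `|pd l (cut r) x| <= C.
  by apply: le_trans (pd_cut_le r l x dK) _; rewrite /C; lra.
exact: gen.
Qed.

End inclusions.

(** * Measurable versions of stationary realisations *)

Section stationary_realisations.
Import HBNNSimple.
Context {R : realType} {d : nat} {disp : measure_display}
  {Omega : measurableType disp}.
Variables (P : probability Omega R) (T : 'rV[R]_d -> Omega -> Omega).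
Hypothesis TE : ergodic_dynamical_system P T.
Let L := leb R d.
Let mu := (L \x P)%E.

(* [f (T x w)] is only measurable with respect to the completion of [mu]. *)
Definition realisation f (f' : 'rV[R]_d * Omega -> R) :=
  measurable_fun setT f' /\ {ae mu, forall z, f' z = f (T z.1 z.2)}.

Lemma realisation_indic (F : set Omega) : measurable F -> exists f', realisation \1_F f'.
Proof.
move=> mF; have [B mB nB] := shift_jointly_measurable TE mF.
exists \1_B; split; first exact: measurable_indic.
apply: negligibleS nB => z /= h; apply: contrapT => nz; apply: h; rewrite !indicE.
suff -> : (z \in B) = (T z.1 z.2 \in F) by [].
apply/idP/idP; rewrite !inE => zB; apply: contrapT => nzB; apply: nz.
  by right; split.
by left; split.
Qed.

Lemma realisationZ k f f' : realisation f f' -> realisation (fun w => k * f w) (fun z => k * f' z).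
Proof.
move=> [mf ff]; split; first exact: measurable_funM.
by apply: filterS ff => z ->.
Qed.

Lemma realisationD f f' g g' : realisation f f' -> realisation g g' ->
  realisation (fun w => f w + g w) (fun z => f' z + g' z).
Proof.
move=> [mf ff] [mg gg]; split; first exact: measurable_funD.
by apply: filterS2 ff gg => z -> ->.
Qed.

Lemma realisation_cst (c : R) : realisation (fun=> c) (fun=> c).
Proof. by split; [exact: measurable_cst|exact: aeW]. Qed.

Lemma realisation_sum (I : Type) (r : seq I) (F : I -> Omega -> R) :
  (forall i, exists f', realisation (F i) f') ->
  exists f', realisation (fun w => \sum_(i <- r) F i w) f'.
Proof.
move=> h; elim: r => [|i r [g' rg]].
  exists (fun=> 0); under eq_fun do rewrite big_nil.
  exact: realisation_cst.
have [f' rf] := h i; exists (fun z => f' z + g' z).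
by under eq_fun do rewrite big_cons; exact: realisationD.
Qed.

(** The versions converge only off a null set; their upper limit is measurable everywhere and has
    the right values where they converge. *)
Lemma realisation_lim (f_ : nat -> Omega -> R) (f : Omega -> R) : (forall k, exists f', realisation (f_ k) f') ->
  (forall w, f_ k w @[k --> \oo] --> f w) -> exists f', realisation f f'.
Proof.
move=> /choice[F rF] ff.
pose g z := limn_esup (fun k => (F k z)%:E).
have mg : measurable_fun setT g.
  by apply: measurable_fun_limn_esup => k; apply/measurable_EFinP; have [] := rF k.
exists (fine \o g); split; first by apply: measurableT_comp mg; exact: fine_measurable.
have : forall k, {ae mu, forall z, F k z = f_ k (T z.1 z.2)} by move=> k; have [] := rF k.
move/ae_foralln; apply: filterS => z Fz.
have cz : (F k z)%:E @[k --> \oo] --> (f (T z.1 z.2))%:E.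
  by apply: cvg_EFin; [exact: nearW|under eq_fun do rewrite Fz; exact: ff].
rewrite /= /g is_cvg_limn_esupE; last by apply/cvg_ex; eexists; exact: cz.
by rewrite (cvg_lim _ cz).
Qed.

(** From indicators to simple functions to limits; signs are handled by f = (|f| + f) - |f|. *)
Lemma realisation_exists (f : Omega -> R) : measurable_fun setT f -> exists f', realisation f f'.
Proof.
have pos (g : Omega -> R) : measurable_fun setT g -> (forall w, 0 <= g w) -> exists g', realisation g g'.
  move=> mg g0; have mg' : measurable_fun setT (EFin \o g) by exact/measurable_EFinP.
  pose s k : Omega -> R := nnsfun_approx measurableT mg' k.
  have sg w : s k w @[k --> \oo] --> g w.
    have h := @cvg_nnsfun_approx _ _ _ setT measurableT _ mg' (fun w _ => g0 w) w I.
    exact: (fine_cvg h).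
  apply: (realisation_lim _ sg) => k.
  have [N [v E]] : exists N (v : nat -> R), forall w,
      s k w = \sum_(i < N) v i * \1_(s k @^-1` [set v i]) w.
    by eexists; eexists => w; exact: (fimfunEord (nnsfun_approx measurableT mg' k) w).
  pose F i := s k @^-1` [set v i].
  have -> : s k = fun w => \sum_(i < N) (v i * \1_(F i) w) by exact/funext.
  apply: realisation_sum => i.
  have mF : measurable (F i).
    rewrite -[X in measurable X]setTI; exact: measurable_funPT.
  have [f' rf] := realisation_indic mF.
  by eexists; exact: realisationZ rf.
move=> mf.
have ma : measurable_fun setT (fun w => `|f w|) by exact: measurableT_comp.
have [h1 r1] := pos (fun w => `|f w|) ma (fun w => normr_ge0 _).
have s0 w : 0 <= `|f w| + f w by have := ler_norm (- f w); rewrite normrN; lra.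
have [h2 r2] := pos (fun w => `|f w| + f w) (measurable_funD ma mf) s0.
exists (fun z => h2 z + (-1) * h1 z).
rewrite (_ : f = fun w => (`|f w| + f w) + (-1) * `|f w|).
  by apply: realisationD => //; exact: realisationZ.
by apply/funext => w; ring.
Qed.

Lemma Rint_shift x (f : Omega -> R) : rintg P f -> \int[P]_w f (T x w) = \int[P]_w f w.
Proof.
move=> rf; have mf := rintg_measurable rf.
have pos g : rintg P g -> (forall w, 0 <= g w) -> \int[P]_w g (T x w) = \int[P]_w g w.
  move=> rg g0; rewrite /Rintegral; congr fine.
  rewrite (ge0_integral_shift TE x (f := EFin \o g))//.
  by apply/measurable_EFinP; exact: rintg_measurable rg.
have shift_rintg g : rintg P g -> rintg P (fun w => g (T x w)).
  move=> /rintgP[mg go]; apply/rintgP; split; first exact: (measurable_shift TE).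
  rewrite (ge0_integral_shift TE x (f := fun w => `|g w|%:E))//.
  by apply/measurable_EFinP; exact: measurableT_comp.
have rn := rintg_norm rf; have rs := rintgD rn rf.
have s0 w : 0 <= `|f w| + f w by have := ler_norm (- f w); rewrite normrN; lra.
transitivity (\int[P]_w ((`|f (T x w)| + f (T x w)) - `|f (T x w)|)).
  by apply: eq_Rintegral => w _; ring.
rewrite (RintB (shift_rintg _ rs) (shift_rintg _ rn)).
rewrite (pos _ rs s0) (pos _ rn (fun w => normr_ge0 _)) RintD//.
by ring.
Qed.

Lemma realisation_ae_slice f f' : realisation f f' ->
  {ae L, forall x, {ae P, forall w, f' (x, w) = f (T x w)}}.
Proof. by case=> _ /ae_prodl. Qed.

Lemma stationary_rintg (phi : 'rV[R]_d -> R) f f' : realisation f f' -> rintg L phi ->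
  rintg P f -> rintg mu (fun z => phi z.1 * f' z).
Proof.
move=> rff rphi rf; have [mf' _] := rff; have mphi := rintg_measurable rphi.
have mpf : measurable_fun setT (fun z : 'rV[R]_d * Omega => phi z.1 * f' z).
  by apply: measurable_funM => //; exact: measurable_fst_fun.
apply/rintgP; split => //.
have mn : measurable_fun setT (fun z : 'rV[R]_d * Omega => `|phi z.1 * f' z|%:E).
  by apply/measurable_EFinP; exact: measurableT_comp.
rewrite (fubini_tonelli1 _ mn)//.
have /rintgP[mf fo] := rf.
have inner x : {ae P, forall w, f' (x, w) = f (T x w)} ->
    fubini_F P (fun z : 'rV[R]_d * Omega => `|phi z.1 * f' z|%:E) x =
    (`|phi x|%:E * \int[P]_w `|f w|%:E)%E.
  move=> ae_x; rewrite /fubini_F /=.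
  transitivity (\int[P]_w (`|phi x|%:E * `|f (T x w)|%:E))%E.
    apply: ae_eq_integral => //.
    - by apply/measurable_EFinP; exact: measurableT_comp (measurable_pair1 x mpf).
    - apply/measurable_EFinP; apply: measurable_funM => //; apply: measurableT_comp => //.
      exact: (measurable_shift TE).
    - by apply: filterS ae_x => w -> _ /=; rewrite normrM.
  rewrite ge0_integralZl//; last first.
    by apply/measurable_EFinP; apply: measurableT_comp => //; exact: (measurable_shift TE).
  congr (_ * _)%E; rewrite (ge0_integral_shift TE x (f := fun w => `|f w|%:E))//.
  by apply/measurable_EFinP; exact: measurableT_comp.
rewrite (_ : (\int[_]_x _)%E = \int[L]_x (`|phi x|%:E * \int[P]_w `|f w|%:E))%E; last first.
  apply: ae_eq_integral => //.
  - exact: measurable_fun_fubini_tonelli_F.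
  - by apply: emeasurable_funM => //; apply/measurable_EFinP; exact: measurableT_comp.
  - by apply: filterS (realisation_ae_slice rff) => x h _; exact: inner.
rewrite ge0_integralZr//; [|by apply/measurable_EFinP; exact: measurableT_comp|exact: integral_ge0].
have /rintgP[_ po] := rphi.
by rewrite lte_mul_pinfty ?integral_ge0// ge0_fin_numE ?integral_ge0.
Qed.

(** For almost every x the slice is f(T_x w), whose mean over w does not depend on x. With phi the
    indicator of a cube this is volume times expectation, exactly and at every scale. *)
Lemma stationary_Rint (phi : 'rV[R]_d -> R) f f' : realisation f f' -> rintg L phi ->
  rintg P f -> \int[mu]_z (phi z.1 * f' z) = \int[L]_x phi x * \int[P]_w f w.
Proof.
move=> rff rphi rf; have rm := stationary_rintg rff rphi rf.
rewrite (Rint_fubini1 rm) [RHS]mulrC -RintZ//; apply: ae_eq_Rintegral.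
- exact: rintg_measurable (rintg_fubini1 rm).
- exact: rintg_measurable (rintgZ _ rphi).
have [mf' _] := rff.
apply: filterS (realisation_ae_slice rff) => x h /=.
transitivity (\int[P]_w (phi x * f (T x w))).
  apply: ae_eq_Rintegral.
  - by apply: measurable_funM => //; exact: measurable_pair1.
  - by apply: measurable_funM => //; exact: (measurable_shift TE) (rintg_measurable rf).
  - by apply: filterS h => w ->.
rewrite RintZ; last first.
  have /rintgP[mf fo] := rf.
  apply/rintgP; split; first exact: (measurable_shift TE).
  rewrite (ge0_integral_shift TE x (f := fun w => `|f w|%:E))//.
  by apply/measurable_EFinP; exact: measurableT_comp.
by rewrite Rint_shift// mulrC.
Qed.

End stationary_realisations.

(** * Local integrability and the weak curl identity *)

Section local_integrability.
Context {R : realType} {n : nat}.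
Let L := leb R n.

Lemma measurable_eball (r : R) : measurable (eball (0 : 'rV[R]_n) r).
Proof.
have m : measurable_fun setT (fun y : 'rV[R]_n => enorm (y - 0)).
  rewrite (_ : (fun _ => _) = Num.sqrt \o (fun y : 'rV[R]_n => \sum_l y 0 l ^+ 2)).
    apply: measurableT_comp; first exact: continuous_measurable_fun (@sqrt_continuous R).
    by apply: measurable_sum => l; apply: measurable_funX; exact: measurable_coord.
  by apply/funext => y; rewrite subr0 /enorm dotv_sqr.
rewrite (_ : eball _ _ = setT `&` (fun y : 'rV[R]_n => enorm (y - 0)) @^-1` `]-oo, r[%classic).
  by apply: m => //; exact: measurable_itv.
by rewrite setTI; apply/seteqP; split => y /=; rewrite in_itv.
Qed.

Lemma cube_eball (r : R) : 0 < r -> (0 < n)%N -> cube n r `<=` eball 0 (n%:R * r).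
Proof.
move=> r0 n0 y cy; rewrite /eball /= subr0; apply: le_lt_trans (enorm_le_sum _) _.
rewrite -[n in n%:R]card_ord mulr_natl -sumr_const; apply: ltr_sum.
  by apply/hasP; exists (Ordinal n0) => //; exact: mem_index_enum.
by move=> l _; rewrite ltr_norml; exact: cy.
Qed.

Lemma L2loc_L2 (u : 'rV[R]_n -> R) (r : R) : (0 < n)%N -> L2loc u ->
  (fun x => \1_(cube n r) x * u x) \in Lfun L 2%:E.
Proof.
move=> n0 [mu uo].
have mi (s : R) : measurable_fun setT (\1_(cube n s) : _ -> R) by apply: measurable_indic; exact: measurable_box.
apply: (@le_L2 _ _ _ L _ (fun x => \1_(cube n (`|r| + 1)) x * u x)); first exact: measurable_funM.
  apply/L2P; split; first exact: measurable_funM.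
  apply: le_lt_trans (uo (n%:R * (`|r| + 1))).
  rewrite [leRHS]integral_mkcond; apply: ge0_le_integral => //.
  - by move=> x _; rewrite lee_fin sqr_ge0.
  - by apply: measurable_sq; exact: measurable_funM.
  - apply/(measurable_restrictT _ _).1; first exact: measurable_eball.
    exact/measurable_funTS/measurable_sq.
  - move=> x _; rewrite patchE indicE.
    have [h|h] := pselect (cube n (`|r| + 1) x).
      have h' : eball 0 (n%:R * (`|r| + 1)) x by apply: cube_eball h => //; rewrite ltr_wpDl.
      by rewrite mem_set// mem_set// mul1r.
    rewrite memNset// mul0r expr0n/=; case: ifP => _ //.
    by rewrite lee_fin sqr_ge0.
move=> x; rewrite !normrM ler_wpM2r// !indicE.
have [h|h] := pselect (cube n r x); last by rewrite memNset// normr0.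
rewrite !mem_set//; apply: sub_cube h.
by have := ler_norm r; lra.
Qed.

Lemma L2loc_rintg (u : 'rV[R]_n -> R) (r : R) : (0 < n)%N -> L2loc u ->
  rintg L (fun x => \1_(cube n r) x * u x).
Proof.
move=> n0 uL.
have L1 : (\1_(cube n r) : _ -> R) \in Lfun L 2%:E.
  have : @L2loc R n (fun=> 1).
    split; first exact: measurable_cst.
    move=> s; have /rintgP[_] := rintg_indic_cube (R := R) (n := n) (`|s| + 1).
    apply: le_lt_trans; rewrite [leLHS]integral_mkcond; apply: ge0_le_integral => //.
    - by move=> x _; rewrite patchE; case: ifP => _ //; rewrite lee_fin expr1n.
    - apply/(measurable_restrictT _ _).1; first exact: measurable_eball.
      exact: measurable_cst.
    - apply/measurable_EFinP; apply: measurableT_comp => //; apply: measurable_indic.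
      exact: measurable_box.
    - move=> x _; rewrite patchE; case: ifPn => [|_]; last by rewrite lee_fin.
      rewrite inE => ex; rewrite lee_fin expr1n indicE mem_set ?normr1//.
      move=> l; rewrite -ltr_norml; apply: le_lt_trans (normr_coord_enorm _ _) _.
      move: ex; rewrite /eball /= subr0 => ex; apply: lt_le_trans ex _.
      by have := ler_norm s; lra.
  by move/(L2loc_L2 r n0); under eq_fun do rewrite mulr1.
have := L2_mul_integrable L1 (L2loc_L2 r n0 uL).
congr (rintg _ _); apply/funext => x; rewrite mulrA indicE.
by case: (_ \in _); rewrite ?mul1r ?mul0r.
Qed.

Lemma W12loc_curl_free u (g : 'rV[R]_n -> 'rV[R]_n) (xi : 'rV[R]_n) i j F : W12loc u g ->
  test_function F -> smooth_sym F ->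
  \int[L]_x ((xi 0 i + g x 0 i) * pd j F x) = \int[L]_x ((xi 0 j + g x 0 j) * pd i F x).
Proof.
move=> [uL gL wg] tF [_ symF].
have n0 : (0 < n)%N by apply: leq_ltn_trans (ltn_ord i).
have rg k l : rintg L (fun x => g x 0 k * pd l F x).
  have tp := test_function_pd l tF.
  have [M [s [M0 s0 fM]]] := test_function_bounded tp.
  by apply: (rintg_loc M0 _ _ fM); [move=> r; exact: L2loc_rintg|exact: test_function_measurable].
have E k l : \int[L]_x ((xi 0 k + g x 0 k) * pd l F x) = - \int[L]_x (u x * pd k (pd l F) x).
  have tp := test_function_pd l tF.
  have rt := test_function_rintg tp.
  under eq_Rintegral do rewrite mulrDl.
  rewrite (RintD (rintgZ _ rt) (rg k l)) (RintZ _ rt) (Rint_pd_eq0 l tF) mulr0 add0r.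
  by rewrite (wg _ tp k) opprK.
by rewrite !E symF.
Qed.

Lemma rintg_loc_ae (h Yi Yj : 'rV[R]_n -> R) (A : set 'rV[R]_n) (r : R) : measurable_fun setT h ->
  {ae L, forall x, h x = \1_A x * (`|Yi x| + `|Yj x|)} ->
  rintg L (fun x => \1_(cube n r) x * Yi x) -> rintg L (fun x => \1_(cube n r) x * Yj x) ->
  rintg L (fun x => \1_(cube n r) x * h x).
Proof.
move=> mh hE ri rj.
have mi : measurable_fun setT (\1_(cube n r) : _ -> R) by apply: measurable_indic; exact: measurable_box.
have rs := rintgD (rintg_norm ri) (rintg_norm rj).
(* A is an arbitrary set, so the right-hand side of the hypothesis need not be measurable. The
   minimum is measurable, dominated everywhere, and equal to the target almost everywhere. *)
pose k x := Num.min `|\1_(cube n r) x * h x| (`|\1_(cube n r) x * Yi x| + `|\1_(cube n r) x * Yj x|).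
have mk : measurable_fun setT k.
  apply: measurable_minr; last exact: rintg_measurable rs.
  by apply: measurableT_comp => //; exact: measurable_funM.
have rk : rintg L k.
  apply: le_rintg mk _ rs => x.
  have b0 : 0 <= `|\1_(cube n r) x * Yi x| + `|\1_(cube n r) x * Yj x| by rewrite addr_ge0.
  by rewrite [leRHS]ger0_norm// ger0_norm ?ge_min ?lexx ?orbT// le_min normr_ge0.
apply: ae_eq_rintg rk; first exact: measurable_funM.
apply: filterS hE => x E; rewrite /k E; set c := \1_(cube n r) x; set a := \1_A x.
have c01 : c = 0 \/ c = 1 by rewrite /c indicE; case: (_ \in _); [right|left].
have a01 : a = 0 \/ a = 1 by rewrite /a indicE; case: (_ \in _); [right|left].
have s0 : 0 <= `|Yi x| + `|Yj x| by rewrite addr_ge0.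
case: c01 => ->; rewrite ?mul0r ?normr0 ?addr0 ?minxx ?mul1r//.
case: a01 => ->; first by rewrite mul0r normr0 min_l.
by rewrite mul1r ger0_norm ?minxx.
Qed.

End local_integrability.

(** * A lower bound for potential fields outside the inclusions *)

Section nondegeneracy.
Context {R : realType} {d : nat} {disp : measure_display}
  {Omega : measurableType disp}.
Variables (P : probability Omega R) (T : 'rV[R]_d -> Omega -> Omega) (O : set Omega).
Hypothesis TE : ergodic_dynamical_system P T.
Let L := leb R d.
Let mu := (L \x P)%E.

Lemma Rint_indic_cube (r : R) : 0 <= r -> \int[L]_x (\1_(cube d r) x : R) = (r *+ 2) ^+ d.
Proof.
move=> r0; rewrite /Rintegral integral_indic ?setIT//; last exact: measurable_box.
exact: (congr1 fine (leb_cube d r0)).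
Qed.

Lemma L2_rintg (f : Omega -> R) : f \in Lfun P 2%:E -> rintg P f.
Proof.
move=> fL; have L1 : (fun=> 1 : R) \in Lfun P 2%:E by exact: Lfun_cst.
by have := L2_mul_integrable fL L1; under eq_fun do rewrite mulr1.
Qed.

(** After division by the volume (2 k)^d the factor of a tends to 1, and that of b, the relative
    volume of the shell, to 0. *)
Lemma cube_ratio_limit (x a b : R) :
  (forall k : nat, (0 < k)%N -> (k%:R *+ 2) ^+ d * x <=
     ((k%:R + 1) *+ 2) ^+ d * a + (((k%:R + 1) *+ 2) ^+ d - (k%:R *+ 2) ^+ d) * b) -> x <= a.
Proof.
move=> h; pose q (k : nat) : R := (1 + k.+1%:R^-1) ^+ d.
have q1 : q k @[k --> \oo] --> (1 : R).
  have h1 : 1 + k.+1%:R^-1 @[k --> \oo] --> (1 + 0 : R).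
    by apply: cvgD; [exact: cvg_cst|exact: cvg_harmonic].
  have h2 := @exprn_continuous R d (1 + 0); rewrite /continuous_at addr0 expr1n in h2.
  by rewrite addr0 in h1; exact: (@cvg_comp _ _ _ (fun k => 1 + k.+1%:R^-1) (fun x => x ^+ d) _ _ _ h1 h2).
have c1 : q k * a + (q k - 1) * b @[k --> \oo] --> 1 * a + (1 - 1) * b.
  apply: cvgD; first by apply: cvgM q1 (cvg_cst _).
  by apply: cvgM (cvgB q1 (cvg_cst _)) (cvg_cst _).
rewrite -[leRHS]addr0 -[in leRHS](mul0r b) -[in leRHS](mul1r a) -[X in X * b](subrr 1).
rewrite -(cvg_lim _ c1)//; apply: limr_ge; first by apply/cvg_ex; eexists; exact: c1.
apply: nearW => k; have := h k.+1 isT.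
have k0 : 0 < (k.+1%:R *+ 2) ^+ d :> R by rewrite exprn_gt0// pmulrn_lgt0// ltr0n.
have -> : ((k.+1%:R + 1) *+ 2) ^+ d = (k.+1%:R *+ 2) ^+ d * q k :> R.
  have E (t : R) : t != 0 -> (t + 1) *+ 2 = t *+ 2 * (1 + t^-1) by move=> t0; field.
  by rewrite -exprMn (E k.+1%:R) ?pnatr_eq0.
move=> hk; rewrite -(ler_pM2l k0); apply: le_trans hk _.
rewrite le_eqVlt; apply/orP; left; apply/eqP; ring.
Qed.

(** The pathwise estimate [corrector_bound] is integrated over Omega; [stationary_Rint] turns its
    terms into volumes times expectations, and the shell disappears as the cube grows. On the left
    the mean of xi + p is xi, since p has mean zero. *)
Lemma potential_field_bound (r0 : R) i j : 0 < r0 -> i != j -> measurable O ->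
  {ae P, forall w, separated_inclusions r0 (realised_set T O w)} ->
  exists2 C, 0 <= C & forall (xi : 'rV[R]_d) p, Vpot P T p ->
    `|xi 0 i| <= C * \int[P]_w (\1_(~` O) w * (`|xi 0 i + p w 0 i| + `|xi 0 j + p w 0 j|)).
Proof.
move=> r00 ij mO sepO; have [C C0 CP] := @corrector_bound R d r0 r00; exists C => // xi p [[pL pot] p0].
pose y l w := xi 0 l + p w 0 l.
have ry l : rintg P (y l).
  apply: rintgD; [exact: finite_measure_integrable_cst|exact: L2_rintg].
have my l := rintg_measurable (ry l).
pose H w := `|y i w| + `|y j w|; pose h w := \1_(~` O) w * H w.
have rH : rintg P H by apply: rintgD; exact: rintg_norm.
have mO' : measurable_fun setT (\1_(~` O) : Omega -> R) by apply: measurable_indic; exact: measurableC.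
have rh : rintg P h.
  rewrite /h; under eq_fun do rewrite mulrC.
  by apply: (@rintg_bounded _ _ _ _ 1) => // w; exact: normr_indic_le1.
have [yi' ryi] := realisation_exists TE (my i).
have [h' rh'] := realisation_exists TE (rintg_measurable rh).
have [H' rH'] := realisation_exists TE (rintg_measurable rH).
have slice (f : Omega -> R) f' : realisation P T f f' ->
    {ae P, forall w, measurable_fun setT (fun x => f' (x, w)) /\ {ae L, forall x, f' (x, w) = f (T x w)}}.
  move=> [mf /ae_prodr]; apply: filterS => w hw; split => //; exact: measurable_pair2.
have Ey : \int[P]_w y i w = xi 0 i.
  rewrite RintD; [|exact: finite_measure_integrable_cst|exact: L2_rintg].
  by rewrite p0 addr0 Rintegral_cst//= probability_setT mulr1.
have d0 : (0 < d)%N by apply: leq_ltn_trans (ltn_ord i).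
have main (k : nat) : (0 < k)%N -> {ae P, forall w,
   `|\int[L]_x (cut k%:R x * yi' (x, w))| <=
   C * (\int[L]_x (\1_(cube d (k%:R + 1)) x * h' (x, w)) +
        \int[L]_x (\1_(cube d (k%:R + 1)) x * H' (x, w) - \1_(cube d k%:R) x * H' (x, w)))}.
  move=> k0; apply: filterS3 (filterI sepO pot) (slice _ _ ryi) (filterI (slice _ _ rh') (slice _ _ rH')).
  move=> w [sepw [u [g [ug pg]]]] [myw yw] [[mhw hw] [mHw Hw]].
  pose Y l x := xi 0 l + g x 0 l.
  have yE l : {ae L, forall x, y l (T x w) = Y l x} by apply: filterS pg => x; rewrite /y => ->.
  have [_ gL _] := ug.
  have mY l : measurable_fun setT (Y l).
    by apply: measurable_funD => //; have [] := gL l.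
  have rY l r : rintg L (fun x => \1_(cube d r) x * Y l x).
    under eq_fun do rewrite mulrDr; apply: rintgD; last exact: L2loc_rintg.
    by under eq_fun do rewrite mulrC; apply: rintgZ; exact: rintg_indic_cube.
  have hE : {ae L, forall x, h' (x, w) = \1_(~` (realised_set T O w)) x * (`|Y i x| + `|Y j x|)}.
    apply: filterS3 hw (yE i) (yE j) => x -> <- <-; rewrite /h /H; congr (_ * _).
  have HE : {ae L, forall x, H' (x, w) = `|Y i x| + `|Y j x|}.
    by apply: filterS3 Hw (yE i) (yE j) => x -> <- <-.
  have HE1 : {ae L, forall x, H' (x, w) = \1_setT x * (`|Y i x| + `|Y j x|)}.
    by apply: filterS HE => x ->; rewrite indicT mul1r.
  have -> : \int[L]_x (cut k%:R x * yi' (x, w)) = \int[L]_x (cut k%:R x * Y i x).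
    have mc : measurable_fun setT (@cut R d k%:R) by apply: test_function_measurable; exact: boxf_test.
    apply: ae_eq_Rintegral; [exact: measurable_funM|exact: measurable_funM|].
    by apply: filterS2 yw (yE i) => x -> ->.
  have k0' : 0 < k%:R :> R by rewrite ltr0n.
  have curl F : test_function F -> smooth_sym F ->
      \int[L]_x (Y i x * pd j F x) = \int[L]_x (Y j x * pd i F x).
    by move=> tF sF; exact: W12loc_curl_free ug tF sF.
  have rhw r := rintg_loc_ae mhw hE (rY i r) (rY j r).
  have rHw r := rintg_loc_ae mHw HE1 (rY i r) (rY j r).
  exact: (CP (realised_set T O w) i j Y (fun x => h' (x, w)) (fun x => H' (x, w)) k%:R
            ij sepw k0' curl rY rhw rHw hE HE).
rewrite -[X in _ <= C * X]/(\int[P]_w h w).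
apply: (@cube_ratio_limit _ _ (C * \int[P]_w H w)) => k k0.
have k0' : 0 < k%:R :> R by rewrite ltr0n.
have rc := rintg_indic_cube (R := R) (n := d).
have tc : test_function (@cut R d k%:R) by exact: boxf_test.
have rcut := test_function_rintg tc.
have ri := stationary_rintg TE ryi rcut (ry i).
have rhm s := stationary_rintg TE rh' (rc s) rh.
have rHm s := stationary_rintg TE rH' (rc s) rH.
have /(le_trans (le_norm_Rint (rintg_fubini2 ri))) : \int[P]_w `|\int[L]_x (cut k%:R x * yi' (x, w))| <=
    \int[P]_w (C * (\int[L]_x (\1_(cube d (k%:R + 1)) x * h' (x, w)) +
        \int[L]_x (\1_(cube d (k%:R + 1)) x * H' (x, w) - \1_(cube d k%:R) x * H' (x, w)))).
  apply: le_ae_Rint; last exact: main.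
  - exact: rintg_norm (rintg_fubini2 ri).
  - apply: rintgZ; apply: rintgD; first exact: rintg_fubini2 (rhm _).
    exact: rintg_fubini2 (rintgB (rHm _) (rHm _)).
rewrite -(Rint_fubini2 ri) (stationary_Rint TE ryi rcut (ry i)) Ey.
rewrite RintZ; last first.
  by apply: rintgD; [exact: rintg_fubini2 (rhm _)|exact: rintg_fubini2 (rintgB (rHm _) (rHm _))].
rewrite RintD; [|exact: rintg_fubini2 (rhm _)|exact: rintg_fubini2 (rintgB (rHm _) (rHm _))].
rewrite -(Rint_fubini2 (rhm _)) -(Rint_fubini2 (rintgB (rHm _) (rHm _))).
rewrite RintB// !(stationary_Rint TE rh' (rc _) rh) !(stationary_Rint TE rH' (rc _) rH).
have k1 : 0 <= k%:R + 1 :> R by rewrite addr_ge0.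
rewrite (Rint_indic_cube (ltW k0')) (Rint_indic_cube k1) => hk.
(* The cutoff equals 1 on the smaller cube, so the left-hand side keeps at least its volume. *)
have cutge : (k%:R *+ 2) ^+ d <= \int[L]_x (cut k%:R x : R).
  rewrite -(Rint_indic_cube (ltW k0')); apply: le_Rint => // x; rewrite indicE.
  have [h1|h1] := pselect (cube d k%:R x); first by rewrite mem_set// cut_eq1.
  by rewrite memNset// boxf_ge0.
apply: (@le_trans _ _ `|\int[L]_x (cut k%:R x : R) * xi 0 i|).
  rewrite normrM ler_wpM2r// (le_trans cutge)// ler_norm//.
apply: le_trans hk _.
by rewrite le_eqVlt; apply/orP; left; apply/eqP; ring.
Qed.

End nondegeneracy.

(** * Coordinate bounds for positive definite matrices *)

Section positive_definite.
Context {R : realType} {d : nat}.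

Lemma posdef_unit (A : 'M[R]_d) : (forall xi : 'rV[R]_d, xi != 0 -> 0 < mxform A xi xi) ->
  A \in unitmx.
Proof.
move=> Apos; rewrite -unitmx_tr -row_free_unit -kermx_eq0; apply/eqP/row_matrixP => i.
rewrite row0; apply/eqP; apply: contrapT => /negP v0.
have := Apos _ v0; rewrite /mxform /dotv -row_mul mulmx_ker row0 mul0mx mxE.
by rewrite ltxx.
Qed.

Lemma mxformBl (A : 'M[R]_d) (x y z : 'rV[R]_d) : mxform A (x - y) z = mxform A x z - mxform A y z.
Proof. by rewrite /mxform /dotv mulmxBl mulmxBl !mxE. Qed.

Lemma mxformBr (A : 'M[R]_d) (x y z : 'rV[R]_d) : mxform A z (x - y) = mxform A z x - mxform A z y.
Proof. by rewrite /mxform /dotv linearB /= mulmxBr !mxE. Qed.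

(** If A z = e_l, then y_l is the A-inner product of z and y, and the Cauchy-Schwarz inequality for
    A gives the constant 1 / (A z . z). *)
Lemma posdef_coord (A : 'M[R]_d) : A^T = A ->
  (forall xi : 'rV[R]_d, xi != 0 -> 0 < mxform A xi xi) ->
  forall l : 'I_d, exists2 c : R, 0 < c & forall y : 'rV[R]_d, c * y 0 l ^+ 2 <= mxform A y y.
Proof.
move=> sA Apos l.
pose z : 'rV[R]_d := basisv l *m invmx A.
have zA : z *m A^T = basisv l by rewrite sA mulmxKV// posdef_unit.
have zy (y : 'rV[R]_d) : mxform A z y = y 0 l.
  rewrite /mxform zA dotvE (bigD1 l)//= big1 ?addr0 ?mxE ?eqxx ?mul1r//.
  by move=> k kl; rewrite mxE eqxx (negPf kl) mul0r.
have z0 : z != 0.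
  apply/negP => /eqP z0; have := zA; rewrite z0 mul0mx => /rowP/(_ l)/eqP.
  by rewrite !mxE !eqxx eq_sym oner_eq0.
have q0 := Apos _ z0; set q := mxform A z z in q0.
have nneg (y : 'rV[R]_d) : 0 <= mxform A y y.
  have [->|y0] := eqVneq y 0; last exact: ltW (Apos _ y0).
  by rewrite /mxform mul0mx /dotv mul0mx mxE.
exists q^-1; first by rewrite invr_gt0.
move=> y; have := nneg (y - (y 0 l / q) *: z).
rewrite mxformBl !mxformBr.
have -> : mxform A y ((y 0 l / q) *: z) = (y 0 l / q) * y 0 l.
  by rewrite -{1}[y]scale1r mxformZ mul1r mxform_sym// zy.
have -> : mxform A ((y 0 l / q) *: z) y = (y 0 l / q) * y 0 l.
  by rewrite -{2}[y]scale1r mxformZ mulr1 zy.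
rewrite mxformZ -/q.
have -> : y 0 l / q * (y 0 l / q) * q = y 0 l / q * y 0 l by field; rewrite gt_eqF.
rewrite subrr subr0 subr_ge0; apply: le_trans.
by rewrite expr2 mulrA [q^-1 * _]mulrC.
Qed.

End positive_definite.

(** * Positivity of the homogenised matrix, coordinate by coordinate *)

Section homogenised_matrix.
Context {R : realType} {d : nat} {disp : measure_display}
  {Omega : measurableType disp}.
Variables (P : probability Omega R) (T : 'rV[R]_d -> Omega -> Omega) (O : set Omega).
Hypothesis TE : ergodic_dynamical_system P T.

Lemma Vpot0 : Vpot P T (fun=> 0).
Proof.
have l20 : @L2loc R d (fun=> 0).
  split; first exact: measurable_cst.
  move=> r; rewrite (_ : (\int[_]_(x in _) _)%E = 0%E) ?ltry//.
  by apply: integral0_eq => x _; rewrite expr0n.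
split.
  split; first by move=> j; under eq_fun do rewrite mxE; exact: L20.
  apply: aeW => w; exists (fun=> 0), (fun=> 0); split; last exact: aeW.
  split => //; first by move=> j; under eq_fun do rewrite mxE.
  move=> f tf j; under eq_Rintegral do rewrite mul0r.
  under [in RHS]eq_Rintegral do rewrite mxE mul0r.
  by rewrite Rint0 oppr0.
by move=> j; under eq_Rintegral do rewrite mxE; rewrite Rint0.
Qed.

Lemma Rint_mkcond (A : set Omega) (f : Omega -> R) :
  \int[P]_(w in A) f w = \int[P]_w (\1_A w * f w).
Proof.
rewrite /Rintegral integral_mkcond; congr fine; apply: eq_integral => w _.
by rewrite patchE indicE; case: ifP; rewrite ?mul1r ?mul0r.
Qed.

(** [potential_field_bound] controls |xi_i| by a mean over the complement of O; Cauchy-Schwarz on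
    Omega squares it, and [posdef_coord] for A1 compares the squares with the energy density. The
    constants do not depend on p, so the bound passes to the infimum. *)
Lemma hom_matrix_coord (A1 A1hom : 'M[R]_d) (r0 : R) : (1 < d)%N -> 0 < r0 -> measurable O ->
  {ae P, forall w, separated_inclusions r0 (realised_set T O w)} ->
  A1^T = A1 -> (forall xi : 'rV[R]_d, xi != 0 -> 0 < mxform A1 xi xi) ->
  hom_matrix P T O A1 A1hom ->
  forall i : 'I_d, exists2 c : R, 0 < c &
    forall xi : 'rV[R]_d, c * xi 0 i ^+ 2 <= mxform A1hom xi xi.
Proof.
move=> d1 r00 mO sepO sA Apos [_ homE] i.
(* The curl identity needs a second direction, which exists as d >= 2. *)
have [j ij] : exists j : 'I_d, i != j.
  have [i0|i0] := eqVneq (val i) 0%N.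
    by exists (Ordinal d1); apply/negP => /eqP/(congr1 val)/=; rewrite i0.
  exists (Ordinal (ltnW d1)); by apply: contra i0 => /eqP/(congr1 val)/= ->.
have [C C0 CP] := potential_field_bound TE r00 ij mO sepO.
have [ci ci0 cA] := posdef_coord sA Apos i.
have [cj cj0 cB] := posdef_coord sA Apos j.
(* From (|a| + |b|)^2 <= 2 (a^2 + b^2) and the bounds of a^2 and b^2 by the energy density. *)
pose K := 2 * (ci^-1 + cj^-1).
have K0 : 0 < K by rewrite mulr_gt0// addr_gt0 ?invr_gt0.
have D0 : 0 < C ^+ 2 * K + 1 by rewrite ltr_wpDl// mulr_ge0 ?sqr_ge0// ltW.
(* The summand 1 keeps the denominator positive when C = 0. *)
exists (C ^+ 2 * K + 1)^-1; first by rewrite invr_gt0.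
move=> xi; rewrite homE; apply: lb_le_inf.
  by eexists; exists (fun=> 0) => //; exact: Vpot0.
move=> _ [p Vp <-]; have := CP xi p Vp.
have [[pL _] _] := Vp.
rewrite (Rint_mkcond (~` O)).
pose h w := \1_(~` O) w * (`|xi 0 i + p w 0 i| + `|xi 0 j + p w 0 j|).
have yL l : (fun w => (xi + p w) 0 l) \in Lfun P 2%:E.
  by under eq_fun do rewrite mxE; apply: L2D => //; exact: Lfun_cst.
have m1 : measurable_fun setT (\1_(~` O) : Omega -> R) by apply: measurable_indic; exact: measurableC.
have hL : h \in Lfun P 2%:E.
  have nL l : (fun w => `|xi 0 l + p w 0 l|) \in Lfun P 2%:E.
    apply: (@le_L2 _ _ _ P _ _ _ (yL l)) => [|w]; last by rewrite normr_id mxE.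
    by apply: measurableT_comp => //; have := L2_measurable (yL l); under eq_fun do rewrite mxE.
  apply: (@le_L2 _ _ _ P _ _ _ (L2D (nL i) (nL j))).
    by apply: measurable_funM => //; exact: L2_measurable (L2D (nL i) (nL j)).
  by move=> w; rewrite normrM ler_piMl// normr_indic_le1.
have rf : rintg P (fun w => mxform A1 (xi + p w) (xi + p w)) by exact: mxform_rintg.
have rE : rintg P (fun w => \1_(~` O) w * mxform A1 (xi + p w) (xi + p w)).
  under eq_fun do rewrite mulrC.
  by apply: (@rintg_bounded _ _ _ _ 1) => // w; exact: normr_indic_le1.
set E := \int[P]_w (\1_(~` O) w * _).
rewrite -[X in _ <= C * X -> _]/(\int[P]_w h w) => hC.
have h2 : (\int[P]_w h w) ^+ 2 <= K * E.
  have L1 : (fun=> 1 : R) \in Lfun P 2%:E by exact: Lfun_cst.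
  have := L2_cauchy_schwarz hL L1.
  under eq_Rintegral do rewrite mulr1.
  under [X in _ <= _ * X -> _]eq_Rintegral do rewrite expr1n.
  rewrite Rintegral_cst//= probability_setT !mulr1 => h1; apply: le_trans h1 _.
  rewrite -RintZ//; apply: le_Rint; [exact: L2_sqr_integrable|exact: rintgZ|].
  move=> w; rewrite /h; set a := xi 0 i + p w 0 i; set b := xi 0 j + p w 0 j.
  have qa : a ^+ 2 <= ci^-1 * mxform A1 (xi + p w) (xi + p w).
    by rewrite ler_pdivlMl//; have := cA (xi + p w); rewrite mxE.
  have qb : b ^+ 2 <= cj^-1 * mxform A1 (xi + p w) (xi + p w).
    by rewrite ler_pdivlMl//; have := cB (xi + p w); rewrite mxE.
  have -> : (\1_(~` O) w * (`|a| + `|b|)) ^+ 2 = \1_(~` O) w * (`|a| + `|b|) ^+ 2 :> R.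
    by rewrite exprMn indicE; case: (_ \in _); rewrite ?expr1n ?expr0n.
  rewrite [leRHS]mulrCA ler_wpM2l// ?indicE ?ler0n//.
  have : (`|a| + `|b|) ^+ 2 <= 2 * (a ^+ 2 + b ^+ 2).
    rewrite -(real_normK (num_real a)) -(real_normK (num_real b)).
    by have := sqr_ge0 (`|a| - `|b|); nra.
  by rewrite /K; move: (mxform _ _ _) qa qb => M; lra.
rewrite ler_pdivrMl//.
have xi2 : xi 0 i ^+ 2 <= C ^+ 2 * (K * E).
  rewrite -real_normK ?num_real//; apply: (@le_trans _ _ ((C * \int[P]_w h w) ^+ 2)).
    by rewrite ler_sqr ?nnegrE ?(le_trans _ hC).
  by rewrite exprMn ler_wpM2l// sqr_ge0.
have E0 : 0 <= E.
  have := le_trans (sqr_ge0 _) h2; by rewrite pmulr_rge0.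
by apply: le_trans xi2 _; rewrite mulrA mulrDl mul1r lerDl.
Qed.

End homogenised_matrix.

(** * Separated inclusions on the line *)

Section one_dimension.
Context {R : realType}.
Implicit Types (x y : 'rV[R]_1) (S : set 'rV[R]_1).

Lemma enorm1 x : enorm x = `|x 0 0|.
Proof. by rewrite /enorm dotv_sqr big_ord1 sqrtr_sqr. Qed.

(* Walking from [x] to [x + s] in steps shorter than the gap between inclusions
   never leaves the inclusion of [x], whose diameter is below 1/2. *)
Lemma inclusion_exit (r0 : R) S x (s : R) : 0 < r0 -> separated_inclusions r0 S -> S x ->
  `|s| = 1 -> exists2 t : R, 0 < t & (~` closure S) (x + (t * s)%:M).
Proof.
move=> r00 [Ok [SE oOk dOk sOk]] Sx s1; apply: contrapT => h.
have cl (t : R) : 0 < t -> closure S (x + (t * s)%:M).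
  by move=> t0; apply: contrapT => nt; apply: h; exists t.
have [k0 _ k0x] : (\bigcup_k Ok k) x by rewrite -SE.
(* The step h0 is below r0 / 4 and 1/2. Consecutive points of the walk are within 3 h0 < r0 of each
   other, hence in the same inclusion, and the last is farther than 1 - h0 > 1/2 from x, against the
   diameter. *)
pose M := Num.truncn (2 + 4 / r0); pose h0 : R := M.+1%:R^-1.
have M0 : 0 < M.+1%:R :> R by rewrite ltr0n.
have h00 : 0 < h0 by rewrite invr_gt0.
have hM : 2 + 4 / r0 < M.+1%:R by exact: truncnS_gt.
have h4 : 4 * h0 < r0.
  have : 4 / r0 < M.+1%:R by apply: lt_trans hM; rewrite ltrDr.
  by rewrite ltr_pdivrMr// mulrC -ltr_pdivrMr.
have h2 : 2 * h0 < 1.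
  by rewrite ltr_pdivrMr// mul1r; apply: lt_trans hM; rewrite ltrDl divr_gt0.
(* After the start, x + m h0 s is only known to lie in the closure of S, so the walk follows nearby
   points q of S. *)
have walk (m : nat) : exists2 q, Ok k0 q & `|q 0 0 - (x 0 0 + m%:R * h0 * s)| < h0.
  elim: m => [|m [q Okq qm]]; first by exists x => //; rewrite !mul0r addr0 subrr normr0.
  have t0 : 0 < m.+1%:R * h0 by rewrite mulr_gt0// ltr0n.
  have [q' [Sq' bq']] := cl _ t0 _ (nbhsx_ballx _ _ h00).
  have q'm : `|q' 0 0 - (x 0 0 + m.+1%:R * h0 * s)| < h0.
    move: bq'; rewrite -ball_normE /= => bq'; rewrite distrC.
    apply: le_lt_trans bq'; apply: le_trans (normr_coord_le _ 0).
    by rewrite !mxE eqxx mulr1n.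
  move: Sq'; rewrite SE => -[k' _ Okq'].
  have [kk|/eqP kk] := eqVneq k' k0; first by exists q' => //; rewrite -kk.
  have := euclid_dist_lt (sOk _ _ kk) Okq' Okq; rewrite enorm1 !mxE => far; exfalso.
  have E : q' 0 0 - q 0 0 = (q' 0 0 - (x 0 0 + m.+1%:R * h0 * s)) -
      (q 0 0 - (x 0 0 + m%:R * h0 * s)) + h0 * s by rewrite -natr1; ring.
  move: far; apply/negP; rewrite -leNgt E; apply: le_trans (ler_normD _ _) _.
  rewrite normrM s1 mulr1 (gtr0_norm h00).
  have := ler_normB (q' 0 0 - (x 0 0 + m.+1%:R * h0 * s)) (q 0 0 - (x 0 0 + m%:R * h0 * s)).
  by move: qm q'm; set u := `|_ - _|; set v := `|_ - _|; set w := `|_ - _|; lra.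
have [q Okq] := walk M.+1; rewrite /h0 divff ?gt_eqF// mul1r => qx.
have := euclid_diam_lt (dOk k0) Okq k0x; rewrite enorm1 !mxE; apply/negP; rewrite -leNgt.
have := ler_normB (q 0 0 - x 0 0) (q 0 0 - (x 0 0 + s)).
rewrite (_ : _ - _ - _ = s) ?s1; last by ring.
by move: qx; rewrite -/h0; set u := `|_ - _|; set v := `|_ - _|; lra.
Qed.

(** A point x of S separates the line: by [inclusion_exit] the complement has points on both sides,
    and its part below x is relatively open and closed because the complement does not contain x. *)
Lemma connected_complement_empty (r0 : R) S : 0 < r0 -> separated_inclusions r0 S ->
  connected (~` closure S) -> S = set0.
Proof.
move=> r00 sepS conn; apply/seteqP; split => // x Sx.
have [t1 t10 C1] := inclusion_exit r00 sepS Sx (normr1 R).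
have [t2 t20 C2] := inclusion_exit r00 sepS Sx (normrN1 R).
have cx : continuous (fun y : 'rV[R]_1 => y 0 0) by exact: coord_continuous.
have E : ~` closure S `&` [set y : 'rV[R]_1 | y 0 0 < x 0 0] = ~` closure S `&` [set y : 'rV[R]_1 | y 0 0 <= x 0 0].
  apply/seteqP; split => y [cy /= yx]; split => //=; first exact: ltW.
  rewrite lt_neqAle yx andbT; apply/negP => /eqP yx'; apply: cy; apply: subset_closure.
  suff -> : y = x by [].
  by apply/rowP => i; rewrite ord1.
have : ~` closure S `&` [set y : 'rV[R]_1 | y 0 0 < x 0 0] = ~` closure S.
  apply: conn.
  - exists (x + (t2 * -1)%:M); split => //=.
    by rewrite !mxE eqxx mulr1n mulrN1 gtrDl oppr_lt0.
  - exists [set y : 'rV[R]_1 | y 0 0 < x 0 0] => //.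
    exact: (open_comp (fun y _ => cx y) (@open_lt R (x 0 0))).
  - exists [set y : 'rV[R]_1 | y 0 0 <= x 0 0] => //.
    exact: (closed_comp (fun y _ => cx y) (@closed_le R (x 0 0))).
move/seteqP => [_ /(_ _ C1)[_ /=]].
by rewrite !mxE eqxx mulr1n mulr1 gtrDl ltNge (ltW t10).
Qed.

End one_dimension.

Section no_inclusions_in_dimension_one.
Context {R : realType} {d : nat} {disp : measure_display}
  {Omega : measurableType disp}.
Variables (P : probability Omega R) (T : 'rV[R]_d -> Omega -> Omega) (O : set Omega).

Lemma ae_separated_inclusions rho N gamma r0 : random_inclusions P T O rho N gamma r0 ->
  {ae P, forall w, separated_inclusions r0 (realised_set T O w)}.
Proof.
move=> RI; apply: filterS (inclusions_ae RI) => w [_ [Ok [E hO hs]]].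
by exists Ok; split => // k; have [] := hO k.
Qed.

Lemma ae_open_inclusions rho N gamma r0 : random_inclusions P T O rho N gamma r0 ->
  {ae P, forall w, open (realised_set T O w)}.
Proof.
move=> RI; apply: filterS (ae_separated_inclusions RI) => w [Ok [-> oO _ _]].
exact: bigcup_open.
Qed.

End no_inclusions_in_dimension_one.

(** In dimension one almost every realisation would be empty by [connected_complement_empty]. As w
    is in O exactly when 0 is in its realisation, this contradicts P(O) > 0. *)
Lemma random_inclusions_dim (R : realType) d disp (Omega : measurableType disp)
    (P : probability Omega R) (T : 'rV[R]_d -> Omega -> Omega) (O : set Omega) rho N gamma r0 :
  (0 < d)%N -> ergodic_dynamical_system P T -> random_inclusions P T O rho N gamma r0 -> (1 < d)%N.
Proof.
case: d T => [|[|d]] // T _ TE RI; exfalso.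
have mO := inclusions_measurable RI; have /andP[PO _] := inclusions_proba RI.
have nO : {ae P, forall w, ~ O w}.
  apply: filterS2 (inclusions_ae RI) (ae_separated_inclusions RI) => w [conn _] sep Ow.
  have : realised_set T O w 0 by rewrite /realised_set /= (shift0 TE).
  by rewrite (connected_complement_empty (inclusions_r0 RI) sep conn).
have [B [mB B0 OB]] := nO.
move: PO; rewrite ltNge => /negP; apply; rewrite -B0.
by apply: le_measure; rewrite ?inE// => w Ow; apply: OB => /(_ Ow).
Qed.

Lemma cvge0 (R : realType) (u : nat -> \bar R) : (forall k, 0 <= u k)%E ->
  (forall e : R, 0 < e -> \forall k \near \oo, (u k <= e%:E)%E) -> u k @[k --> \oo] --> 0%E.
Proof.
move=> u0 ue; apply/fine_cvgP; split.
  apply: filterS (ue 1 ltr01) => k uk.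
  by rewrite ge0_fin_numE// (le_lt_trans uk)// ltry.
apply/cvgrPdist_le => e e0; apply: filterS (ue e e0) => k /=; have := u0 k.
case: (u k) => // r; rewrite !lee_fin => r0 re.
by rewrite sub0r normrN ger0_norm.
Qed.

(** * The eigenvalue problem *)

Section weighted_averages.
Context {R : realType} {d : nat} {disp : measure_display}
  {Omega : measurableType disp}.
Variables (P : probability Omega R) (T : 'rV[R]_d -> Omega -> Omega) (O : set Omega).
Hypothesis TE : ergodic_dynamical_system P T.
Let L := leb R d.
Let mu := (L \x P)%E.

Definition wint (f : 'rV[R]_d -> R) (F : 'rV[R]_d * Omega -> R) (w : Omega) : R :=
  \int[leb R d]_x (f x * F (x, w)).

Lemma sqint_fubini2 (F : 'rV[R]_d * Omega -> R) : measurable_fun setT F ->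
  sqint mu F = (\int[P]_w sqint L (fun x => F (x, w)))%E.
Proof.
move=> mf; rewrite /sqint (fubini_tonelli2 (fun z => ((F z) ^+ 2)%:E))//.
- exact: measurable_sq.
- by move=> z; rewrite lee_fin sqr_ge0.
Qed.

Lemma L2_fubini2 (F : 'rV[R]_d * Omega -> R) : F \in Lfun mu 2%:E ->
  {ae P, forall w, (fun x => F (x, w)) \in Lfun L 2%:E}.
Proof.
move=> fL; have mF := L2_measurable fL.
have := ae_integrable2 (L2_sqr_integrable fL).
apply: filterS => w rw; apply/L2P; split; first exact: measurable_pair2.
have [_] := integrableP _ _ _ rw; apply: le_lt_trans; apply: ge0_le_integral => //.
- by move=> y _; rewrite lee_fin sqr_ge0.
- by apply: measurable_sq; exact: measurable_pair2.
- by apply: measurableT_comp => //; apply: measurable_sq; exact: measurable_pair2.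
- by move=> y _; rewrite /= lee_fin ler_norm.
Qed.

Lemma wint_rintg f F : f \in Lfun L 2%:E -> F \in Lfun mu 2%:E ->
  rintg mu (fun z => f z.1 * F z).
Proof. by move=> fL FL; exact: L2_mul_integrable (L2_fst P fL) FL. Qed.

Lemma measurable_wint f F : f \in Lfun L 2%:E -> F \in Lfun mu 2%:E ->
  measurable_fun setT (wint f F).
Proof. by move=> fL FL; exact: rintg_measurable (rintg_fubini2 (wint_rintg fL FL)). Qed.

Lemma sqint_wint f F : f \in Lfun L 2%:E -> F \in Lfun mu 2%:E ->
  (sqint P (wint f F) <= (\int[L]_x (f x ^+ 2))%:E * sqint mu F)%E.
Proof.
move=> fL FL; have mF := L2_measurable FL.
have B0 : 0 <= \int[L]_x (f x ^+ 2) by apply: Rintegral_ge0 => x _; exact: sqr_ge0.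
have mS : measurable_fun setT (fun w => sqint L (fun x => F (x, w))).
  apply: (measurable_fun_fubini_tonelli_G (fun z => ((F z) ^+ 2)%:E)).
    exact: measurable_sq.
  by move=> z; rewrite lee_fin sqr_ge0.
rewrite sqint_fubini2// -ge0_integralZl//; last by move=> w _; exact: sqint_ge0.
apply: ae_ge0_le_integral => //.
- by move=> w _; rewrite lee_fin sqr_ge0.
- by apply: measurable_sq; exact: measurable_wint.
- by move=> w _; rewrite mule_ge0// sqint_ge0.
- exact: measurable_funeM.
- apply: filterS (L2_fubini2 FL) => w Fw _.
  by rewrite -integral_sqE// -EFinM lee_fin; exact: L2_cauchy_schwarz.
Qed.

Lemma L2_wint f F : f \in Lfun L 2%:E -> F \in Lfun mu 2%:E -> wint f F \in Lfun P 2%:E.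
Proof.
move=> fL FL; apply/L2P; split; first exact: measurable_wint.
apply: le_lt_trans (sqint_wint fL FL) _.
rewrite lte_mul_pinfty//; last exact: L2_sqint_lty FL.
by rewrite lee_fin; apply: Rintegral_ge0 => x _; exact: sqr_ge0.
Qed.

Lemma measurable_shift_snd t : measurable_fun setT (fun z : 'rV[R]_d * Omega => (z.1, T t z.2)).
Proof.
apply/measurable_fun_pairP; split; first exact: measurable_fst.
by apply: measurableT_comp measurable_snd; exact: shift_measurable TE t.
Qed.

Lemma L2_shift_snd t F : F \in Lfun mu 2%:E -> (fun z => F (z.1, T t z.2)) \in Lfun mu 2%:E.
Proof.
move=> /L2P[mF Fo].
have ms : measurable_fun setT (fun z : 'rV[R]_d * Omega => F (z.1, T t z.2)).
  exact: measurableT_comp mF (measurable_shift_snd t).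
apply/L2P; split => //; rewrite (sqint_fubini1 _ _ ms) (_ : (\int[_]_x _)%E = sqint mu F)//.
rewrite (sqint_fubini1 _ _ mF); apply: eq_integral => x _.
exact: (sqint_shift TE t (measurable_pair1 x mF)).
Qed.

(** For almost every x the quotients converge in L^2(P). To integrate over x they need a bound
    uniform in k: [sqint_shift_sub] bounds the squared norm of the quotient by twice that of G(x,
    .), which gives the factor 6 = 2 * 2 + 2. *)
Lemma diffquot_sqint_cvg j (F G : 'rV[R]_d * Omega -> R) (t : nat -> R) :
  F \in Lfun mu 2%:E -> G \in Lfun mu 2%:E ->
  {ae L, forall x, stoch_deriv P T j (fun w => F (x, w)) (fun w => G (x, w))} ->
  (forall k, t k != 0) -> t k @[k --> \oo] --> (0 : R) ->
  sqint mu (fun z => (F (z.1, T (t k *: basisv j) z.2) - F z) / t k - G z) @[k --> \oo] --> 0%E.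
Proof.
move=> FL GL FG tn0 t0.
have mF := L2_measurable FL; have mG := L2_measurable GL.
pose D k z := (F (z.1, T (t k *: basisv j) z.2) - F z) / t k - G z.
have mD k : measurable_fun setT (D k).
  apply: measurable_funB => //; apply: measurable_funM => //; apply: measurable_funB => //.
  exact: L2_measurable (L2_shift_snd _ FL).
have mS (H : 'rV[R]_d * Omega -> R) : measurable_fun setT H ->
    measurable_fun setT (fun x => sqint P (fun w => H (x, w))).
  move=> mH; apply: (measurable_fun_fubini_tonelli_F (fun z => ((H z) ^+ 2)%:E)).
    exact: measurable_sq.
  by move=> z; rewrite lee_fin sqr_ge0.
have [] := @dominated_convergence _ _ _ L setT measurableT
    (fun k x => sqint P (fun w => D k (x, w))) (fun=> 0%E)
    (fun x => (6%:E * sqint P (fun w => G (x, w)))%E).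
- by move=> k; exact: mS.
- exact: measurable_cst.
- apply: filterS FG => x /stoch_derivP[_ _ h] _.
  apply: cvge0 => [k|e e0]; first exact: sqint_ge0.
  have [dlt dlt0 hd] := h e e0.
  have : \forall k \near \oo, `|t k| < dlt.
    by have /cvgr0_norm_lt := t0; apply.
  by apply: filterS => k tk; exact: hd.
- apply/integrableP; split; first by apply: measurable_funeM; exact: mS.
  rewrite (_ : (\int[L]_x _)%E = (6%:E * sqint mu G)%E).
    by rewrite lte_mul_pinfty//; exact: L2_sqint_lty GL.
  rewrite sqint_fubini1// -ge0_integralZl//; [|exact: mS|by move=> x _; exact: sqint_ge0].
  by apply: eq_integral => x _; rewrite gee0_abs// mule_ge0// sqint_ge0.
- apply: filterS FG => x FGx k _; rewrite gee0_abs ?sqint_ge0//.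
  have mFx : measurable_fun setT (fun w => F (x, w)) by exact: measurable_pair1.
  have mGx : measurable_fun setT (fun w => G (x, w)) by exact: measurable_pair1.
  pose S w := F (x, T (t k *: basisv j) w) - F (x, w).
  have mS' : measurable_fun setT S.
    by apply: measurable_funB => //; exact: (measurable_shift TE _ mFx).
  have h1 := sqint_shift_sub TE (t k) FGx.
  have h2 : (sqint P (fun w => (t k)^-1 * S w)%R <= 2%:E * sqint P (fun w => G (x, w)))%E.
    rewrite sqintZ//; apply: (@le_trans _ _ (((t k)^-1 ^+ 2)%:E * ((2 * t k ^+ 2)%:E * sqint P (fun w => G (x, w))))%E).
      by rewrite lee_wpmul2l// lee_fin sqr_ge0.
    rewrite muleA -EFinM (_ : (t k)^-1 ^+ 2 * (2 * t k ^+ 2) = 2)//.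
    by rewrite mulrCA -exprMn mulVf// expr1n mulr1.
  apply: (@le_trans _ _ (2%:E * sqint P (fun w => (t k)^-1 * S w)%R + 2%:E * sqint P (fun w => - G (x, w))%R)%E).
    apply: le_sqintD.
    - exact: measurable_funM.
    - exact: measurableT_comp.
    - by move=> w; rewrite /D /S /= mulrC.
  rewrite sqintN; have G0 := sqint_ge0 P (fun w => G (x, w)).
  have -> : 6%:E = (2 * 2)%:E + 2%:E :> \bar R by rewrite -EFinD; congr EFin; ring.
  rewrite ge0_muleDl ?lee_fin ?mulr_ge0// EFinM -muleA.
  by apply: leeD => //; exact: lee_wpmul2l.
- move=> _ _; rewrite integral0.
  by under eq_fun do rewrite -(sqint_fubini1 _ _ (mD _)).
Qed.

(** Averaging with weight f commutes with difference quotients and is bounded from L^2(R^d x Omega)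
    to L^2(Omega), by [sqint_wint]. *)
Lemma wint_stoch_deriv j f (F G : 'rV[R]_d * Omega -> R) : f \in Lfun L 2%:E ->
  F \in Lfun mu 2%:E -> G \in Lfun mu 2%:E ->
  {ae L, forall x, stoch_deriv P T j (fun w => F (x, w)) (fun w => G (x, w))} ->
  stoch_deriv P T j (wint f F) (wint f G).
Proof.
move=> fL FL GL FG; apply/stoch_derivP; split; [exact: L2_wint|exact: L2_wint|].
move=> e e0; apply: contrapT => /forall2NP h.
pose B := \int[L]_x (f x ^+ 2).
have B0 : 0 <= B by apply: Rintegral_ge0 => x _; exact: sqr_ge0.
(* Dominated convergence speaks of sequences, so a failure of the limit is first turned into a
   sequence of increments tending to 0. *)
have /choice[t ht] : forall k : nat, exists t : R, [/\ t != 0, `|t| < k.+1%:R^-1 &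
    (e%:E < sqint P (fun w => diffquot T j t (wint f F) w - wint f G w)%R)%E].
  move=> k; have [|] := h (k.+1%:R^-1); first by rewrite invr_gt0 ltr0n.
  by move=> /existsNP[t /not_implyP[t0 /not_implyP[tk /negP]]]; rewrite -ltNge; exists t.
have t0 : t k @[k --> \oo] --> (0 : R).
  apply/norm_cvg0P; apply: (@squeeze_cvgr _ _ _ _ (fun=> 0) (fun k => k.+1%:R^-1)).
  - by apply: nearW => k; rewrite normr_ge0/= ltW//; have [] := ht k.
  - exact: cvg_cst.
  - exact: cvg_harmonic.
have tn0 k : t k != 0 by have [] := ht k.
have eB : 0 < e / (B + 1) by rewrite divr_gt0// ltr_wpDl.
have [K _ /(_ K (leqnn K))/= hK] := cvge0_lt (diffquot_sqint_cvg FL GL FG tn0 t0) eB.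
have [_ _] := ht K; rewrite ltNge => /negP; apply.
set D := (fun z => _ - G z) in hK.
have DL : D \in Lfun mu 2%:E.
  apply: L2B => //; rewrite /D; under eq_fun do rewrite mulrC.
  by apply: L2Z; apply: L2B => //; exact: L2_shift_snd.
have ED : {ae P, forall w, diffquot T j (t K) (wint f F) w - wint f G w = wint f D w}.
  have F1 := L2_fubini2 FL.
  apply: filterS3 F1 (ae_shift TE (t K *: basisv j) F1) (L2_fubini2 GL) => w Fw Ftw Gw.
  rewrite /diffquot /wint -RintB; [|exact: L2_mul_integrable|exact: L2_mul_integrable].
  rewrite mulrC -RintZ; last by apply: rintgB; exact: L2_mul_integrable.
  rewrite -RintB; [|by apply: rintgZ; apply: rintgB; exact: L2_mul_integrable|exact: L2_mul_integrable].
  by apply: eq_Rintegral => x _; rewrite /D/=; ring.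
rewrite (ae_eq_sqint _ _ ED); last exact: measurable_wint.
  apply: le_trans (sqint_wint fL DL) _; rewrite -/B.
  apply: (@le_trans _ _ (B%:E * (e / (B + 1))%:E)%E); first by rewrite lee_wpmul2l// ltW.
  by rewrite -EFinM lee_fin mulrA ler_pdivrMr ?ltr_wpDl// mulrDr mulr1 mulrC lerDl ltW.
apply: measurable_funB; last exact: measurable_wint.
exact: L2_measurable (L2_diffquot TE _ _ (L2_wint fL FL)).
Qed.

Lemma wint_supported f F : f \in Lfun L 2%:E -> F \in Lfun mu 2%:E -> measurable O ->
  {ae mu, forall z, \1_O z.2 * F z = F z} -> supported_in P O (wint f F).
Proof.
move=> fL FL mO /ae_prodr OF; apply: filterS2 OF (L2_fubini2 FL) => w OFw Fw.
rewrite /wint -RintZ; last exact: L2_mul_integrable.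
have mFw := L2_measurable Fw; have mf := L2_measurable fL.
apply: ae_eq_Rintegral.
- by apply: measurable_funM => //; exact: measurable_funM.
- exact: measurable_funM.
- by apply: filterS OFw => x /= E; rewrite mulrCA E.
Qed.

(** The exceptional set of w may vary with x; Tonelli for the square of the measurable defect D
    gives a single null set of the product. *)
Lemma ae_supported_prod F : measurable O -> F \in Lfun mu 2%:E ->
  {ae L, forall x, supported_in P O (fun w => F (x, w))} ->
  {ae mu, forall z, \1_O z.2 * F z = F z}.
Proof.
move=> mO FL h; have mF := L2_measurable FL.
pose D z := \1_O z.2 * F z - F z.
have mD : measurable_fun setT D.
  apply: measurable_funB => //; apply: measurable_funM => //.
  by apply: measurable_snd_fun; exact: measurable_indic.
have : {ae mu, forall z, D z = 0}.
  apply: sqint_eq0 => //; rewrite sqint_fubini1//.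
  rewrite -[RHS](integral0 L setT); apply: ae_eq_integral => //.
    apply: (measurable_fun_fubini_tonelli_F (fun z => ((D z) ^+ 2)%:E)).
      exact: measurable_sq.
    by move=> z; rewrite lee_fin sqr_ge0.
  apply: filterS h => x hx _; apply: ae_eq0_sqint; first exact: measurable_pair1.
  by apply: filterS hx => w E; rewrite /D /= E subrr.
by apply: filterS => z /eqP; rewrite subr_eq0 => /eqP.
Qed.

Lemma wint_W120 f u g : measurable O -> f \in Lfun L 2%:E -> L2_W120 P T O u g ->
  W120 P T O (wint f u) /\ stoch_grad P T (wint f u) (fun w => \row_j wint f (fun z => g z 0 j) w).
Proof.
move=> mO fL [uL gL ug].
have gr : stoch_grad P T (wint f u) (fun w => \row_j wint f (fun z => g z 0 j) w).
  move=> j; under [X in stoch_deriv _ _ _ _ X]eq_fun do rewrite mxE.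
  by apply: wint_stoch_deriv => //; apply: filterS ug => x [_ /(_ j)].
split => //; split; first by move=> j; eexists; exact: gr.
apply: wint_supported => //; apply: ae_supported_prod => //.
by apply: filterS ug => x [[]].
Qed.

End weighted_averages.

(** * Weak solutions on the probability space *)

Section weak_solutions.
Context {R : realType} {d : nat} {disp : measure_display}
  {Omega : measurableType disp}.
Variables (P : probability Omega R) (T : 'rV[R]_d -> Omega -> Omega) (O : set Omega).
Hypothesis TE : ergodic_dynamical_system P T.
Hypothesis mO : measurable O.
Hypothesis PO : (P O < 1)%E.
Hypothesis oO : {ae P, forall w, open (realised_set T O w)}.
Hypothesis d0 : (0 < d)%N.

Lemma W120_L2 v : W120 P T O v -> v \in Lfun P 2%:E.
Proof. by move=> [/(_ (Ordinal d0))[g] /stoch_deriv_L2l]. Qed.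

Lemma stoch_grad_L2 v gv (j : 'I_d) : stoch_grad P T v gv -> (fun w => gv w 0 j) \in Lfun P 2%:E.
Proof. by move=> /(_ j)/stoch_deriv_L2r. Qed.

Lemma W120_grad v : W120 P T O v -> exists gv, stoch_grad P T v gv.
Proof.
move=> [/choice[g gE] _]; exists (fun w => \row_j g j w) => j.
by under [X in stoch_deriv _ _ _ _ X]eq_fun do rewrite mxE.
Qed.

Lemma stoch_gradD v gv v' gv' k : stoch_grad P T v gv -> stoch_grad P T v' gv' ->
  stoch_grad P T (fun w => v w + k * v' w) (fun w => gv w + k *: gv' w).
Proof.
move=> h h' j; under [X in stoch_deriv _ _ _ _ X]eq_fun do rewrite !mxE.
exact: stoch_derivD (h j) (h' j).
Qed.

Lemma W120D v v' k : W120 P T O v -> W120 P T O v' -> W120 P T O (fun w => v w + k * v' w).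
Proof.
move=> [dv sv] [dv' sv']; split.
  by move=> j; have [g h] := dv j; have [g' h'] := dv' j; eexists; exact: stoch_derivD h h'.
by apply: filterS2 sv sv' => w E E'; rewrite mulrDr E mulrCA E'.
Qed.

Lemma W120_0 : W120 P T O (fun=> 0).
Proof.
split; first by move=> j; exists (fun=> 0); exact: stoch_deriv0.
by apply: aeW => w; rewrite mulr0.
Qed.

Lemma stoch_grad_0 : stoch_grad P T (fun=> 0) (fun=> 0).
Proof. by move=> j; under [X in stoch_deriv _ _ _ _ X]eq_fun do rewrite mxE; exact: stoch_deriv0. Qed.

Lemma W120Z v k : W120 P T O v -> W120 P T O (fun w => k * v w).
Proof. by move/(W120D k W120_0); under eq_fun do rewrite add0r. Qed.

Lemma stoch_gradZ v gv k : stoch_grad P T v gv ->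
  stoch_grad P T (fun w => k * v w) (fun w => k *: gv w).
Proof.
move/(stoch_gradD k stoch_grad_0).
by under eq_fun do rewrite add0r; under [X in stoch_grad _ _ _ X]eq_fun do rewrite add0r.
Qed.

(* [c + b] is an eigenfunction of the form on [R + W_0^{1,2}(O)], tested on
   [W_0^{1,2}(O)] only. *)
Definition weak_solution (lambda c : R) (b : Omega -> R) (gb : Omega -> 'rV[R]_d) :=
  [/\ W120 P T O b, stoch_grad P T b gb &
      forall v gv, W120 P T O v -> stoch_grad P T v gv ->
        \int[P]_w dotv (gb w) (gv w) = lambda * (c * \int[P]_w v w + \int[P]_w (b w * v w))].

Lemma weak_solutionD lambda c b gb c' b' gb' k :
  weak_solution lambda c b gb -> weak_solution lambda c' b' gb' ->
  weak_solution lambda (c + k * c') (fun w => b w + k * b' w) (fun w => gb w + k *: gb' w).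
Proof.
move=> [Wb gbE sol] [Wb' gbE' sol']; split; [exact: W120D|exact: stoch_gradD|].
move=> v gv Wv gvE.
have rg := dotv_rintg (fun j => stoch_grad_L2 j gbE) (fun j => stoch_grad_L2 j gvE).
have rg' := dotv_rintg (fun j => stoch_grad_L2 j gbE') (fun j => stoch_grad_L2 j gvE).
have rb := L2_mul_integrable (W120_L2 Wb) (W120_L2 Wv).
have rb' := L2_mul_integrable (W120_L2 Wb') (W120_L2 Wv).
transitivity (\int[P]_w (dotv (gb w) (gv w) + k * dotv (gb' w) (gv w))).
  apply: eq_Rintegral => w _; rewrite !dotvE mulr_sumr -big_split; apply: eq_bigr => l _ /=.
  by rewrite !mxE; ring.
rewrite (RintD rg (rintgZ k rg')) (RintZ k rg') (sol _ _ Wv gvE) (sol' _ _ Wv gvE).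
have -> : \int[P]_w ((b w + k * b' w) * v w) = \int[P]_w (b w * v w) + k * \int[P]_w (b' w * v w).
  rewrite -(RintZ k rb') -(RintD rb (rintgZ k rb')).
  by apply: eq_Rintegral => w _; ring.
by ring.
Qed.

(** For lambda = 0, testing with b itself kills its gradient, so b is constant by ergodicity; the
    constant is 0 because b vanishes on the complement of O, a set of positive probability. Thus
    lambda <psi> = 0 yields <psi> = 0 later. *)
Lemma weak_solution_eigenvalue lambda b gb : weak_solution lambda 0 b gb ->
  ~ {ae P, forall w, b w = 0} -> lambda != 0.
Proof.
move=> [Wb gbE sol] nb; apply/negP => /eqP l0; apply: nb.
have := sol _ _ Wb gbE; rewrite l0 mul0r => E.
have g0 j : {ae P, forall w, gb w 0 j = 0}.
  have gL l := stoch_grad_L2 l gbE.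
  apply: sqint_eq0; first exact: L2_measurable (gL j).
  rewrite -(integral_sqE (gL j)); congr EFin; apply/eqP; rewrite eq_le; apply/andP; split; last first.
    by apply: Rintegral_ge0 => w _; exact: sqr_ge0.
  rewrite -E; apply: le_Rint; [exact: L2_sqr_integrable|exact: dotv_rintg|].
  by move=> w; rewrite dotv_sqr (bigD1 j)//= lerDl sumr_ge0// => l _; exact: sqr_ge0.
have bL := W120_L2 Wb.
have [|c bc] := stoch_grad0_cst TE (L2_measurable bL).
  move=> j; apply: ae_eq_stoch_deriv (gbE j) => //; first exact: L20.
  exact: aeW.
have c0 : c = 0.
  apply: contrapT => /eqP c0; move: PO; rewrite ltNge => /negP; apply.
  rewrite -(probability_setT P).
  have [_ sb] := Wb.
  have [N [mN N0 hN]] : {ae P, forall w, O w}.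
    apply: filterS2 bc sb => w -> /eqP; rewrite indicE.
    have [//|nw] := pselect (O w); rewrite memNset// mul0r eq_sym => /eqP c0'.
    by move: c0; rewrite c0' eqxx.
  have ON : setT `<=` O `|` N.
    by move=> w _; have [|nw] := pselect (O w); [left|right; exact: hN].
  apply: (@le_trans _ _ (P (O `|` N))).
    by apply: le_measure; rewrite ?inE//; exact: measurableU.
  apply: le_trans (measureU2 P mO mN) _.
  by rewrite [X in (_ + X)%E]N0 adde0.
by apply: filterS bc => w ->.
Qed.

Lemma weak_solution_mean lambda b gb psi gpsi : weak_solution lambda 1 b gb ->
  weak_solution lambda 0 psi gpsi -> lambda * \int[P]_w psi w = 0.
Proof.
move=> [Wb gbE sol] [Wp gpE sol'].
have := sol _ _ Wp gpE; have := sol' _ _ Wb gbE.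
rewrite mul0r add0r mul1r => E' E.
have -> : \int[P]_w psi w = (\int[P]_w psi w + \int[P]_w (b w * psi w)) - \int[P]_w (psi w * b w).
  under [X in _ = _ - X]eq_Rintegral do rewrite mulrC.
  by rewrite addrK.
rewrite mulrBr -E -E'; apply/eqP; rewrite subr_eq0; apply/eqP.
by apply: eq_Rintegral => w _; rewrite !dotvE; apply: eq_bigr => l _; rewrite mulrC.
Qed.

(** The form of -Delta_O integrates over O and that of A^hom over Omega; they agree because
    gradients vanish outside O, by [stoch_deriv_supported]. *)
Lemma Rint_dotv_supported b gb (gv : Omega -> 'rV[R]_d) : W120 P T O b -> stoch_grad P T b gb ->
  (forall j : 'I_d, (fun w => gv w 0 j) \in Lfun P 2%:E) ->
  \int[P]_(w in O) dotv (gb w) (gv w) = \int[P]_w dotv (gb w) (gv w).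
Proof.
move=> [_ sb] gbE gvL; rewrite (Rint_mkcond P O).
have rd := dotv_rintg (fun j => stoch_grad_L2 j gbE) gvL.
have md := rintg_measurable rd.
apply: ae_eq_Rintegral => //; first by apply: measurable_funM => //; exact: measurable_indic.
have : forall j : 'I_d, {ae P, forall w, \1_O w * gb w 0 j = gb w 0 j}.
  by move=> j; exact: (stoch_deriv_supported TE mO oO sb (gbE j)).
move=> /filter_forall; apply: filterS => w gw; rewrite !dotvE mulr_sumr; apply: eq_bigr => j _.
by rewrite mulrA gw.
Qed.

Lemma Rint_supported b v (lambda : R) : W120 P T O b -> v \in Lfun P 2%:E ->
  \int[P]_(w in O) (lambda * b w * v w) = lambda * \int[P]_w (b w * v w).
Proof.
move=> Wb vL; have [_ sb] := Wb; rewrite (Rint_mkcond P O).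
have rb := L2_mul_integrable (W120_L2 Wb) vL; have mb := rintg_measurable rb.
rewrite -(RintZ lambda rb); apply: ae_eq_Rintegral.
- apply: measurable_funM; first exact: measurable_indic.
  by under eq_fun do rewrite -mulrA; exact: measurable_funM.
- exact: measurable_funM.
- by apply: filterS sb => w E; rewrite -[in RHS]E; ring.
Qed.

Lemma neg_Delta_weak_solution lambda psi gpsi : stoch_grad P T psi gpsi ->
  neg_Delta P T O psi (fun w => lambda * psi w) <-> weak_solution lambda 0 psi gpsi.
Proof.
move=> gpE; split => [[Wp _ h]|[Wp _ h]]; split => //.
- move=> v gv Wv gvE; rewrite mul0r add0r -(Rint_supported lambda Wp (W120_L2 Wv)).
  rewrite -(h _ _ _ Wv gpE gvE) (Rint_dotv_supported Wp gpE)// => j.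
  exact: stoch_grad_L2 gvE.
- split; first by apply: L2Z; exact: W120_L2.
  by have [_] := W120Z lambda Wp.
- move=> v gu gv Wv guE gvE; rewrite (Rint_supported lambda Wp (W120_L2 Wv)).
  have := h _ _ Wv gvE; rewrite mul0r add0r => <-.
  rewrite (Rint_dotv_supported Wp guE); last by move=> j; exact: stoch_grad_L2 gvE.
  apply: ae_eq_Rintegral.
  - exact: rintg_measurable (dotv_rintg (fun j => stoch_grad_L2 j guE) (fun j => stoch_grad_L2 j gvE)).
  - exact: rintg_measurable (dotv_rintg (fun j => stoch_grad_L2 j gpE) (fun j => stoch_grad_L2 j gvE)).
  - have : forall j : 'I_d, {ae P, forall w, gu w 0 j = gpsi w 0 j}.
      by move=> j; exact: stoch_deriv_unique (guE j) (gpE j).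
    by move=> /filter_forall; apply: filterS => w E; rewrite !dotvE; apply: eq_bigr => j _; rewrite E.
Qed.

Lemma zero_mean_eigenfunction lambda psi gpsi : weak_solution lambda 0 psi gpsi ->
  ~ {ae P, forall w, psi w = 0} -> lambda * \int[P]_w psi w = 0 ->
  exists psi0 : Omega -> R,
      [/\ W120 P T O psi0, ~ {ae P, forall w, psi0 w = 0},
          neg_Delta P T O psi0 (fun w => lambda * psi0 w) &
          \int[P]_w psi0 w = 0].
Proof.
move=> sol np lm; have [Wp gpE _] := sol; exists psi; split => //.
  exact/(neg_Delta_weak_solution lambda gpE).
have := weak_solution_eigenvalue sol np => l0.
by move/eqP: lm; rewrite mulf_eq0 (negPf l0) => /eqP.
Qed.

End weak_solutions.

(** * Eigenfunctions of the homogenised operator *)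

Section point_spectrum_A_hom.
Context {R : realType} {d : nat} {disp : measure_display}
  {Omega : measurableType disp}.
Variables (P : probability Omega R) (T : 'rV[R]_d -> Omega -> Omega) (O : set Omega).
Variable A : 'M[R]_d.
Hypothesis TE : ergodic_dynamical_system P T.
Hypothesis mO : measurable O.
Hypothesis PO : (P O < 1)%E.
Hypothesis oO : {ae P, forall w, open (realised_set T O w)}.
Hypothesis d0 : (0 < d)%N.
Hypothesis sA : A^T = A.
Hypothesis Apos : forall i : 'I_d, exists2 c : R, 0 < c &
  forall y : 'rV[R]_d, c * y 0 i ^+ 2 <= mxform A y y.
Let L := leb R d.
Let mu := (L \x P)%E.

Lemma mxform0l (B : 'M[R]_d) x : mxform B 0 x = 0.
Proof. by rewrite /mxform mul0mx /dotv mul0mx mxE. Qed.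

Lemma mxform0r (B : 'M[R]_d) x : mxform B x 0 = 0.
Proof. by rewrite /mxform /dotv trmx0 mulmx0 mxE. Qed.

Lemma dotv0r (x : 'rV[R]_d) : dotv x 0 = 0.
Proof. by rewrite /dotv trmx0 mulmx0 mxE. Qed.

Lemma W12_0 : @W12 R d (fun=> 0) (fun=> 0).
Proof.
split; [exact: L20|by move=> j; under eq_fun do rewrite mxE; exact: L20|].
move=> f tf j; under eq_Rintegral do rewrite mul0r.
under [in RHS]eq_Rintegral do rewrite mxE mul0r.
by rewrite Rint0 oppr0.
Qed.

Lemma L2_W120_prod f v gv : f \in Lfun L 2%:E -> W120 P T O v -> stoch_grad P T v gv ->
  L2_W120 P T O (fun z => f z.1 * v z.2) (fun z => f z.1 *: gv z.2).
Proof.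
move=> fL Wv gvE; split.
- exact: L2_prod fL (W120_L2 d0 Wv).
- move=> j; under eq_fun do rewrite mxE.
  exact: (L2_prod fL (stoch_grad_L2 j gvE)).
- by apply: aeW => x; split; [exact: (W120Z TE (f x) Wv)|exact: (stoch_gradZ TE (f x) gvE)].
Qed.

Lemma Vdecomp_prod f v gv : f \in Lfun L 2%:E -> W120 P T O v -> stoch_grad P T v gv ->
  Vdecomp P T O (fun z => f z.1 * v z.2) (fun=> 0) (fun=> 0)
    (fun z => f z.1 * v z.2) (fun z => f z.1 *: gv z.2).
Proof.
move=> fL Wv gvE; split.
- exact: L2_prod fL (W120_L2 d0 Wv).
- exact: W12_0.
- exact: L2_W120_prod.
- by apply: aeW => z; rewrite add0r.
Qed.

Lemma L2_W120_0 : L2_W120 P T O (fun=> 0) (fun=> 0).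
Proof.
split; [exact: L20|by move=> j; under eq_fun do rewrite mxE; exact: L20|].
by apply: aeW => x; split; [exact: W120_0|exact: stoch_grad_0].
Qed.

Lemma Vdecomp_fst f h : W12 f h ->
  Vdecomp P T O (fun z => f z.1) f h (fun=> 0) (fun=> 0).
Proof.
move=> fh; have [fL _ _] := fh; split => //; [exact: L2_fst|exact: L2_W120_0|].
by apply: aeW => z; rewrite addr0.
Qed.

Lemma Rint_wint f v (F : 'rV[R]_d * Omega -> R) : f \in Lfun L 2%:E -> v \in Lfun P 2%:E ->
  F \in Lfun mu 2%:E -> \int[mu]_z (F z * (f z.1 * v z.2)) = \int[P]_w (wint f F w * v w).
Proof.
move=> fL vL FL; have rF := L2_mul_integrable FL (L2_prod fL vL).
rewrite (Rint_fubini2 rF); apply: ae_eq_Rintegral.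
- exact: rintg_measurable (rintg_fubini2 rF).
- exact: measurable_funM (measurable_wint fL FL) (L2_measurable vL).
- apply: filterS (L2_fubini2 FL) => w Fw /=.
  rewrite mulrC /wint -RintZ; last exact: L2_mul_integrable.
  by apply: eq_Rintegral => x _; ring.
Qed.

Lemma wint_fst f g w : wint (Omega := Omega) f (fun z => g z.1) w = \int[L]_x (f x * g x).
Proof. by []. Qed.

Lemma wint_eq0 (F : 'rV[R]_d * Omega -> R) : F \in Lfun mu 2%:E ->
  (forall f, test_function f -> {ae P, forall w, wint f F w = 0}) ->
  {ae mu, forall z, F z = 0}.
Proof.
move=> FL F0; apply: fundamental_lemma => // f B tf mB.
have fL := test_function_L2 tf.
have BL : (\1_B : Omega -> R) \in Lfun P 2%:E.
  apply: (@le_L2 _ _ _ P _ (fun=> 1)); first exact: measurable_indic.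
    exact: Lfun_cst.
  by move=> w; rewrite normr1 normr_indic_le1.
rewrite (Rint_wint fL BL FL) -(Rint0 P); apply: ae_eq_Rintegral.
- exact: measurable_funM (measurable_wint fL FL) (L2_measurable BL).
- exact: measurable_cst.
- by apply: filterS (F0 _ tf) => w ->; rewrite mul0r.
Qed.

Section eigenfunction.
Variables (lambda : R) (u : 'rV[R]_d * Omega -> R).
Variables (u0 : 'rV[R]_d -> R) (g0 : 'rV[R]_d -> 'rV[R]_d)
  (u1 : 'rV[R]_d * Omega -> R) (g1 : 'rV[R]_d * Omega -> 'rV[R]_d).
Hypothesis uE : A_hom P T O A u (fun z => lambda * u z).
Hypothesis ud : Vdecomp P T O u u0 g0 u1 g1.

Let u0L : u0 \in Lfun L 2%:E. Proof. by case: ud => _ []. Qed.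
Let u1L : u1 \in Lfun mu 2%:E. Proof. by case: ud => _ _ []. Qed.
Let g1L (j : 'I_d) : (fun z => g1 z 0 j) \in Lfun mu 2%:E. Proof. by case: ud => _ _ []. Qed.

Lemma eigenfunction_pairing f v : f \in Lfun L 2%:E -> v \in Lfun P 2%:E ->
  \int[mu]_z (lambda * u z * (f z.1 * v z.2)) =
  lambda * (\int[L]_x (u0 x * f x) * \int[P]_w v w + \int[P]_w (wint f u1 w * v w)).
Proof.
move=> fL vL; have [uL _ _ udE] := ud.
have fvL := L2_prod fL vL.
have r0 := L2_mul_integrable (L2_fst P u0L) fvL.
have r1 := L2_mul_integrable u1L fvL.
transitivity (\int[mu]_z (lambda * (u0 z.1 * (f z.1 * v z.2) + u1 z * (f z.1 * v z.2)))).
  apply: ae_eq_Rintegral.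
  - by under eq_fun do rewrite -mulrA; exact: rintg_measurable (rintgZ lambda (L2_mul_integrable uL fvL)).
  - exact: rintg_measurable (rintgZ lambda (rintgD r0 r1)).
  - by apply: filterS udE => z ->; ring.
rewrite (RintZ lambda (rintgD r0 r1)) (RintD r0 r1) (Rint_wint fL vL (L2_fst P u0L)) (Rint_wint fL vL u1L).
congr (_ * (_ + _)); rewrite -RintZ; last exact: L2_rintg.
apply: eq_Rintegral => w _; rewrite wint_fst; congr (_ * _).
by apply: eq_Rintegral => x _; rewrite mulrC.
Qed.

Lemma eigenfunction_weak_solution f : f \in Lfun L 2%:E ->
  weak_solution P T O lambda (\int[L]_x (u0 x * f x)) (wint f u1)
    (fun w => \row_j wint f (fun z => g1 z 0 j) w).
Proof.
move=> fL; have [_ _ u1d _] := ud; have [W1 G1] := wint_W120 TE mO fL u1d.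
split => // v gv Wv gvE; have vL := W120_L2 d0 Wv.
have [_ _ hE] := uE.
have := hE _ _ _ _ _ _ _ _ _ ud (Vdecomp_prod fL Wv gvE).
rewrite (eigenfunction_pairing fL vL) => <-.
under [X in X + _]eq_Rintegral do rewrite mxform0r.
rewrite Rint0 add0r.
have rj (j : 'I_d) := L2_mul_integrable (g1L j) (L2_prod fL (stoch_grad_L2 j gvE)).
have sj (j : 'I_d) := L2_mul_integrable (L2_wint fL (g1L j)) (stoch_grad_L2 j gvE).
transitivity (\sum_(j < d) \int[P]_w (wint f (fun z => g1 z 0 j) w * gv w 0 j)).
  rewrite -(Rint_sum _ sj); apply: eq_Rintegral => w _; rewrite dotvE.
  by apply: eq_bigr => j _; rewrite mxE.
transitivity (\sum_(j < d) \int[mu]_z (g1 z 0 j * (f z.1 * gv z.2 0 j))).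
  by apply: eq_bigr => j _; rewrite (Rint_wint fL (stoch_grad_L2 j gvE) (g1L j)).
rewrite -(Rint_sum _ rj); apply: eq_Rintegral => z _; rewrite dotvE.
by apply: eq_bigr => j _; rewrite mxE.
Qed.

(** For a test function of x alone the microscopic energy drops out, and u1 enters through its mean
    only. *)
Lemma eigenfunction_macro f h : W12 f h ->
  \int[L]_x mxform A (g0 x) (h x) = lambda * (\int[L]_x (u0 x * f x) + \int[P]_w wint f u1 w).
Proof.
move=> fh; have [fL _ _] := fh; have [_ _ hE] := uE.
have L1 : (fun=> 1 : R) \in Lfun P 2%:E by exact: Lfun_cst.
have := hE _ _ _ _ _ _ _ _ _ ud (Vdecomp_fst fh).
under [X in _ + X]eq_Rintegral do rewrite dotv0r.
rewrite Rint0 addr0 => ->.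
have := eigenfunction_pairing fL L1.
under eq_Rintegral do rewrite mulr1.
under [X in _ = _ * (_ + X) -> _]eq_Rintegral do rewrite mulr1.
by rewrite Rintegral_cst//= probability_setT !mulr1.
Qed.

(** [A_hom] states its identity for every decomposition of u, so it may be applied with u0 and its
    gradient replaced by 0, which removes the macroscopic energy. *)
Lemma u0_eq0_Vdecomp : {ae L, forall x, u0 x = 0} ->
  Vdecomp P T O u (fun=> 0) (fun=> 0) u1 g1.
Proof.
move=> u00; have [uL _ u1d udE] := ud; split => //; first exact: W12_0.
by apply: filterS2 udE (ae_fst P u00) => z -> /= ->.
Qed.

Lemma eigenfunction_eq0 : {ae L, forall x, u0 x = 0} ->
  (forall f, test_function f -> {ae P, forall w, wint f u1 w = 0}) ->
  {ae mu, forall z, u z = 0}.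
Proof.
move=> u00 w0; have [_ _ _ udE] := ud.
by apply: filterS3 udE (ae_fst P u00) (wint_eq0 u1L w0) => z -> /= -> ->; rewrite addr0.
Qed.

End eigenfunction.

Lemma eigenvalue_A_hom lambda u : A_hom P T O A u (fun z => lambda * u z) ->
  ~ {ae mu, forall z, u z = 0} ->
  exists psi gpsi, [/\ weak_solution P T O lambda 0 psi gpsi, ~ {ae P, forall w, psi w = 0} &
    lambda * \int[P]_w psi w = 0].
Proof.
move=> uE nu; have [[u0 [g0 [u1 [g1 ud]]]] _ _] := uE.
have [uL [u0L g0L wg0] [u1L g1L _] _] := ud.
have sol := eigenfunction_weak_solution uE ud.
have [[b [gb solb]]|nosol] := pselect (exists b gb, weak_solution P T O lambda 1 b gb).
  have bL : b \in Lfun P 2%:E by case: solb => Wb _ _; exact: W120_L2 Wb.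
  (* Without a suitable psi every average is the multiple of b in [wE]; u0 then solves the scalar
     problem and u vanishes. *)
  apply: contrapT => none.
  have wE f : f \in Lfun L 2%:E ->
      {ae P, forall w, wint f u1 w = \int[L]_x (u0 x * f x) * b w}.
    move=> fL; apply: contrapT => nf; apply: none.
    have := weak_solutionD TE d0 (- \int[L]_x (u0 x * f x)) (sol f fL) solb.
    rewrite mulr1 subrr => solf; eexists; eexists; split; first exact: solf.
      move=> h; apply: nf; apply: filterS h => w /eqP.
      by rewrite mulNr subr_eq0 => /eqP.
    exact: weak_solution_mean solb solf.
  have u00 : {ae L, forall x, u0 x = 0}.
    apply: (@elliptic_eigenfunction R d u0 g0 A (lambda * (1 + \int[P]_w b w))) => //.
    move=> f h fh; rewrite (eigenfunction_macro uE ud fh) -mulrA; congr (_ * _).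
    rewrite mulrDl mul1r; congr (_ + _); have [fL _ _] := fh.
    rewrite mulrC -(RintZ _ (L2_rintg bL)); apply: ae_eq_Rintegral.
    - exact: (measurable_wint fL u1L).
    - exact: measurable_funM (L2_measurable bL).
    - exact: wE.
  apply: nu; apply: (eigenfunction_eq0 ud u00) => f tf.
  have fL := test_function_L2 tf; apply: filterS (wE f fL) => w ->.
  rewrite (_ : \int[L]_x _ = 0) ?mul0r// -(Rint0 L); apply: ae_eq_Rintegral.
  - exact: measurable_funM (L2_measurable u0L) (L2_measurable fL).
  - exact: measurable_cst.
  - by apply: filterS u00 => x ->; rewrite mul0r.
have c0 f : f \in Lfun L 2%:E -> \int[L]_x (u0 x * f x) = 0.
  move=> fL; apply: contrapT => /eqP c0; apply: nosol.
  (* For a nonzero pairing c this solves c + k c = 1, so that a multiple of the average would be the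
     missing solution b. *)
  pose k := (\int[L]_x (u0 x * f x))^-1 - 1.
  have := weak_solutionD TE d0 k (sol f fL) (sol f fL).
  rewrite (_ : _ + k * _ = 1); first by move=> h; eexists; eexists; exact: h.
  by rewrite /k mulrBl mul1r mulVf// addrC subrK.
have u00 : {ae L, forall x, u0 x = 0}.
  apply: sqint_eq0; first exact: L2_measurable u0L.
  (* The weight is u0 itself. *)
  by rewrite -(integral_sqE u0L); congr EFin; exact: (c0 u0 u0L).
have ud' := u0_eq0_Vdecomp ud u00.
have [f [tf nf]] : exists f, test_function f /\ ~ {ae P, forall w, wint f u1 w = 0}.
  apply: contrapT => h; apply: nu; apply: (eigenfunction_eq0 ud u00) => f tf.
  by apply: contrapT => nf; apply: h; exists f.
have fL := test_function_L2 tf.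
exists (wint f u1), (fun w => \row_j wint f (fun z => g1 z 0 j) w); split => //.
  by have := sol f fL; rewrite c0.
have := eigenfunction_macro uE ud' (test_function_W12 tf).
under eq_Rintegral do rewrite mxform0l.
rewrite Rint0 => E; rewrite [RHS]E; congr (_ * _).
under [X in _ = X + _]eq_Rintegral do rewrite mul0r.
by rewrite Rint0 add0r.
Qed.

Lemma A_hom_eigenvalue lambda psi : W120 P T O psi -> ~ {ae P, forall w, psi w = 0} ->
  neg_Delta P T O psi (fun w => lambda * psi w) -> \int[P]_w psi w = 0 ->
  exists u, ~ {ae mu, forall z, u z = 0} /\ A_hom P T O A u (fun z => lambda * u z).
Proof.
move=> Wp np nD mp0; have [gp gpE] := W120_grad Wp.
have [_ _ sol] := (neg_Delta_weak_solution TE mO oO d0 lambda gpE).1 nD.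
have pL := W120_L2 d0 Wp.
(* The second component of V carries no derivative in x, so the indicator of a cube is an admissible
   profile. *)
pose chi : 'rV[R]_d -> R := \1_(cube d 1).
have chiL : chi \in Lfun L 2%:E.
  apply/L2P; split; first by apply: measurable_indic; exact: measurable_box.
  have /rintgP[_] := rintg_indic_cube (R := R) (n := d) 1; rewrite /sqint.
  rewrite (eq_integral (fun x => (chi x ^+ 2)%:E))// => x _; congr EFin.
  by rewrite /chi indicE; case: (_ \in _); rewrite ?expr1n ?expr0n ?normr1 ?normr0.
pose u z := chi z.1 * psi z.2; have ud := Vdecomp_prod chiL Wp gpE.
have uL : u \in Lfun mu 2%:E by exact: L2_prod.
have uO : {ae mu, forall z, \1_O z.2 * u z = u z}.
  have [_ sp] := Wp; have := @ae_snd R d _ _ P _ sp; apply: filterS => z E.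
  by rewrite /u mulrCA E.
exists u; split.
  move=> u0; apply: np; apply: sqint_eq0; first exact: L2_measurable pL.
  have := ae_eq0_sqint (L2_measurable uL) u0.
  rewrite [LHS](sqint_prod P (L2_measurable chiL) (L2_measurable pL)) => /eqP.
  rewrite mule_eq0 => /orP[|/eqP//].
  rewrite -(integral_sqE chiL) (_ : \int[L]_x (chi x ^+ 2) = (1 *+ 2) ^+ d); last first.
    rewrite -(Rint_indic_cube ler01); apply: eq_Rintegral => x _.
    by rewrite /chi indicE; case: (_ \in _); rewrite ?expr1n ?expr0n.
  by rewrite eqe expf_eq0 (_ : 1 *+ 2 == 0 = false) ?andbF// pnatr_eq0.
split.
- by exists (fun=> 0), (fun=> 0), u, (fun z => chi z.1 *: gp z.2).
- split; first exact: L2Z.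
  exists (fun=> 0), (fun z => lambda * u z); split; [exact: L20|exact: L2Z| |].
    by apply: filterS uO => z E; rewrite mulrCA E.
  by apply: aeW => z; rewrite add0r.
(* The decomposition of u is arbitrary here. Outside O both u and u1 vanish, which forces u0 = 0;
   then g0 = 0 and u1 = u, and g1 is determined by the uniqueness of stochastic derivatives. *)
move=> u0 g0 u1 g1 phi phi0 h0 phi1 h1 [_ [u0L g0L wg0] [u1L g1L ug1] uE] [pL' [p0L h0L _] [p1L h1L ph1] phiE].
have u1O : {ae mu, forall z, \1_O z.2 * u1 z = u1 z}.
  by apply: ae_supported_prod => //; apply: filterS ug1 => x [[]].
have PO' : (0 < P (~` O))%E by rewrite probability_setC// sube_gt0.
have u00 : {ae L, forall x, u0 x = 0}.
  apply: (ae_fst_inv (measurableC mO) PO').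
  apply: filterS3 uE uO u1O => z E E' E'' nO.
  move: E' E''; rewrite indicE memNset// !mul0r => E' E''.
  by move: E; rewrite -E' -E'' addr0.
have g00 (j : 'I_d) : {ae L, forall x, g0 x 0 j = 0}.
  apply: (@fundamental_lemma_leb R d _ _ P) => // f tf.
  apply: oppr_inj; rewrite -(wg0 f tf j) oppr0 -(Rint0 L); apply: ae_eq_Rintegral.
  - apply: measurable_funM; first exact: L2_measurable u0L.
    exact: test_function_measurable (test_function_pd j tf).
  - exact: measurable_cst.
  - by apply: filterS u00 => x ->; rewrite mul0r.
have u1E : {ae mu, forall z, u1 z = u z}.
  by apply: filterS2 uE (ae_fst P u00) => z -> /= ->; rewrite add0r.
have g1E : {ae L, forall x, {ae P, forall w, g1 (x, w) = chi x *: gp w}}.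
  apply: filterS2 ug1 (ae_prodl u1E) => x [Wx gx] ux.
  have : forall j : 'I_d, {ae P, forall w, g1 (x, w) 0 j = (chi x *: gp w) 0 j}.
    move=> j.
    have h2 : stoch_deriv P T j (fun w => u1 (x, w)) (fun w => (chi x *: gp w) 0 j).
      have gpx := stoch_gradZ TE (chi x) gpE.
      apply: ae_eq_stoch_deriv (gpx j) => //.
      - exact: (W120_L2 d0 Wx).
      - exact: (stoch_grad_L2 j gpx).
      - by apply: filterS ux => w ->.
      - exact: aeW.
    exact: stoch_deriv_unique (gx j) h2.
  by move=> /filter_forall; apply: filterS => w E; apply/rowP.
have -> : \int[L]_x mxform A (g0 x) (h0 x) = 0.
  rewrite -(Rint0 L); apply: ae_eq_Rintegral.
  - exact: rintg_measurable (mxform_rintg A g0L h0L).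
  - exact: measurable_cst.
  - by move: g00 => /filter_forall; apply: filterS => x E; rewrite (_ : g0 x = 0) ?mxform0l//;
      apply/rowP => j; rewrite E mxE.
have rd := dotv_rintg g1L h1L.
have ruphi := L2_mul_integrable uL pL'.
have ru1 := L2_mul_integrable uL p1L.
rewrite add0r (Rint_fubini1 rd).
transitivity (\int[L]_x (lambda * \int[P]_w (u (x, w) * phi1 (x, w)))).
  apply: ae_eq_Rintegral.
  - exact: rintg_measurable (rintg_fubini1 rd).
  - exact: rintg_measurable (rintgZ lambda (rintg_fubini1 ru1)).
  - apply: filterS3 g1E ug1 ph1 => x E [_ gx1] [Wx gx].
    have rx := dotv_rintg (fun j => stoch_grad_L2 j gpE) (fun j => stoch_grad_L2 j gx).
    have := sol _ _ Wx gx; rewrite mul0r add0r => Ex.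
    transitivity (\int[P]_w (chi x * dotv (gp w) (h1 (x, w)))).
      apply: ae_eq_Rintegral.
      + exact: rintg_measurable (dotv_rintg (fun j => stoch_grad_L2 j gx1) (fun j => stoch_grad_L2 j gx)).
      + exact: rintg_measurable (rintgZ (chi x) rx).
      + apply: filterS E => w ->; rewrite !dotvE mulr_sumr; apply: eq_bigr => j _.
        by rewrite mxE mulrA.
    rewrite (RintZ (chi x) rx) Ex mulrCA; congr (_ * _).
    rewrite -RintZ; last exact: L2_mul_integrable pL (W120_L2 d0 Wx).
    by apply: eq_Rintegral => w _; rewrite /u /= mulrA.
rewrite (RintZ lambda (rintg_fubini1 ru1)) -(Rint_fubini1 ru1).
have rchi := L2_fst P chiL.
have rp0 := L2_prod p0L pL.
have ru0 := L2_mul_integrable rchi rp0.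
(* The macroscopic part phi0 of the test function sees psi through its mean only: this is where
   <psi> = 0 enters. *)
have E0 : \int[mu]_z (chi z.1 * (phi0 z.1 * psi z.2)) = 0.
  rewrite (Rint_wint p0L pL rchi).
  under eq_Rintegral do rewrite wint_fst.
  by rewrite (RintZ _ (L2_rintg pL)) mp0 mulr0.
transitivity (\int[mu]_z (lambda * (chi z.1 * (phi0 z.1 * psi z.2) + u z * phi1 z))).
  by rewrite (RintZ lambda (rintgD ru0 ru1)) (RintD ru0 ru1) E0 add0r.
apply: ae_eq_Rintegral.
- exact: rintg_measurable (rintgZ lambda (rintgD ru0 ru1)).
- under eq_fun do rewrite -mulrA; exact: rintg_measurable (rintgZ lambda ruphi).
- by apply: filterS phiE => z ->; rewrite /u; ring.
Qed.

End point_spectrum_A_hom.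

Theorem proposition4p13 (R : realType) (d : nat) (disp : measure_display)
    (Omega : measurableType disp) (P : probability Omega R)
    (T : 'rV[R]_d -> Omega -> Omega) (O : set Omega)
    (rho : R) (N : nat) (gamma r0 : R) (A1 A1hom : 'M[R]_d)
    (d_gt0 : (0 < d)%N)
    (P_complete : measure_is_complete P)
    (P_countably_generated : countably_generated P)
    (T_ergodic : ergodic_dynamical_system P T)
    (O_inclusions : random_inclusions P T O rho N gamma r0)
    (A1_sym : A1^T = A1)
    (A1_posdef : forall xi : 'rV[R]_d, xi != 0 -> 0 < mxform A1 xi xi)
    (A1hom_def : hom_matrix P T O A1 A1hom) :
  point_spectrum (leb R d \x P)%E (A_hom P T O A1hom) =
  [set lambda | point_spectrum P (neg_Delta P T O) lambda /\
    exists psi : Omega -> R,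
      [/\ W120 P T O psi, ~ {ae P, forall w, psi w = 0},
          neg_Delta P T O psi (fun w => lambda * psi w) &
          \int[P]_w psi w = 0]].
Proof.
have mO := inclusions_measurable O_inclusions.
have /andP[_ PO1] := inclusions_proba O_inclusions.
have d1 := random_inclusions_dim d_gt0 T_ergodic O_inclusions.
have oO := ae_open_inclusions O_inclusions.
have Apos := hom_matrix_coord T_ergodic d1 (inclusions_r0 O_inclusions) mO
  (ae_separated_inclusions O_inclusions) A1_sym A1_posdef A1hom_def.
have [Asym _] := A1hom_def.
apply/seteqP; split => [lambda [u [u0 uE]]|lambda [_ [psi [Wpsi psi0 psiE mpsi]]]].
  have [psi [gpsi [sol psi0 mpsi]]] :=
    eigenvalue_A_hom T_ergodic mO d_gt0 Asym Apos uE u0.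
  have [psi1 [W1 n1 E1 m1]] :=
    zero_mean_eigenfunction T_ergodic mO PO1 oO d_gt0 sol psi0 mpsi.
  by split; [exists psi1|exists psi1].
exact: (A_hom_eigenvalue _ T_ergodic mO PO1 oO d_gt0 Wpsi psi0 psiE mpsi).
Qed.
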